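(* Let $d\ge 1$, $p\ge 2$ be integers, $s\in\mathbb{R}$, $T>0$. Let $\phi=\phi(n,n_1,\dots,n_p)\in\mathbb{R}$ and $m=m(n,n_1,\dots,n_p)\in\mathbb{C}$ be given functions on $(\mathbb{Z}^d)^{p+1}$ and consider the equation $$\partial_t\omega_n(t)=\sum_{n=n_1+\dots+n_p}e^{it\phi}\,m\,\omega_{n_1}(t)\omega_{n_2}(t)\cdots\omega_{n_p}(t)+\mathcal{R}[\omega]_n(t),\qquad n\in\mathbb{Z}^d. \quad ( * )$$ Assume that $\mathcal{R}[\omega]\in C([0,T];\ell^2_s)$ for any $\omega\in C([0,T];\ell^2_s)$ and that, for all $\omega,\tilde\omega\in C_T\ell^2_s:=C([0,T];\ell^2_s)$, $$\|\mathcal{R}[\omega]\|_{C_T\ell^2_s}\le C(\|\omega\|_{C_T\ell^2_s}),\qquad \|\mathcal{R}[\omega]-\mathcal{R}[\tilde\omega]\|_{C_T\ell^2_s}\le C(\|\omega\|_{C_T\ell^2_s},\|\tilde\omega\|_{C_T\ell^2_s})\,\|\omega-\tilde\omega\|_{C_T\ell^2_s}.$$ Assume further that there is a Banach space $X$ of functions on $\mathbb{Z}^d$ with the property that $|\omega_n|\le|\tilde\omega_n|$ for all $n\in\mathbb{Z}^d$ implies $\|\omega\|_X\le C\|\tilde\omega\|_X$, for which at least one of the following [A], [B] holds. [A] There exist $\delta\in(0,\frac12)$ and $C>0$ such that $$(A1)\quad \Big\|\sum_{n=n_1+\dots+n_p}\frac{|m|}{\langle\phi\rangle^{1/2}}\omega^{(1)}_{n_1}\cdots\omega^{(p)}_{n_p}\Big\|_{\ell^2_s}\le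 C\prod_{j=1}^p\|\omega^{(j)}\|_{\ell^2_s},$$ $$(A2)\quad \Big\|\sum_{n=n_1+\dots+n_p}\frac{|m|}{\langle\phi\rangle^{1-\delta}}\omega^{(1)}_{n_1}\cdots\omega^{(p)}_{n_p}\Big\|_{X}\le C\min_{1\le j\le p}\Big[\|\omega^{(j)}\|_X\prod_{l\ne j}\|\omega^{(l)}\|_{\ell^2_s}\Big],$$ $$(A3)\quad \Big\|\sum_{n=n_1+\dots+n_p}|m|\,\omega^{(1)}_{n_1}\cdots\omega^{(p)}_{n_p}\Big\|_{X}\le C\prod_{j=1}^p\|\omega^{(j)}\|_{\ell^2_s}.$$ [B] There exist $s_1<s<s_2$ and $C>0$ such that $$(B1)\quad \sup_{\mu\in\mathbb{Z}}\Big\|\sum_{\substack{n=n_1+\dots+n_p\\ \mu\le\phi<\mu+1}}|m|\,\omega^{(1)}_{n_1}\cdots\omega^{(p)}_{n_p}\Big\|_{\ell^2_{s_1}}\le C\prod_{j=1}^p\|\omega^{(j)}\|_{\ell^2_{s_1}},$$ $$(B1)'\quad \Big\|\sum_{n=n_1+\dots+n_p}|m|\,\omega^{(1)}_{n_1}\cdots\omega^{(p)}_{n_p}\Big\|_{\ell^2_{s_2}}\le C\prod_{j=1}^p\|\omega^{(j)}\|_{\ell^2_{s_2}},$$ $$(B2)\quad \sup_{\mu\in\mathbb{Z}}\Big\|\sum_{\substack{n=n_1+\dots+n_p\\ \mu\le\phi<\mu+1}}|m|\,\omega^{(1)}_{n_1}\cdots\omega^{(p)}_{n_p}\Big\|_{X}\le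 C\min_{1\le j\le p}\Big[\|\omega^{(j)}\|_X\prod_{l\ne j}\|\omega^{(l)}\|_{\ell^2_{s_1}}\Big],$$ $$(B2)'\quad \Big\|\sum_{n=n_1+\dots+n_p}|m|\,\omega^{(1)}_{n_1}\cdots\omega^{(p)}_{n_p}\Big\|_{X}\le C\min_{1\le j\le p}\Big[\|\omega^{(j)}\|_X\prod_{l\ne j}\|\omega^{(l)}\|_{\ell^2_{s_2}}\Big],$$ $$(B3)\quad \Big\|\sum_{n=n_1+\dots+n_p}|m|\,\omega^{(1)}_{n_1}\cdots\omega^{(p)}_{n_p}\Big\|_{X}\le C\prod_{j=1}^p\|\omega^{(j)}\|_{\ell^2_s}.$$ Then for every initial datum there is at most one solution $\omega\in C([0,T];\ell^2_s)$ of the Cauchy problem associated with $( * )$.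
   Context: Notation: $\langle x\rangle=(1+|x|^2)^{1/2}$; $\ell^2_s=\ell^2_s(\mathbb{Z}^d)$ is the space of $\omega:\mathbb{Z}^d\to\mathbb{C}$ with $\|\omega\|_{\ell^2_s}=\|\langle\cdot\rangle^s\omega\|_{\ell^2}<\infty$. For given $n$, $\sum_{n=n_1+\dots+n_p}$ is over all $(n_1,\dots,n_p)\in(\mathbb{Z}^d)^p$ with $n_1+\dots+n_p=n$, and $m,\phi$ are evaluated at $(n,n_1,\dots,n_p)$; an additional condition under the sum restricts it further. Multilinear estimates are required for all sequences in the spaces on the right-hand side, with a constant independent of these sequences, and include the assertion that the sums converge absolutely for each $n$ and define elements of the space on the left. In an estimate with a minimum over $j$, the bound is required for each $j$, whenever $\omega^{(j)}\in X$ and the other $\omega^{(l)}$ are in the indicated weighted $\ell^2$ space. In the monotonicity property of $X$, $\tilde\omega\in X$ implies $\omega\in X$. The map $\mathcal{R}$ acts pointwise in time: $\mathcal{R}[\omega](t)$ depends only on $t$ and $\omega(t)$. The symbols $C(\cdot)$, $C(\cdot,\cdot)$ denote finite constants depending only (in a nondecreasing way) on the displayed quantities. Solution: $\omega\in C([0,T];\ell^2_s)$ is a solution of the Cauchy problem for $( * )$ with initial datum $\omega_0\in\ell^2_s$ if for each $n\in\mathbb{Z}^d$ the right-hand side of $( * )$ is well-defined as a distribution in $t$, $( * )$ holds in $\mathcal{D}'((0,T))$, and $\omega(0)=\omega_0$. (Under (A3) or (B3) the right-hand side is a bounded function of $t$ for each $n$.) *)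

(* Defs.v *)
From mathcomp Require Import all_boot all_order all_algebra.
From mathcomp Require Import all_classical all_reals all_analysis.
From mathcomp Require Import complex.
Import Order.TTheory GRing.Theory Num.Theory.
Import numFieldNormedType.Exports.

Set Implicit Arguments.
Unset Strict Implicit.
Unset Printing Implicit Defensive.

Local Open Scope classical_set_scope.
Local Open Scope ring_scope.
Local Open Scope complex_scope.

(* The real-valued modulus; the norm `|z| of R[i] is itself R[i]-valued. *)
Notation cabs := ComplexField.Normc.normc.

Definition Zd (d : nat) := 'rV[int]_d.

Definition bracket (R : realType) (x : R) : R := Num.sqrt (1 + x ^+ 2).

(* |n| is the Euclidean norm on Z^d. *)
Definition bracketZ (R : realType) (d : nat) (n : Zd d) : R :=
  Num.sqrt (1 + \sum_(i < d) (n ord0 i)%:~R ^+ 2).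

(* A normed space of sequences: membership, and a norm which is meaningful on
   the members only. *)
Record seqspace (R : realType) (d : nat) := SeqSpace {
  member :> (Zd d -> R[i]) -> Prop;
  snorm : (Zd d -> R[i]) -> R }.

Definition l2_sq (R : realType) (d : nat) (s : R) (w : Zd d -> R[i]) : \bar R :=
  (\esum_(n in [set: Zd d]) ((bracketZ R n `^ s * cabs (w n)) ^+ 2)%:E)%R.

Definition l2 (R : realType) (d : nat) (s : R) : seqspace R d :=
  SeqSpace (fun w => (l2_sq s w < +oo)%E) (fun w => Num.sqrt (fine (l2_sq s w))).

(* A Banach space X with an embedding ev of X into the sequences, seen as a
   space of sequences: the norm of ev x is that of x. *)
Definition embedded (R : realType) (d : nat) (X : completeNormedModType R[i])
    (ev : X -> (Zd d -> R[i])) : seqspace R d :=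
  SeqSpace (range ev) (fun w => complex.Re `| xget 0 [set x | ev x = w] |).

Definition function_space (R : realType) (d : nat)
    (X : completeNormedModType R[i]) (ev : X -> (Zd d -> R[i])) : Prop :=
  injective ev /\
  forall (a : R[i]) (x y : X) (n : Zd d), ev (a *: x + y) n = a * ev x n + ev y n.

Definition solid (R : realType) (d : nat) (E : seqspace R d) : Prop :=
  exists C : R, forall w w' : Zd d -> R[i],
    (forall n, cabs (w n) <= cabs (w' n)) -> E w' ->
    E w /\ snorm E w <= C * snorm E w'.

(* Sums of absolutely convergent real and complex families. *)
Definition rsum (R : realType) (K : choiceType) (D : set K) (f : K -> R) : R :=
  fine (\esum_(k in D) (f^\+ k)%:E)%R - fine (\esum_(k in D) (f^\- k)%:E)%R.

Definition csum (R : realType) (K : choiceType) (D : set K) (f : K -> R[i])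
    : R[i] :=
  rsum D (fun k => complex.Re (f k)) +i* rsum D (fun k => complex.Im (f k)).

Definition abs_summable (R : realType) (K : choiceType) (D : set K)
    (f : K -> R[i]) : Prop := summable D (fun k => (cabs (f k))%:E).

Definition tuples (d p : nat) := {ffun 'I_p -> Zd d}.

Definition decomp (d p : nat) (n : Zd d) : set (tuples d p) :=
  [set k | n = \sum_(j < p) k j].

Definition window (R : realType) (d p : nat) (phi : Zd d -> tuples d p -> R)
    (mu : int) (n : Zd d) : set (tuples d p) :=
  [set k | decomp n k /\ mu%:~R <= phi n k < mu%:~R + 1].

Definition mterm (R : realType) (d p : nat) (a : Zd d -> tuples d p -> R[i])
    (w : 'I_p -> Zd d -> R[i]) (n : Zd d) (k : tuples d p) : R[i] :=
  a n k * \prod_(j < p) w j (k j).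

Definition multisum (R : realType) (d p : nat) (D : Zd d -> set (tuples d p))
    (a : Zd d -> tuples d p -> R[i]) (w : 'I_p -> Zd d -> R[i]) (n : Zd d) : R[i] :=
  csum (D n) (mterm a w n).

Definition multilinear_bound (R : realType) (d p : nat)
    (D : Zd d -> set (tuples d p)) (a : Zd d -> tuples d p -> R) (C : R)
    (source : 'I_p -> seqspace R d) (target : seqspace R d) : Prop :=
  let aC := fun n k => (a n k)%:C in
  forall w : 'I_p -> Zd d -> R[i], (forall j, source j (w j)) ->
    [/\ forall n, abs_summable (D n) (mterm aC w n),
        target (multisum D aC w) &
        snorm target (multisum D aC w) <= C * \prod_(j < p) snorm (source j) (w j)].

(* w^(j) is taken in X and the other w^(l) in E. *)
Definition one_in (R : realType) (d p : nat) (j : 'I_p) (X E : seqspace R d)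
    : 'I_p -> seqspace R d :=
  fun l => if l == j then X else E.

Definition condition_A (R : realType) (d p : nat) (s : R)
    (phi : Zd d -> tuples d p -> R) (m : Zd d -> tuples d p -> R[i])
    (X : seqspace R d) : Prop :=
  exists delta C : R, [/\ 0 < delta < 2^-1, 0 < C,
    multilinear_bound (@decomp d p)
      (fun n k => cabs (m n k) / bracket (phi n k) `^ 2^-1) C
      (fun=> l2 d s) (l2 d s),
    forall j : 'I_p, multilinear_bound (@decomp d p)
      (fun n k => cabs (m n k) / bracket (phi n k) `^ (1 - delta)) C
      (one_in j X (l2 d s)) X &
    multilinear_bound (@decomp d p) (fun n k => cabs (m n k)) C
      (fun=> l2 d s) X].

Definition condition_B (R : realType) (d p : nat) (s : R)
    (phi : Zd d -> tuples d p -> R) (m : Zd d -> tuples d p -> R[i])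
    (X : seqspace R d) : Prop :=
  let absm := fun n k => cabs (m n k) in
  exists s1 s2 C : R, [/\ s1 < s < s2, 0 < C,
    (forall mu : int, multilinear_bound (window phi mu) absm C
       (fun=> l2 d s1) (l2 d s1)) /\
    multilinear_bound (@decomp d p) absm C (fun=> l2 d s2) (l2 d s2),
    (forall (mu : int) (j : 'I_p), multilinear_bound (window phi mu) absm C
       (one_in j X (l2 d s1)) X) /\
    (forall j : 'I_p, multilinear_bound (@decomp d p) absm C
       (one_in j X (l2 d s2)) X) &
    multilinear_bound (@decomp d p) absm C (fun=> l2 d s) X].

(* Curves are functions on all of R, of which only the values on [0, T]
   matter. *)
Definition CTl2 (R : realType) (d : nat) (T s : R) (w : R -> Zd d -> R[i]) : Prop :=
  forall t : R, t \in `[0, T] ->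
    l2 d s (w t) /\
    (fun t' => snorm (l2 d s) (w t' \- w t)) @ within `[0, T] (nbhs t) --> (0 : R).

Definition CTl2_norm (R : realType) (d : nat) (T s : R) (w : R -> Zd d -> R[i]) : R :=
  sup [set snorm (l2 d s) (w t) | t in `[0, T]].

Definition admissible_remainder (R : realType) (d : nat) (T s : R)
    (Rem : (R -> Zd d -> R[i]) -> (R -> Zd d -> R[i])) : Prop :=
  [/\ forall w, CTl2 T s w -> CTl2 T s (Rem w),
      forall w w', CTl2 T s w -> CTl2 T s w' ->
        forall t : R, t \in `[0, T] -> w t = w' t -> Rem w t = Rem w' t,
      exists C : R -> R,
        (forall a a' : R, 0 <= a <= a' -> C a <= C a') /\
        forall w, CTl2 T s w -> CTl2_norm T s (Rem w) <= C (CTl2_norm T s w) &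
      exists C : R -> R -> R,
        (forall a a' b b' : R, 0 <= a <= a' -> 0 <= b <= b' -> C a b <= C a' b') /\
        forall w w', CTl2 T s w -> CTl2 T s w' ->
          CTl2_norm T s (fun t => Rem w t \- Rem w' t) <=
          C (CTl2_norm T s w) (CTl2_norm T s w') *
            CTl2_norm T s (fun t => w t \- w' t)].

Definition expi (R : realType) (x : R) : R[i] := cos x +i* sin x.

Definition rhs (R : realType) (d p : nat)
    (phi : Zd d -> tuples d p -> R) (m : Zd d -> tuples d p -> R[i])
    (Rem : (R -> Zd d -> R[i]) -> (R -> Zd d -> R[i]))
    (w : R -> Zd d -> R[i]) (n : Zd d) (t : R) : R[i] :=
  multisum (@decomp d p) (fun n k => expi (t * phi n k) * m n k) (fun=> w t) n
    + Rem w t n.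

(* Real-valued test functions on ]0, T[ suffice: by linearity they determine a
   complex distribution. *)
Definition test_function (R : realType) (T : R) (psi : R -> R) : Prop :=
  (forall (k : nat) (x : R), derivable (derive1n k psi) x 1) /\
  exists K : set R, [/\ compact K, K `<=` `]0, T[ &
    forall x, ~ K x -> psi x = 0].

Definition Clocally_integrable (R : realType) (D : set R) (f : R -> R[i]) : Prop :=
  locally_integrable D (fun t => complex.Re (f t)) /\
  locally_integrable D (fun t => complex.Im (f t)).

Definition Cintegral (R : realType) (D : set R) (f : R -> R[i]) : R[i] :=
  (\int[lebesgue_measure]_(t in D) complex.Re (f t)) +i*
  (\int[lebesgue_measure]_(t in D) complex.Im (f t)).

(* u' = f in D'(]0, T[), for locally integrable u and f. *)
Definition distr_deriv (R : realType) (T : R) (u f : R -> R[i]) : Prop :=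
  forall psi : R -> R, test_function T psi ->
    - Cintegral `]0, T[ (fun t => (derive1 psi t)%:C * u t) =
    Cintegral `]0, T[ (fun t => (psi t)%:C * f t).

Definition solution (R : realType) (d p : nat) (T s : R)
    (phi : Zd d -> tuples d p -> R) (m : Zd d -> tuples d p -> R[i])
    (Rem : (R -> Zd d -> R[i]) -> (R -> Zd d -> R[i]))
    (w0 : Zd d -> R[i]) (w : R -> Zd d -> R[i]) : Prop :=
  [/\ CTl2 T s w,
      forall n,
        (forall t : R, t \in `]0, T[ -> abs_summable (decomp n)
           (mterm (fun n k => expi (t * phi n k) * m n k) (fun=> w t) n)) /\
        Clocally_integrable `]0, T[ (rhs phi m Rem w n),
      forall n, distr_deriv T (fun t => w t n) (rhs phi m Rem w n) &
      w 0 = w0].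

(* Main.v *)
(* Let v = w - w'. To a state, that is a finite list sg of frequencies, attach
   the difference V_sg of the products of w and of w' over sg. A move replaces
   one frequency n of sg by n_1, ..., n_p with n = n_1 + ... + n_p. The time
   derivative of V_sg is the sum of e^{it phi} m V_tau over the moves sg -> tau,
   plus the contribution of the remainder. When the phase of the move, added to
   those of the previous moves, is large, one integrates by parts: this gives a
   boundary term B and leads to the moves from tau. The other moves are estimated
   directly. What is left after K steps is small by (A3) or (B3).

   If |v(t)| <= g(t) in l2_s, then |V_sg| <= g prod_{n in sg} Y_n for
   Y = |w| + |w'| + |R[w]| + |R[w']| + (|v| + |R[w] - R[w']|) / g, which lies in
   a ball of l2_s that does not depend on g. Every term thus reduces to sums over
   moves of products of one nonnegative sequence. These are bounded by a
   potential P_i(sg), the product over sg of the image of Y by finitely many maps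
   y -> y + c_i N(y), where N is the multilinear operator of (A1) or (B1) and
   c_i = c / 2^i: expanding the product shows that one move loses at most 1 / c_i.
   Replacing products by their derivatives in the direction of a sequence of X,
   (A2) and (B2) yield the same for the rest. Under (B) the operators depend on the
   integer parts of the phases, over which one sums with weights, and l2_s is
   reached by geometric interpolation between l2_{s1} and l2_{s2}.

   For g = G e^{Lt}, a small constant in front of the boundary term and a large L
   give |v| <= g / 2 in l2_s; iterating, v = 0. The equation holds in the
   classical sense for each frequency, since the tails of the sums are small
   uniformly in time, so that the right-hand side is continuous in t. *)

Require Import Defs.
From mathcomp Require Import all_boot all_order all_algebra.
From mathcomp Require Import ring lra zify.
From mathcomp Require Import all_classical all_reals all_analysis.
From mathcomp Require Import complex finmap.
Import Order.TTheory GRing.Theory Num.Theory.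
Import numFieldNormedType.Exports.

Set Implicit Arguments.
Unset Strict Implicit.
Unset Printing Implicit Defensive.

Local Open Scope classical_set_scope.
Local Open Scope ring_scope.
Local Open Scope complex_scope.

(** * Products over states and moves *)

(** After [K] moves from a single frequency a state has [1 + K * p.-1] entries, so the choices of
    positions along a chain of moves grow like a factorial of [K], and bounds taken chain by chain
    would not converge. The potentials answer this obstacle: by the Leibniz rule, the sum over all
    positions of a move is a directional derivative of a product, and it costs [1 / c i] whatever
    the length of the state. The factors [2 ^ i] lost in this way are recovered by letting the
    thresholds of resonance grow geometrically with [i]. Nothing compares X with l2_s. X enters only
    through point evaluations of a remainder whose norm grows like [2 ^ K] while its coefficient is
    [4 ^- K]. This dictates the order of choices: the radius [C0], then [c], [b], the thresholds
    with their errors [e], and [L], all independent of [K]. Only then does [K] tend to infinity, for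
    finitely many frequencies and up to an arbitrary [eta]. All sums over moves are finite, with
    bounds that do not depend on the finite sets. *)

Lemma ler_eq (R : numDomainType) (x y : R) : x = y -> x <= y.
Proof. by move=> ->. Qed.

Section ListProducts.
Variables (I : eqType) (p : nat).
Implicit Types (n : I) (s : seq I) (k : {ffun 'I_p -> I}).

Definition lprod (R : comNzRingType) (y : I -> R) s : R := \prod_(n <- s) y n.

(** The derivative of [lprod] at [y] in the direction [z]: each factor in turn is replaced by
    [z]. *)
Fixpoint ldiff (R : comNzRingType) (y z : I -> R) s : R :=
  if s is n :: s' then z n * lprod y s' + y n * ldiff y z s' else 0.

Definition children k : seq I := [seq k j | j <- enum 'I_p].

(* A move (n, k, s') replaces one entry n of s by the entries of k. *)
Fixpoint moves (D : I -> seq {ffun 'I_p -> I}) s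
    : seq (I * {ffun 'I_p -> I} * seq I) :=
  if s is n :: s' then
    [seq (n, k, children k ++ s') | k <- D n] ++
    [seq (v.1, n :: v.2) | v <- moves D s']
  else [::].

Section Ring.
Variable R : comNzRingType.
Implicit Types (y z : I -> R).

Lemma lprod_cons y n s : lprod y (n :: s) = y n * lprod y s.
Proof. by rewrite /lprod big_cons. Qed.

Lemma lprod_nil y : lprod y [::] = 1.
Proof. by rewrite /lprod big_nil. Qed.

Lemma lprod_cat y s1 s2 : lprod y (s1 ++ s2) = lprod y s1 * lprod y s2.
Proof. by rewrite /lprod big_cat. Qed.

Lemma lprod_children y k : lprod y (children k) = \prod_(j < p) y (k j).
Proof. by rewrite /lprod /children big_map big_enum. Qed.

Lemma ldiff_cat y z s1 s2 :
  ldiff y z (s1 ++ s2) = ldiff y z s1 * lprod y s2 + lprod y s1 * ldiff y z s2.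
Proof.
elim: s1 => [|n s1 IH] /=; first by rewrite lprod_nil mul0r add0r mul1r.
rewrite IH lprod_cat lprod_cons; ring.
Qed.

(** [uniq] lets the test [l == j] single out one position, while the values [f j] may repeat. *)
Lemma ldiff_map (J : eqType) y z (f : J -> I) (r : seq J) : uniq r ->
  ldiff y z [seq f j | j <- r] =
  \sum_(j <- r) \prod_(l <- r) (if l == j then z else y) (f l).
Proof.
elim: r => [_|j r IH] /=; first by rewrite big_nil.
move=> /andP[jr ur]; rewrite big_cons big_cons eqxx IH //; congr (_ * _ + _).
  rewrite /lprod big_map; apply: eq_big_seq => l lr.
  by case: eqP => // ej; rewrite -ej lr in jr.
rewrite mulr_sumr; apply: eq_big_seq => l lr; rewrite big_cons.
by case: eqP => // ej; rewrite ej lr in jr.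
Qed.

Lemma ldiff_children y z k :
  ldiff y z (children k) = \sum_(j < p) \prod_(l < p) (if l == j then z else y) (k l).
Proof.
rewrite /children ldiff_map ?enum_uniq // big_enum.
by apply: eq_bigr => j _; rewrite big_enum.
Qed.

Lemma ldiffD y z z' s :
  ldiff y (fun n => z n + z' n) s = ldiff y z s + ldiff y z' s.
Proof. by elim: s => [|n s /= ->]; [rewrite /= addr0|ring]. Qed.

Lemma ldiff_diag y s : ldiff y y s = (size s)%:R * lprod y s.
Proof.
elim: s => [|n s IH] /=; first by rewrite mul0r.
rewrite IH lprod_cons -natr1; ring.
Qed.

Lemma big_moves_cons (V : nmodType) D n s (g : I * {ffun 'I_p -> I} * seq I -> V) :
  \sum_(v <- moves D (n :: s)) g v =
  \sum_(k <- D n) g (n, k, children k ++ s) +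
  \sum_(v <- moves D s) g (v.1, n :: v.2).
Proof. by rewrite /= big_cat /= !big_map. Qed.

(** The Leibniz rule: a move acts on one entry, so summing over the moves is a derivation of
    products, along the image of [y] under the operator of kernel [K]. *)
Lemma sum_moves_lprod D (K : I -> {ffun 'I_p -> I} -> R) y s :
  \sum_(v <- moves D s) K v.1.1 v.1.2 * lprod y v.2 =
  ldiff y (fun n => \sum_(k <- D n) K n k * lprod y (children k)) s.
Proof.
elim: s => [|n s IH]; first by rewrite big_nil.
rewrite big_moves_cons /= -IH mulr_suml mulr_sumr; congr (_ + _).
  by apply: eq_bigr => k _; rewrite lprod_cat mulrA.
by apply: eq_bigr => v _; rewrite lprod_cons mulrCA.
Qed.

End Ring.

Section Order.
Variable R : realFieldType.
Implicit Types (y z N M : I -> R) (c : R).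

Lemma lprod_ge0 y s : (forall n, 0 <= y n) -> 0 <= lprod y s.
Proof. by move=> y0; rewrite /lprod; apply: prodr_ge0. Qed.

Lemma ldiff_ge0 y z s : (forall n, 0 <= y n) -> (forall n, 0 <= z n) ->
  0 <= ldiff y z s.
Proof.
move=> y0 z0; elim: s => //= n s IH.
by rewrite addr_ge0 ?mulr_ge0 ?lprod_ge0.
Qed.

Lemma le_ldiff y z z' s : (forall n, 0 <= y n) -> (forall n, z n <= z' n) ->
  ldiff y z s <= ldiff y z' s.
Proof.
move=> y0 zz; elim: s => //= n s IH.
by rewrite lerD ?ler_wpM2l ?ler_wpM2r ?lprod_ge0.
Qed.

Lemma le_lprod y y' s : (forall n, 0 <= y n) -> (forall n, y n <= y' n) ->
  lprod y s <= lprod y' s.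
Proof.
by move=> y0 yy; rewrite /lprod; apply: ler_prod => n _; rewrite y0 yy.
Qed.

Lemma le_ldiff2 y y' z z' s : (forall n, 0 <= y n) -> (forall n, 0 <= z n) ->
  (forall n, y n <= y' n) -> (forall n, z n <= z' n) ->
  ldiff y z s <= ldiff y' z' s.
Proof.
move=> y0 z0 yy zz; elim: s => //= n s IH.
by apply: lerD; apply: ler_pM; rewrite ?lprod_ge0 ?ldiff_ge0 ?le_lprod.
Qed.

(** The left side keeps the terms of order 0 and 1 in [c] of the expanded product, and the others
    are nonnegative. Divided by [c], it bounds a sum over the positions of [s] regardless of its
    length. *)
Lemma lprodDM y N c s : (forall n, 0 <= y n) -> (forall n, 0 <= N n) -> 0 <= c ->
  lprod y s + c * ldiff y N s <= lprod (fun n => y n + c * N n) s.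
Proof.
move=> y0 N0 c0; elim: s => [|n s IH]; first by rewrite !lprod_nil /= mulr0 addr0.
rewrite !lprod_cons /=.
have le1 : lprod y s <= lprod (fun n => y n + c * N n) s.
  by apply: le_lprod => // i; rewrite lerDl mulr_ge0.
have := ler_wpM2l (y0 n) IH.
have := ler_wpM2l (mulr_ge0 c0 (N0 n)) le1.
nra.
Qed.

(** After a move, the factor [z] sits either among the children, which [M] absorbs as a bound for
    the derivative of the operator, or on an untouched entry, and then the children are absorbed by
    [N]. *)
Lemma ldiffDM D (K : I -> {ffun 'I_p -> I} -> R) y z N M c s :
  (forall n, 0 <= y n) -> (forall n, 0 <= z n) ->
  (forall n, 0 <= N n) -> (forall n, 0 <= M n) -> 0 <= c ->
  (forall n, \sum_(k <- D n) K n k * lprod y (children k) <= N n) ->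
  (forall n, \sum_(k <- D n) K n k * ldiff y z (children k) <= M n) ->
  ldiff y z s + c * \sum_(v <- moves D s) K v.1.1 v.1.2 * ldiff y z v.2 <=
  ldiff (fun n => y n + c * N n) (fun n => z n + c * M n) s.
Proof.
move=> y0 z0 N0 M0 c0 hN hM; elim: s => [|n s IH].
  by rewrite big_nil /= mulr0 addr0.
rewrite big_moves_cons.
have -> : \sum_(k <- D n) K n k * ldiff y z (children k ++ s) =
    (\sum_(k <- D n) K n k * ldiff y z (children k)) * lprod y s +
    (\sum_(k <- D n) K n k * lprod y (children k)) * ldiff y z s.
  rewrite !mulr_suml -big_split; apply: eq_bigr => k _ /=.
  rewrite ldiff_cat; ring.
have -> : \sum_(v <- moves D s) K v.1.1 v.1.2 * ldiff y z (n :: v.2) =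
    z n * (\sum_(v <- moves D s) K v.1.1 v.1.2 * lprod y v.2) +
    y n * \sum_(v <- moves D s) K v.1.1 v.1.2 * ldiff y z v.2.
  rewrite !mulr_sumr -big_split; apply: eq_bigr => v _ /=; ring.
rewrite /=; set S := \sum_(v <- _) _ * ldiff y z _ in IH *.
rewrite sum_moves_lprod; set E := ldiff y (fun n0 => \sum_(k <- D n0) _ n0 k * _) s.
set y' := fun n => y n + c * N n; set z' := fun n => z n + c * M n.
have hE : lprod y s + c * E <= lprod y' s.
  apply: le_trans (lprodDM s y0 N0 c0); rewrite lerD2l.
  by apply: ler_wpM2l => //; apply: le_ldiff.
have y0' i : 0 <= y' i by rewrite addr_ge0 ?mulr_ge0.
have le1 : lprod y s <= lprod y' s.
  by apply: le_lprod => // i; rewrite lerDl mulr_ge0.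
have le2 : ldiff y z s <= ldiff y' z' s.
  by apply: le_ldiff2 => // i; rewrite lerDl mulr_ge0.
(* The claim is the sum of the six inequalities [a1] to [a6]. *)
have a1 := ler_wpM2l (z0 n) hE.
have a2 := ler_wpM2l (y0 n) IH.
have a3 : c * M n * lprod y s <= c * M n * lprod y' s.
  by apply: ler_wpM2l => //; rewrite mulr_ge0.
have a4 : c * N n * ldiff y z s <= c * N n * ldiff y' z' s.
  by apply: ler_wpM2l => //; rewrite mulr_ge0.
have a5 : c * ((\sum_(k <- D n) K n k * ldiff y z (children k)) * lprod y s) <=
    c * (M n * lprod y s).
  by apply/ler_wpM2l/ler_wpM2r => //; apply: lprod_ge0.
have a6 : c * ((\sum_(k <- D n) K n k * lprod y (children k)) * ldiff y z s) <=
    c * (N n * ldiff y z s).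
  by apply/ler_wpM2l/ler_wpM2r => //; apply: ldiff_ge0.
rewrite /y' /z' in a1 a2 a3 a4 a5 a6 *; lra.
Qed.

End Order.
End ListProducts.

(** * Potentials *)

(* [E r y] reads: y is nonnegative, and has norm at most r. *)
Definition norm_balls (R : realFieldType) (I : Type) (E : R -> (I -> R) -> Prop) :=
  [/\ forall r y n, E r y -> 0 <= y n,
      E 0 (fun=> 0),
      forall r r' y y', E r y -> E r' y' -> E (r + r') (fun n => y n + y' n),
      forall a r y, 0 <= a -> E r y -> E (a * r) (fun n => a * y n) &
      forall r r' y, E r y -> r <= r' -> E r' y].

Section Balls.
Variables (R : realFieldType) (I : Type) (E : R -> (I -> R) -> Prop).
Hypothesis hE : norm_balls E.

Lemma norm_balls_sum (J : eqType) (l : seq J) (a : J -> R) (y : J -> I -> R) r :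
  (forall j, j \in l -> 0 <= a j) -> (forall j, j \in l -> E r (y j)) ->
  E ((\sum_(j <- l) a j) * r) (fun n => \sum_(j <- l) a j * y j n).
Proof.
case: hE => _ E0 ED EZ _.
elim: l => [|j l IH] ha hy.
  rewrite big_nil mul0r (_ : (fun _ => _) = fun=> 0) //.
  by apply/funext => n; rewrite big_nil.
rewrite big_cons mulrDl.
rewrite (_ : (fun _ => _) = fun n => a j * y j n + \sum_(i <- l) a i * y i n).
  apply: ED; first by apply: EZ; [apply: ha|apply: hy]; rewrite mem_head.
  by apply: IH => i il; [apply: ha|apply: hy]; rewrite in_cons il orbT.
by apply/funext => n; rewrite big_cons.
Qed.

End Balls.

Section Potentials.
Variables (R : realFieldType) (I Lab : eqType) (p : nat).
Variables (E X : R -> (I -> R) -> Prop).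
Hypotheses (hE : norm_balls E) (hX : norm_balls X).

Variables (wt : Lab -> R) (box : seq Lab).
Hypotheses (wt0 : forall a, 0 <= wt a) (wt1 : \sum_(a <- box) wt a <= 2^-1).

Variables (K : Lab -> Lab -> I -> {ffun 'I_p -> I} -> R).
Variables (D : I -> seq {ffun 'I_p -> I}).
Hypothesis (K0 : forall a b n k, 0 <= K a b n k).

Variables (N : Lab -> Lab -> (I -> R) -> I -> R).
Variables (M : Lab -> Lab -> (I -> R) -> (I -> R) -> I -> R).
Variable (C : R).
Hypothesis NE : forall a b r y, E r y ->
  E (C * r ^+ p) (N a b y) /\
  forall n, \sum_(k <- D n) K a b n k * lprod y (children k) <= N a b y n.
Hypothesis MX : forall a b r q y z, E r y -> X q z ->
  X (C * r ^+ p.-1 * q) (M a b y z) /\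
  forall n, \sum_(k <- D n) K a b n k * ldiff y z (children k) <= M a b y z n.

Variables (c r : nat -> R) (r0 : R) (y : I -> R).
Hypotheses (c0 : forall i, 0 < c i) (Ey : E r0 y) (r0_ge0 : 0 <= r0).
Hypothesis r0r : forall i, (1 + c i) * r0 <= r i.
Hypothesis rS : forall i, r i.+1 + c i * (C * r i.+1 ^+ p) <= r i.
Hypothesis r1 : forall i, c i * (C * r i.+1 ^+ p.-1) <= 1.
Variables (q0 : R) (z : I -> R).
Hypotheses (Xz : X q0 z) (q0_ge0 : 0 <= q0).

(* The labels are the integer parts of the phases met along a chain of moves;
   level i enlarges the majorant by its image under the operator of the i-th
   move, with a small factor [c i] that keeps the norms bounded. *)
Fixpoint ymaj i a (l : seq Lab) : I -> R :=
  if l is b :: l' then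
    fun n => ymaj i.+1 b l' n + c i * N a b (ymaj i.+1 b l') n
  else fun n => (1 + c i) * y n.

(** The counterpart of [ymaj] for the one factor that lies in X: [M a b] stands for the derivative
    of [N a b] at the majorant of the next level. *)
Fixpoint zmaj i a (l : seq Lab) : I -> R :=
  if l is b :: l' then
    fun n => zmaj i.+1 b l' n + c i * M a b (ymaj i.+1 b l') (zmaj i.+1 b l') n
  else z.

(** Shorter sequences are kept at every depth: the empty one makes a potential dominate the product
    itself, and those of the form [b :: l] leave room for a move of label [b]. *)
Fixpoint label_seqs j : seq (seq Lab) :=
  if j is j'.+1 then [::] :: [seq b :: l | b <- box, l <- label_seqs j']
  else [:: [::]].

Definition seq_wt (l : seq Lab) : R := \prod_(b <- l) wt b.

Definition pot j i a s := \sum_(l <- label_seqs j) seq_wt l * lprod (ymaj i a l) s.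

Definition dpot j i a s :=
  \sum_(l <- label_seqs j) seq_wt l * ldiff (ymaj i a l) (zmaj i a l) s.

Lemma seq_wt_ge0 l : 0 <= seq_wt l.
Proof. by rewrite /seq_wt prodr_ge0. Qed.

Lemma big_label_seqs (V : zmodType) j (f : seq Lab -> V) :
  \sum_(l <- label_seqs j.+1) f l =
  f [::] + \sum_(b <- box) \sum_(l <- label_seqs j) f (b :: l).
Proof. by rewrite /= big_cons big_allpairs_dep. Qed.

Lemma seq_wt_cons b l : seq_wt (b :: l) = wt b * seq_wt l.
Proof. by rewrite /seq_wt big_cons. Qed.

(** A geometric series: each further letter contributes a factor at most 1/2. *)
Lemma sum_seq_wt j : \sum_(l <- label_seqs j) seq_wt l <= 2.
Proof.
elim: j => [|j IH]; first by rewrite big_seq1 /seq_wt big_nil ler1n.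
rewrite big_label_seqs {1}/seq_wt big_nil.
under eq_bigr => b _ do
  (under eq_bigr => l _ do rewrite seq_wt_cons; rewrite -mulr_sumr).
rewrite -mulr_suml.
have S0 : 0 <= \sum_(l <- label_seqs j) seq_wt l.
  by apply: sumr_ge0 => l _; apply: seq_wt_ge0.
have := ler_wpM2r S0 wt1; lra.
Qed.

Lemma ymajE i a l : E (r i) (ymaj i a l).
Proof.
case: hE => _ _ ED EZ Ele; elim: l i a => [|b l IH] i a /=.
  apply: (Ele _ _ _ _ (r0r i)); apply: EZ => //.
  by rewrite addr_ge0 // ltW.
apply: (Ele _ _ _ _ (rS i)); apply: ED => //.
by apply: EZ; [exact: ltW|exact: (NE _ _ (IH _ _)).1].
Qed.

Lemma ymaj_ge0 i a l n : 0 <= ymaj i a l n.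
Proof. by case: hE => + _ _ _ _; apply; apply: ymajE. Qed.

(** By [r1] each level at most doubles the norm. This is the origin of the growth [2 ^ K] of the
    remainder. *)
Lemma zmajX i a l : X (q0 * 2 ^+ size l) (zmaj i a l).
Proof.
case: hX => _ _ ED EZ Ele; elim: l i a => [|b l IH] i a /=.
  by rewrite expr0 mulr1.
have := ED _ _ _ _ (IH i.+1 b)
  (EZ _ _ _ (ltW (c0 i)) (MX a b (ymajE i.+1 b l) (IH i.+1 b)).1).
move/Ele; apply; rewrite exprS.
have q2 : 0 <= q0 * 2 ^+ size l by rewrite mulr_ge0 // exprn_ge0.
have := ler_wpM2r q2 (r1 i); lra.
Qed.

Lemma zmaj_ge0 i a l n : 0 <= zmaj i a l n.
Proof. by case: hX => + _ _ _ _; apply; apply: zmajX. Qed.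

Lemma N_ge0 a b r' y' n : E r' y' -> 0 <= N a b y' n.
Proof. by case: hE => + _ _ _ _; move=> h /(NE a b) [/h]. Qed.

Lemma M_ge0 a b r' q' y' z' n : E r' y' -> X q' z' -> 0 <= M a b y' z' n.
Proof.
by case: hX => + _ _ _ _; move=> h Ey' /(MX a b Ey') [/h].
Qed.

Lemma pot_ge_nil j i a s : lprod (fun n => (1 + c i) * y n) s <= pot j i a s.
Proof.
have h0 l : 0 <= seq_wt l * lprod (ymaj i a l) s.
  by rewrite mulr_ge0 ?seq_wt_ge0 // lprod_ge0 // => n; apply: ymaj_ge0.
rewrite /pot; case: j => [|j].
  by rewrite big_seq1 /seq_wt big_nil mul1r.
rewrite big_label_seqs {1}/seq_wt big_nil mul1r lerDl.
by do 2!apply: sumr_ge0 => ? _.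
Qed.

Lemma pot_lprod j i a s : lprod y s <= pot j i a s.
Proof.
case: hE => E_ge0 _ _ _ _; apply: le_trans (pot_ge_nil j i a s).
apply: le_lprod => n; first exact: E_ge0 Ey.
by rewrite mulrDl mul1r lerDl mulr_ge0 // ?(E_ge0 _ _ _ Ey) // ltW.
Qed.

(** The end value [(1 + c i) * y] of [ymaj] is made for this bound: its surplus [c i * y] yields, to
    first order, one copy of the product for each entry of [s]. *)
Lemma pot_size j i a s : (size s)%:R * lprod y s <= (c i)^-1 * pot j i a s.
Proof.
case: hE => E_ge0 _ _ _ _; rewrite mulrC ler_pdivlMl //.
apply: le_trans (pot_ge_nil j i a s).
have y0 n : 0 <= y n := E_ge0 _ _ n Ey.
have -> : (fun n => (1 + c i) * y n) = fun n => y n + c i * y n.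
  by apply/funext => n; rewrite mulrDl mul1r.
apply: le_trans (lprodDM s y0 y0 (ltW (c0 i))).
rewrite ldiff_diag (mulrC (lprod _ _)) lerDr; exact: lprod_ge0.
Qed.

(** A move of label [b] is charged to the sequences that begin with [b], whose majorants contain the
    image under the operator of that move; the term of the empty sequence is dropped. The abstract
    [h] covers products and their derivatives alike. *)
Lemma weighted_move (h : nat -> Lab -> seq Lab -> seq I -> R) j i a s
    (g : I * {ffun 'I_p -> I} * seq I -> R) lab :
  (forall i a l s, 0 <= h i a l s) ->
  (forall b l, c i * (\sum_(v <- moves D s) K a b v.1.1 v.1.2 * h i.+1 b l v.2) <=
     h i a (b :: l) s) ->
  (forall v, v \in moves D s -> lab v \in box /\
     0 <= g v <= wt (lab v) * K a (lab v) v.1.1 v.1.2) ->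
  \sum_(v <- moves D s) g v * (\sum_(l <- label_seqs j) seq_wt l * h i.+1 (lab v) l v.2) <=
  (c i)^-1 * \sum_(l <- label_seqs j.+1) seq_wt l * h i a l s.
Proof.
move=> h0 hstep hg.
have H0 i' a' s' r' : 0 <= \sum_(l <- r') seq_wt l * h i' a' l s'.
  by apply: sumr_ge0 => l _; rewrite mulr_ge0 ?seq_wt_ge0.
(* The label depends on the move. Summing over all of [box] instead decouples the two, and the
   weights keep this affordable. *)
apply: (@le_trans _ _ (\sum_(v <- moves D s) \sum_(b <- box)
    wt b * K a b v.1.1 v.1.2 * \sum_(l <- label_seqs j) seq_wt l * h i.+1 b l v.2)).
  rewrite big_seq [leRHS]big_seq; apply: ler_sum => v vs.
  have [lb /andP[g0 g1]] := hg v vs.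
  apply: le_trans (ler_wpM2r (H0 _ _ _ _) g1) _.
  rewrite (big_rem _ lb) /= lerDl; apply: sumr_ge0 => b _.
  by apply: mulr_ge0 => //; apply: mulr_ge0.
rewrite exchange_big /= ler_pdivlMl // big_label_seqs.
apply: ler_wpDl; first by rewrite mulr_ge0 ?seq_wt_ge0.
rewrite mulr_sumr; apply: ler_sum => b _.
have -> : c i * (\sum_(v <- moves D s) wt b * K a b v.1.1 v.1.2 *
      (\sum_(l <- label_seqs j) seq_wt l * h i.+1 b l v.2)) =
    \sum_(l <- label_seqs j) seq_wt (b :: l) *
      (c i * \sum_(v <- moves D s) K a b v.1.1 v.1.2 * h i.+1 b l v.2).
  rewrite mulr_sumr; under eq_bigr => v _ do rewrite !mulr_sumr.
  rewrite exchange_big; apply: eq_bigr => l _; rewrite !mulr_sumr.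
  by apply: eq_bigr => v _; rewrite seq_wt_cons; ring.
by apply: ler_sum => l _; apply: ler_wpM2l; [exact: seq_wt_ge0|exact: hstep].
Qed.

Lemma pot_move j i a s (g : I * {ffun 'I_p -> I} * seq I -> R) lab :
  (forall v, v \in moves D s -> lab v \in box /\
     0 <= g v <= wt (lab v) * K a (lab v) v.1.1 v.1.2) ->
  \sum_(v <- moves D s) g v * pot j i.+1 (lab v) v.2 <= (c i)^-1 * pot j.+1 i a s.
Proof.
apply: (@weighted_move (fun i a l => lprod (ymaj i a l))) => [i' a' l s'|b l].
  exact/lprod_ge0/ymaj_ge0.
rewrite sum_moves_lprod /=.
have yE := ymajE i.+1 b l.
apply: le_trans (lprodDM s (ymaj_ge0 i.+1 b l) _ (ltW (c0 i))).
  apply: ler_wpDl; first by apply/lprod_ge0/ymaj_ge0.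
  apply: ler_wpM2l; first exact: ltW.
  apply: le_ldiff; first exact: ymaj_ge0.
  exact: (NE a b yE).2.
by move=> n; apply: N_ge0 yE.
Qed.

Lemma dpot_move j i a s (g : I * {ffun 'I_p -> I} * seq I -> R) lab :
  (forall v, v \in moves D s -> lab v \in box /\
     0 <= g v <= wt (lab v) * K a (lab v) v.1.1 v.1.2) ->
  \sum_(v <- moves D s) g v * dpot j i.+1 (lab v) v.2 <= (c i)^-1 * dpot j.+1 i a s.
Proof.
apply: (@weighted_move (fun i a l => ldiff (ymaj i a l) (zmaj i a l))) => [i' a' l s'|b l].
  by apply: ldiff_ge0; [exact: ymaj_ge0|exact: zmaj_ge0].
have yE := ymajE i.+1 b l; have zX := zmajX i.+1 b l.
apply: le_trans; last first.
  apply: (@ldiffDM _ _ _ D (K a b) _ _ _ _ (c i) s (ymaj_ge0 i.+1 b l)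
    (zmaj_ge0 i.+1 b l)).
  - by move=> n; apply: N_ge0 yE.
  - by move=> n; apply: M_ge0 yE zX.
  - exact: ltW.
  - exact: (NE a b yE).2.
  - exact: (MX a b yE zX).2.
rewrite lerDr; apply: ldiff_ge0; [exact: ymaj_ge0|exact: zmaj_ge0].
Qed.

Lemma dpot_ldiff a s i : ldiff y z s <= dpot 0 i a s.
Proof.
case: hE => E_ge0 _ _ _ _.
have y0 n : 0 <= y n := E_ge0 _ _ n Ey.
rewrite /dpot big_seq1 /seq_wt big_nil mul1r /=.
have z0 : forall n, 0 <= z n := zmaj_ge0 i a [::].
have y1 n : y n <= (1 + c i) * y n by rewrite mulrDl mul1r lerDl mulr_ge0 // ltW.
by apply: le_ldiff2.
Qed.

Lemma potE j i a : E (2 * r i) (fun n => pot j i a [:: n]).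
Proof.
case: (hE) => E_ge0 _ _ _ Ele.
have h := @norm_balls_sum _ _ _ hE _ (label_seqs j) seq_wt _ (r i)
  (fun l _ => seq_wt_ge0 l) (fun l _ => ymajE i a l).
have ri0 : 0 <= r i by apply: le_trans (r0r i); rewrite mulr_ge0 // addr_ge0 // ltW.
have := Ele _ _ _ h (ler_wpM2r ri0 (sum_seq_wt j)).
rewrite (_ : (fun n => _) = fun n => pot j i a [:: n]) //.
by apply/funext => n; apply: eq_bigr => l _; rewrite /lprod big_seq1.
Qed.

Lemma dpotX j i a : X (2 * (q0 * 2 ^+ j)) (fun n => dpot j i a [:: n]).
Proof.
case: (hX) => X_ge0 _ _ _ Xle.
have sz l : l \in label_seqs j -> (size l <= j)%N.
  elim: j l => [|j IH] l /=; first by rewrite inE => /eqP ->.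
  rewrite inE => /orP[/eqP ->//|/allpairsP[[b l'] /= [_ /IH h ->]]].
  by rewrite ltnS.
have h := @norm_balls_sum _ _ _ hX _ (label_seqs j) seq_wt (zmaj i a) (q0 * 2 ^+ j)
  (fun l _ => seq_wt_ge0 l).
have := Xle _ _ _ (h _) (ler_wpM2r _ (sum_seq_wt j)).
rewrite (_ : (fun n => _) = fun n => dpot j i a [:: n]).
  apply; last by rewrite mulr_ge0 // exprn_ge0.
  move=> l /sz lj; apply: Xle (zmajX i a l) _.
  by rewrite ler_wpM2l // ler_weXn2l // ler1n.
apply/funext => n; apply: eq_bigr => l _ /=.
by rewrite lprod_nil mulr1 mulr0 addr0.
Qed.

End Potentials.

(** * Interpolation and weights on the integers *)

Section GeometricMean.
Variables (R : realType) (th : R).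
Hypotheses (th0 : 0 < th) (th1 : th < 1).
Implicit Types x y : R.

Definition gmean x y := x `^ th * y `^ (1 - th).

Lemma gmean_ge0 x y : 0 <= gmean x y.
Proof. by rewrite mulr_ge0 ?powR_ge0. Qed.

Lemma gmeanxx x : 0 <= x -> gmean x x = x.
Proof.
move=> x0; rewrite /gmean -powRD; first by rewrite subrKC powRr1.
by rewrite subrKC oner_eq0.
Qed.

Lemma gmeanM x y x' y' : 0 <= x -> 0 <= y -> 0 <= x' -> 0 <= y' ->
  gmean (x * x') (y * y') = gmean x y * gmean x' y'.
Proof. by move=> *; rewrite /gmean !powRM // mulrACA. Qed.

Lemma le_gmean x y x' y' : 0 <= x -> 0 <= y -> x <= x' -> y <= y' ->
  gmean x y <= gmean x' y'.
Proof.
move=> x0 y0 xx yy.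
have x'0 := le_trans x0 xx; have y'0 := le_trans y0 yy.
by apply: ler_pM; rewrite ?powR_ge0 //;
  apply: ge0_ler_powR; rewrite ?nnegrE // ?subr_ge0 ltW.
Qed.

Lemma gmean_le_amean x y : 0 <= x -> 0 <= y -> gmean x y <= th * x + (1 - th) * y.
Proof.
move=> x0 y0; have th1' : 0 < 1 - th by rewrite subr_gt0.
have := @conjugate_powR R (x `^ th) (y `^ (1 - th)) th^-1 (1 - th)^-1
  (powR_ge0 _ _) (powR_ge0 _ _).
rewrite !invr_gt0 !invrK -!powRrM !mulfV ?gt_eqF // !powRr1 //.
rewrite (mulrC th) (mulrC (1 - th)); apply => //; exact: subrKC.
Qed.

Lemma gmean_eq0 x y : 0 <= x -> 0 <= y -> x * y = 0 -> gmean x y = 0.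
Proof.
move=> x0 y0 /eqP; rewrite mulf_eq0 /gmean => /orP[]/eqP ->.
  by rewrite powR0 ?mul0r // gt_eqF.
by rewrite (powR0 (_ : 1 - th != 0)) ?mulr0 // subr_eq0 gt_eqF.
Qed.

(** Hölder's inequality with exponents [1 / th] and [1 / (1 - th)]: normalize both sums to 1 and
    apply the weighted inequality of means to each term. Vanishing sums, which cannot be normalized,
    are treated apart. *)
Lemma sum_gmean (I : eqType) (s : seq I) (x y : I -> R) :
  (forall i, 0 <= x i) -> (forall i, 0 <= y i) ->
  \sum_(i <- s) gmean (x i) (y i) <= gmean (\sum_(i <- s) x i) (\sum_(i <- s) y i).
Proof.
move=> x0 y0.
have sx0 : 0 <= \sum_(i <- s) x i by rewrite sumr_ge0.
have sy0 : 0 <= \sum_(i <- s) y i by rewrite sumr_ge0.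
have zero (f : I -> R) i : (forall i, 0 <= f i) -> \sum_(i <- s) f i = 0 ->
    i \in s -> f i = 0.
  move=> f0 /eqP; rewrite psumr_eq0 // => /allP h /h; exact: eqP.
have [X0|Xn0] := eqVneq (\sum_(i <- s) x i) 0.
  rewrite big_seq big1 ?gmean_ge0 // => i si.
  by rewrite gmean_eq0 // (zero x) // mul0r.
have [Y0|Yn0] := eqVneq (\sum_(i <- s) y i) 0.
  rewrite big_seq big1 ?gmean_ge0 // => i si.
  by rewrite gmean_eq0 // (zero y) // mulr0.
set X := \sum_(i <- s) x i in sx0 Xn0 *; set Y := \sum_(i <- s) y i in sy0 Yn0 *.
have Xp : 0 < X by rewrite lt_neqAle eq_sym Xn0.
have Yp : 0 < Y by rewrite lt_neqAle eq_sym Yn0.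
apply: (@le_trans _ _ (\sum_(i <- s)
    (th * (x i / X) + (1 - th) * (y i / Y)) * gmean X Y)).
  apply: ler_sum => i _.
  have xX : 0 <= x i / X by rewrite divr_ge0.
  have yY : 0 <= y i / Y by rewrite divr_ge0.
  rewrite -{1}(divfK Xn0 (x i)) -{1}(divfK Yn0 (y i)) gmeanM //.
  by apply: ler_wpM2r; [exact: gmean_ge0|exact: gmean_le_amean].
rewrite -mulr_suml big_split /= -!mulr_sumr -!mulr_suml -/X -/Y !divff //.
by rewrite !mulr1 subrKC mul1r.
Qed.

Lemma gmeanD x y x' y' : 0 <= x -> 0 <= y -> 0 <= x' -> 0 <= y' ->
  gmean x y + gmean x' y' <= gmean (x + x') (y + y').
Proof.
move=> x0 y0 x'0 y'0.
have := @sum_gmean bool [:: true; false] (fun b => if b then x else x')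
  (fun b => if b then y else y').
by rewrite !big_cons !big_nil !addr0; apply => -[].
Qed.

Section Lists.
Variable I : eqType.
Implicit Types (s : seq I).

Lemma lprod_gmean (y1 y2 : I -> R) s : (forall n, 0 <= y1 n) -> (forall n, 0 <= y2 n) ->
  lprod (fun n => gmean (y1 n) (y2 n)) s = gmean (lprod y1 s) (lprod y2 s).
Proof.
move=> y10 y20; elim: s => [|n s IH]; first by rewrite !lprod_nil gmeanxx.
by rewrite !lprod_cons IH gmeanM // lprod_ge0.
Qed.

(** Products interpolate exactly; the derivative is a sum of products, and Hölder's inequality for
    two terms is applied at each entry. *)
Lemma ldiff_gmean (y1 y2 z1 z2 : I -> R) s :
  (forall n, 0 <= y1 n) -> (forall n, 0 <= y2 n) ->
  (forall n, 0 <= z1 n) -> (forall n, 0 <= z2 n) ->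
  ldiff (fun n => gmean (y1 n) (y2 n)) (fun n => gmean (z1 n) (z2 n)) s <=
  gmean (ldiff y1 z1 s) (ldiff y2 z2 s).
Proof.
move=> y10 y20 z10 z20; elim: s => [|n s IH] /=; first exact: gmean_ge0.
apply: le_trans; last first.
  by apply: gmeanD; rewrite ?mulr_ge0 ?lprod_ge0 ?ldiff_ge0.
rewrite lprod_gmean //; apply: lerD.
  by rewrite gmeanM ?lprod_ge0.
by rewrite gmeanM ?ldiff_ge0 //; apply: ler_wpM2l; rewrite ?gmean_ge0.
Qed.

End Lists.
End GeometricMean.

Section IntegerWeights.
Variables (R : realType) (e : R).
Hypothesis e0 : 0 < e.

Definition int_box (L : nat) : seq int :=
  [seq Posz i | i <- iota 0 L.+1] ++ [seq - Posz i | i <- iota 0 L.+1].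

Lemma mem_int_box L (a : int) : (`|a| <= L)%N -> a \in int_box L.
Proof.
move=> aL; rewrite mem_cat; apply/orP; case: a aL => i iL; [left|right]; apply/mapP.
  by exists i; rewrite // mem_iota add0n ltnS.
exists i.+1; last by rewrite NegzE.
by rewrite mem_iota add0n ltnS.
Qed.

(** A difference that telescopes on each half line, with mass at most 1/4 there; zero, listed twice
    in [int_box], is counted in both. Its decay has the exponent [1 + e] of the derivative, and [e]
    may be as small as desired. *)
Definition int_wt (a : int) : R :=
  4^-1 * ((1 + `|a|%N%:R) `^ (- e) - (2 + `|a|%N%:R) `^ (- e)).

(** A mean value bound, obtained from [1 + u <= expR u] and [ln (1 + u) <= u]. *)
Lemma int_wt_lower a : e / 4 * (2 + `|a|%N%:R) `^ (- (1 + e)) <= int_wt a.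
Proof.
rewrite /int_wt; move: (`|a|%N%:R) (ler0n R `|a|%N) => x x0.
have b0 : 0 < 2 + x by lra.
have a0 : 0 < 1 + x by lra.
rewrite opprD powRD; last by rewrite (gt_eqF b0) implybT.
rewrite powR_inv1; last exact: ltW.
have : expR (- e * ln (1 + x)) >=
    expR (- e * ln (2 + x)) * (1 + e * (2 + x)^-1).
  have -> : - e * ln (1 + x) =
      - e * ln (2 + x) + e * - ln ((1 + x) / (2 + x)).
    by rewrite ln_div ?posrE //; ring.
  rewrite expRD ler_pM2l ?expR_gt0 //; apply: le_trans (expR_ge1Dx _).
  rewrite lerD2l ler_pM2l //.
  have -> : (1 + x) / (2 + x) = 1 + - (2 + x)^-1.
    by field; rewrite gt_eqF.
  rewrite lerNr; apply: le_ln1Dx; rewrite ltrN2 invf_lt1 //; lra.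
rewrite /powR !gt_eqF //.
set E1 := expR (_ * ln (1 + x)); set E2 := expR (_ * ln (2 + x)).
set q := (2 + x)^-1; nra.
Qed.

Lemma int_wt_ge0 a : 0 <= int_wt a.
Proof.
apply: le_trans (int_wt_lower a).
by rewrite mulr_ge0 ?powR_ge0 // divr_ge0 // ltW.
Qed.

Lemma sum_int_wt L : \sum_(a <- int_box L) int_wt a <= 2^-1.
Proof.
have tel l : \sum_(i <- iota 0 l) 4^-1 * ((1 + i%:R) `^ (- e) - (2 + i%:R) `^ (- e))
    = 4^-1 * (1 - (1 + l%:R) `^ (- e)).
  rewrite -mulr_sumr; congr (_ * _); elim: l => [|l IH].
    by rewrite big_nil addr0 powR1 subrr.
  rewrite -addn1 iotaD big_cat /= IH big_seq1 add0n natrD.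
  have -> : (2 + l%:R : R) = 1 + (l%:R + 1) by ring.
  ring.
rewrite /int_box big_cat !big_map.
have -> : \sum_(i <- iota 0 L.+1) int_wt (Posz i) =
    4^-1 * (1 - (1 + L.+1%:R) `^ (- e)) by rewrite -tel.
have -> : \sum_(i <- iota 0 L.+1) int_wt (- Posz i) =
    4^-1 * (1 - (1 + L.+1%:R) `^ (- e)).
  by rewrite -tel; apply: eq_bigr => i _; rewrite /int_wt abszN.
by move: (_ `^ _) (powR_ge0 (1 + L.+1%:R : R) (- e)) => x /=; lra.
Qed.

End IntegerWeights.

(** * Summable families and spaces of sequences *)

Section Esum.
Variables (R : realType) (T : choiceType).
Implicit Types (D : set T) (f : T -> R) (s : seq T).

Lemma esum_ge_seq D f s : (forall i, 0 <= f i) -> uniq s ->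
  (forall i, i \in s -> D i) ->
  ((\sum_(i <- s) f i)%:E <= \esum_(i in D) (f i)%:E)%E.
Proof.
move=> f0 us sD; rewrite -sumEFin fsbig_seq //; apply: ereal_sup_ubound.
by exists [set` s].
Qed.

Lemma esum_le_seq D f (c : R) : (forall i, 0 <= f i) ->
  (forall s, uniq s -> (forall i, i \in s -> D i) -> \sum_(i <- s) f i <= c) ->
  (\esum_(i in D) (f i)%:E <= c%:E)%E.
Proof.
move=> f0 h; apply: ge_ereal_sup => _ [A [fA AD] <-].
rewrite fsbig_finite // sumEFin lee_fin; apply: h; first exact: fset_uniq.
by move=> i; rewrite in_fset_set // => /set_mem/AD.
Qed.

Lemma esum_fin_ge D f s : (forall i, 0 <= f i) ->
  (\esum_(i in D) (f i)%:E < +oo)%E -> uniq s -> (forall i, i \in s -> D i) ->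
  \sum_(i <- s) f i <= fine (\esum_(i in D) (f i)%:E).
Proof.
move=> f0 foo us sD; have := esum_ge_seq f0 us sD.
by rewrite -[X in (_ <= X)%E -> _]fineK ?lee_fin // ge0_fin_numE // esum_ge0 // => *;
  rewrite lee_fin.
Qed.

Lemma esum_approx D f (e : R) : (forall i, 0 <= f i) ->
  (\esum_(i in D) (f i)%:E < +oo)%E -> 0 < e ->
  exists s, [/\ uniq s, forall i, i \in s -> D i &
    fine (\esum_(i in D) (f i)%:E) <= \sum_(i <- s) f i + e].
Proof.
move=> f0 foo e0; apply: contrapT => /forallNP h.
have fin : (\esum_(i in D) (f i)%:E)%E \is a fin_num.
  by rewrite ge0_fin_numE // esum_ge0 // => i _; rewrite lee_fin.
have : (\esum_(i in D) (f i)%:E <= (fine (\esum_(i in D) (f i)%:E) - e)%:E)%E.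
  apply: esum_le_seq => // s us sD; rewrite leNgt; apply/negP => lt_s.
  by apply: (h s); split => //; rewrite -lerBlDr ltW.
rewrite -[X in (X <= _)%E]fineK // lee_fin; lra.
Qed.

Lemma rsum_ge0E D f : (forall i, 0 <= f i) ->
  rsum D f = fine (\esum_(i in D) (f i)%:E).
Proof.
move=> f0; rewrite /rsum.
have -> : f^\+ = f by apply/funext => i; rewrite /funrpos; apply/max_idPl.
have -> : f^\- = fun=> 0.
  by apply/funext => i; rewrite /funrneg; apply/max_idPr; rewrite oppr_le0.
by rewrite (esum1 (a := fun=> 0%:E)) // subr0.
Qed.

Lemma csum_ge0E D f : (forall i, 0 <= f i) ->
  csum D (fun i => (f i)%:C) = (fine (\esum_(i in D) (f i)%:E))%:C.
Proof.
move=> f0; rewrite /csum (rsum_ge0E D f0) (@rsum_ge0E D (fun=> 0)) //.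
by rewrite (esum1 (a := fun=> 0%:E)).
Qed.

(** The bound off [s] also makes the sums of the positive and negative parts finite, which matters
    because [fine] sends an infinite sum to 0. *)
Lemma rsum_close D f s (e c : R) : uniq s -> (forall i, i \in s -> D i) -> 0 <= e ->
  (forall s', uniq s' -> (forall i, i \in s' -> D i /\ i \notin s) ->
     \sum_(i <- s') `|f i| <= e) ->
  `|rsum D f - \sum_(i <- s) f i| <= e.
Proof.
move=> us sD e0 hs.
have half (g : T -> R) : (forall i, 0 <= g i) -> (forall i, g i <= `|f i|) ->
    \sum_(i <- s) g i <= fine (\esum_(i in D) (g i)%:E) <= \sum_(i <- s) g i + e.
  move=> g0 gf.
  have le : (\esum_(i in D) (g i)%:E <= (\sum_(i <- s) g i + e)%:E)%E.
    apply: esum_le_seq => // s' us' s'D.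
    (* The part of [s'] inside [s] is bounded by the sum over [s], the part outside by [e]. *)
    rewrite (bigID (fun i => i \in s)) /=; apply: lerD.
      rewrite -big_filter; set s1 := [seq i <- s' | _].
      rewrite [leRHS](bigID (fun i => i \in s1)) /= ler_wpDr ?sumr_ge0 //.
      rewrite -[leRHS]big_filter (perm_big [seq i <- s | i \in s1]) //.
      apply: uniq_perm; rewrite ?filter_uniq // => i.
      by rewrite !mem_filter; case: (i \in s'); case: (i \in s).
    rewrite -big_filter; apply: le_trans (ler_sum _ (fun i _ => gf i)) _.
    apply: hs; first exact: filter_uniq.
    by move=> i; rewrite mem_filter => /andP[-> /s'D].
  have foo := le_lt_trans le (ltry _).
  rewrite (esum_fin_ge g0 foo) //=.
  rewrite -lee_fin fineK // ge0_fin_numE // esum_ge0 // => i _; exact: g0.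
have /(half _ (funrpos_ge0 f))/andP[p1 p2] i : f^\+ i <= `|f i|.
  by rewrite ge_max ler_norm normr_ge0.
have /(half _ (funrneg_ge0 f))/andP[q1 q2] i : f^\- i <= `|f i|.
  by rewrite ge_max normr_ge0 andbT -normrN ler_norm.
have -> : \sum_(i <- s) f i = \sum_(i <- s) f^\+ i - \sum_(i <- s) f^\- i.
  rewrite -sumrB; apply: eq_bigr => i _; by rewrite -[in LHS](funrposBneg f).
by rewrite /rsum ler_norml; lra.
Qed.

End Esum.

(** * The real-valued modulus of complex numbers *)

Section ComplexModulus.
Variable R : realType.
Implicit Types (x y : R[i]) (a : R).

Lemma cabs_norm x : (cabs x)%:C = `|x|.
Proof. by case: x. Qed.

Lemma cabsE x : cabs x = Num.sqrt (complex.Re x ^+ 2 + complex.Im x ^+ 2).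
Proof. by case: x. Qed.

Lemma cabs_ge0 x : 0 <= cabs x.
Proof. by rewrite cabsE sqrtr_ge0. Qed.

Lemma cabsM x y : cabs (x * y) = cabs x * cabs y.
Proof. exact: ComplexField.Normc.normcM. Qed.

Lemma cabsD x y : cabs (x + y) <= cabs x + cabs y.
Proof. exact: (le_normcD (x : Rcomplex R) y). Qed.

Lemma cabsN x : cabs (- x) = cabs x.
Proof. exact: (normcN (x : Rcomplex R)). Qed.

Lemma cabsB x y : cabs (x - y) <= cabs x + cabs y.
Proof. by rewrite -(cabsN y) cabsD. Qed.

Lemma cabs_distC x y : cabs (x - y) = cabs (y - x).
Proof. by rewrite -cabsN opprB. Qed.

Lemma cabs0 : cabs (0 : R[i]) = 0.
Proof. exact: ComplexField.Normc.normc0. Qed.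

Lemma cabs1 : cabs (1 : R[i]) = 1.
Proof. exact: ComplexField.Normc.normc1. Qed.

Lemma cabs0_eq0 x : cabs x = 0 -> x = 0.
Proof. exact: ComplexField.Normc.eq0_normc. Qed.

Lemma cabsV x : cabs x^-1 = (cabs x)^-1.
Proof. exact: ComplexField.Normc.normcV. Qed.

Lemma cabs_real a : cabs a%:C = `|a|.
Proof. by rewrite cabsE /= expr0n addr0 sqrtr_sqr. Qed.

Lemma cabs_Re x : `|complex.Re x| <= cabs x.
Proof.
by rewrite cabsE -sqrtr_sqr ler_wsqrtr // lerDl sqr_ge0.
Qed.

Lemma cabs_Im x : `|complex.Im x| <= cabs x.
Proof.
by rewrite cabsE -sqrtr_sqr ler_wsqrtr // lerDr sqr_ge0.
Qed.

Lemma cabs_le_ReIm x : cabs x <= `|complex.Re x| + `|complex.Im x|.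
Proof.
have h0 : 0 <= `|complex.Re x| + `|complex.Im x| by rewrite addr_ge0.
rewrite cabsE -(ger0_norm h0) -sqrtr_sqr ler_wsqrtr // sqrrD !real_normK ?num_real //.
by rewrite lerD2r lerDl mulrn_wge0 // mulr_ge0.
Qed.

Lemma cabs_expi a : cabs (expi a) = 1.
Proof. by rewrite cabsE /= cos2Dsin2 sqrtr1. Qed.

Lemma cabs_prod (I : Type) (s : seq I) (P : pred I) (f : I -> R[i]) :
  cabs (\prod_(i <- s | P i) f i) = \prod_(i <- s | P i) cabs (f i).
Proof. exact: (big_morph _ cabsM cabs1). Qed.

Lemma cabs_sum (I : Type) (s : seq I) (P : pred I) (f : I -> R[i]) :
  cabs (\sum_(i <- s | P i) f i) <= \sum_(i <- s | P i) cabs (f i).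
Proof.
elim/big_ind2: _ => [|x a y b hx hy|//]; first by rewrite cabs0.
exact: le_trans (cabsD _ _) (lerD hx hy).
Qed.

Lemma ReD x y : complex.Re (x + y) = complex.Re x + complex.Re y.
Proof. by case: x; case: y. Qed.

Lemma ImD x y : complex.Im (x + y) = complex.Im x + complex.Im y.
Proof. by case: x; case: y. Qed.

Lemma ReN x : complex.Re (- x) = - complex.Re x.
Proof. by case: x. Qed.

Lemma ImN x : complex.Im (- x) = - complex.Im x.
Proof. by case: x. Qed.

Lemma Re_sum (I : Type) (s : seq I) (f : I -> R[i]) :
  complex.Re (\sum_(i <- s) f i) = \sum_(i <- s) complex.Re (f i).
Proof. by apply: (big_morph _ ReD). Qed.

Lemma Im_sum (I : Type) (s : seq I) (f : I -> R[i]) :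
  complex.Im (\sum_(i <- s) f i) = \sum_(i <- s) complex.Im (f i).
Proof. by apply: (big_morph _ ImD). Qed.

Lemma csum_close (T : choiceType) (D : set T) (f : T -> R[i]) s (e : R) :
  uniq s -> (forall i, i \in s -> D i) -> 0 <= e ->
  (forall s', uniq s' -> (forall i, i \in s' -> D i /\ i \notin s) ->
     \sum_(i <- s') cabs (f i) <= e) ->
  cabs (csum D f - \sum_(i <- s) f i) <= 2 * e.
Proof.
move=> us sD e0 hs; apply: le_trans (cabs_le_ReIm _) _.
rewrite ReD ImD ReN ImN Re_sum Im_sum mulr_natl mulr2n; apply: lerD.
  apply: rsum_close => // s' us' s'D; apply: le_trans (hs s' us' s'D).
  by apply: ler_sum => i _; apply: cabs_Re.
apply: rsum_close => // s' us' s'D; apply: le_trans (hs s' us' s'D).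
by apply: ler_sum => i _; apply: cabs_Im.
Qed.

End ComplexModulus.

(** * Balls of the weighted l2 spaces *)

Section L2Balls.
Variables (R : realType) (d : nat).
Implicit Types (s r : R) (y : Zd d -> R) (w : Zd d -> R[i]).

(** Bounding finite partial sums puts membership and norm into one condition, free of convergence
    questions; [l2_ballP] identifies it with the ball of [l2]. *)
Definition l2_ball s r y := [/\ forall n, 0 <= y n, 0 <= r &
  forall F : seq (Zd d), uniq F -> \sum_(n <- F) (bracketZ R n `^ s * y n) ^+ 2 <= r ^+ 2].

Lemma bracketZ_gt0 (n : Zd d) : 0 < bracketZ R n.
Proof.
rewrite /bracketZ sqrtr_gt0 ltr_wpDr // sumr_ge0 // => i _; exact: sqr_ge0.
Qed.

Lemma sum_sqr_triangle (T : Type) (F : seq T) (x y : T -> R) (a b : R) :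
  0 <= a -> 0 <= b ->
  \sum_(i <- F) x i ^+ 2 <= a ^+ 2 -> \sum_(i <- F) y i ^+ 2 <= b ^+ 2 ->
  \sum_(i <- F) (x i + y i) ^+ 2 <= (a + b) ^+ 2.
Proof.
move=> a0 b0 hx hy.
apply/ler_addgt0Pr => e e0.
(* Perturb a and b to make them positive; then 2xy <= x^2 b/a + y^2 a/b. *)
pose h := e / (2 * (a + b) + 2 * e + 1) / 2.
have den : 0 < 2 * (a + b) + 2 * e + 1 by lra.
have h0 : 0 < h by rewrite /h !divr_gt0.
have hle : (a + h + (b + h)) ^+ 2 <= (a + b) ^+ 2 + e.
  have he : h * 2 * (2 * (a + b) + 2 * e + 1) = e by rewrite /h !divfK // gt_eqF.
  have : h * 2 <= 1 + 2 * e by nra.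
  nra.
apply: le_trans hle.
have a'0 : 0 < a + h by lra.
have b'0 : 0 < b + h by lra.
apply: le_trans (_ : \sum_(i <- F) ((1 + (b + h) / (a + h)) * x i ^+ 2 +
    (1 + (a + h) / (b + h)) * y i ^+ 2) <= _).
  apply: ler_sum => i _.
  have -> : (1 + (b + h) / (a + h)) * x i ^+ 2 + (1 + (a + h) / (b + h)) * y i ^+ 2 =
     (x i + y i) ^+ 2 +
     ((b + h) * x i - (a + h) * y i) ^+ 2 / ((a + h) * (b + h)).
    by field; rewrite !gt_eqF.
  by rewrite lerDl divr_ge0 ?sqr_ge0 // mulr_ge0 // ltW.
rewrite big_split /= -!mulr_sumr.
have -> : (a + h + (b + h)) ^+ 2 = (1 + (b + h) / (a + h)) * (a + h) ^+ 2 +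
    (1 + (a + h) / (b + h)) * (b + h) ^+ 2 by field; rewrite !gt_eqF.
apply: lerD; apply: ler_wpM2l.
- by rewrite addr_ge0 // divr_ge0 // ltW.
- by apply: le_trans hx _; rewrite lerXn2r ?nnegrE //; lra.
- by rewrite addr_ge0 // divr_ge0 // ltW.
- by apply: le_trans hy _; rewrite lerXn2r ?nnegrE //; lra.
Qed.

Lemma l2_ball_norm s : norm_balls (l2_ball s).
Proof.
split.
- by move=> r y n [].
- split => // F _; rewrite big1 ?sqr_ge0 // => n _.
  by rewrite mulr0 expr0n.
- move=> r r' y y' [y0 r0 hy] [y'0 r'0 hy']; split=> [n||F uF].
  + exact: addr_ge0.
  + exact: addr_ge0.
  + under eq_bigr => n _ do rewrite mulrDr.
    by apply: sum_sqr_triangle => //; [exact: hy|exact: hy'].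
- move=> a r y a0 [y0 r0 hy]; split=> [n||F uF]; try exact: mulr_ge0.
  under eq_bigr => n _ do rewrite mulrCA exprMn.
  by rewrite -mulr_sumr exprMn ler_wpM2l ?sqr_ge0 // hy.
- move=> r r' y [y0 r0 hy] rr'; have r'0 := le_trans r0 rr'.
  split=> // F uF; apply: le_trans (hy F uF) _.
  by rewrite lerXn2r.
Qed.

Lemma l2_ball_le s r y y' : l2_ball s r y -> (forall n, 0 <= y' n <= y n) ->
  l2_ball s r y'.
Proof.
move=> [y0 r0 hy] yy; split=> // [n|F uF]; first by case/andP: (yy n).
apply: le_trans (hy F uF); apply: ler_sum => n _.
have /andP[h1 h2] := yy n.
by rewrite lerXn2r ?nnegrE ?mulr_ge0 ?powR_ge0 ?ler_wpM2l ?powR_ge0.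
Qed.

Lemma l2_ball_point s r y n : l2_ball s r y -> bracketZ R n `^ s * y n <= r.
Proof.
move=> [y0 r0 hy]; have := hy [:: n] isT; rewrite big_seq1.
by rewrite ler_pXn2r ?nnegrE // mulr_ge0 ?powR_ge0.
Qed.

Lemma l2_ballP s r w : 0 <= r ->
  (l2 d s w /\ snorm (l2 d s) w <= r) <-> l2_ball s r (fun n => cabs (w n)).
Proof.
move=> r0; rewrite /= /l2_sq; pose f n := (bracketZ R n `^ s * cabs (w n)) ^+ 2.
have f0 n : 0 <= f n by apply: sqr_ge0.
split=> [[foo hr]|[_ _ hF]].
  split=> // [n|F uF]; first exact: cabs_ge0.
  apply: le_trans (esum_fin_ge (s := F) f0 foo uF (fun _ _ => I)) _.
  have S0 : 0 <= fine (\esum_(n in [set: Zd d]) (f n)%:E).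
    by apply/fine_ge0/esum_ge0 => n _; rewrite lee_fin.
  by rewrite -(sqr_sqrtr S0) lerXn2r ?nnegrE ?sqrtr_ge0.
have le : (\esum_(n in [set: Zd d]) (f n)%:E <= (r ^+ 2)%:E)%E.
  by apply: esum_le_seq => // F uF _; apply: hF.
have foo := le_lt_trans le (ltry _).
split; first exact: foo.
have fin : (\esum_(n in [set: Zd d]) (f n)%:E)%E \is a fin_num.
  by rewrite ge0_fin_numE // esum_ge0 // => n _; rewrite lee_fin.
rewrite -(ger0_norm r0) -sqrtr_sqr ler_wsqrtr //.
by rewrite -lee_fin fineK.
Qed.

Lemma l2_ball_snorm s w : l2 d s w ->
  l2_ball s (snorm (l2 d s) w) (fun n => cabs (w n)).
Proof. by move=> ws; apply/l2_ballP; rewrite ?sqrtr_ge0. Qed.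

Lemma l2_ball_real s r y : l2_ball s r y ->
  l2 d s (fun n => (y n)%:C) /\ snorm (l2 d s) (fun n => (y n)%:C) <= r.
Proof.
move=> [y0 r0 hy]; apply/l2_ballP => //.
rewrite (_ : (fun n => _) = y); first by split.
by apply/funext => n; rewrite cabs_real ger0_norm.
Qed.

End L2Balls.

(** * Balls of X and point evaluations *)

Section XBalls.
Variables (R : realType) (d : nat).
Variables (X : completeNormedModType R[i]) (ev : X -> (Zd d -> R[i])).
Hypothesis hX : function_space ev.
Implicit Types (r q : R) (z : Zd d -> R).

Definition X_ball q z := [/\ forall n, 0 <= z n, embedded ev (fun n => (z n)%:C) &
  snorm (embedded ev) (fun n => (z n)%:C) <= q].

Lemma ev0 n : ev 0 n = 0.
Proof.
case: hX => _ /(_ 1 0 0 n); rewrite scaler0 addr0 mul1r => /eqP.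
by rewrite -subr_eq0 opprD addNKr oppr_eq0 => /eqP.
Qed.

Lemma evD x y n : ev (x + y) n = ev x n + ev y n.
Proof. by case: hX => _ /(_ 1 x y n); rewrite scale1r mul1r. Qed.

Lemma evZ a x n : ev (a *: x) n = a * ev x n.
Proof. by case: hX => _ /(_ a x 0 n); rewrite ev0 !addr0. Qed.

Lemma snorm_ev x : snorm (embedded ev) (ev x) = complex.Re `|x|.
Proof.
rewrite /=; congr (complex.Re `|_|); case: hX => inj _.
by apply: xget_unique => [//|y /inj].
Qed.

Lemma ReM_real (a : R) (c : R[i]) : complex.Re (a%:C * c) = a * complex.Re c.
Proof. by case: c => u v /=; rewrite mul0r subr0. Qed.

Lemma snormD x y : snorm (embedded ev) (ev (x + y)) <=
  snorm (embedded ev) (ev x) + snorm (embedded ev) (ev y).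
Proof.
by rewrite !snorm_ev -ReD; have := ler_normD x y; rewrite lecE => /andP[].
Qed.

Lemma snormZ (a : R) x : 0 <= a ->
  snorm (embedded ev) (ev (a%:C *: x)) = a * snorm (embedded ev) (ev x).
Proof.
by move=> a0; rewrite !snorm_ev normrZ -cabs_norm cabs_real ger0_norm // ReM_real.
Qed.

Lemma snorm_ge0 x : 0 <= snorm (embedded ev) (ev x).
Proof. by rewrite snorm_ev; have := normr_ge0 x; rewrite lecE => /andP[]. Qed.

Lemma X_ball_norm : norm_balls X_ball.
Proof.
split.
- by move=> r y n [].
- have e0 : ev 0 = fun n => ((fun=> 0 : R) n)%:C by apply/funext => n; rewrite ev0.
  split=> //; first by exists 0.
  by rewrite -e0 snorm_ev normr0.
- move=> r r' y y' [y0 [x _ xy] hr] [y'0 [x' _ xy'] hr'].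
  have e : ev (x + x') = fun n => (y n + y' n)%:C.
    by apply/funext => n; rewrite evD xy xy' rmorphD.
  split=> [n||]; [exact: addr_ge0|by exists (x + x')|].
  rewrite -e; apply: le_trans (snormD _ _) _; rewrite xy xy'; exact: lerD.
- move=> a r y a0 [y0 [x _ xy] hr].
  have e : ev (a%:C *: x) = fun n => (a * y n)%:C.
    by apply/funext => n; rewrite evZ xy rmorphM.
  split=> [n||]; [exact: mulr_ge0|by exists (a%:C *: x)|].
  by rewrite -e snormZ // xy ler_wpM2l.
- by move=> r r' y [y0 ye hr] rr'; split=> //; apply: le_trans hr _.
Qed.

(* By solidity, point evaluations are bounded on nonnegative members. *)
Lemma X_ball_point : solid (embedded ev) ->
  exists c : Zd d -> R, (forall n, 0 <= c n) /\
    forall q z n, X_ball q z -> z n <= c n * q.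
Proof.
move=> [C hC].
suff /choice[c hc] : forall n, exists c, 0 <= c /\ forall q z, X_ball q z -> z n <= c * q.
  by exists c; split=> n; [case: (hc n)|move=> z i; case: (hc i) => _; apply].
move=> n.
have q_ge0 q z : X_ball q z -> 0 <= q.
  by move=> [_ [x _ <-]]; apply/le_trans/snorm_ge0.
have [[q0 [z0 [zX z0n]]]|none] := pselect (exists q z, X_ball q z /\ z n != 0); last first.
  exists 0; split=> // q z zX; rewrite mul0r leNgt; apply/negP => zn.
  by apply: none; exists q, z; split=> //; rewrite gt_eqF.
have z0p : 0 < z0 n by rewrite lt_neqAle eq_sym z0n; case: zX => h _ _; apply: h.
(* A multiple of the unit sequence at [n]; it belongs to X because [z0] dominates it. *)
pose dl (i : Zd d) : R[i] := if i == n then (z0 n)%:C else 0.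
have [[xd _ xdE] _] : embedded ev dl /\ snorm (embedded ev) dl <= C *
    snorm (embedded ev) (fun n => (z0 n)%:C).
  case: zX => z0_ge0 zX _; apply: hC zX => i; rewrite /dl; case: eqP => [->//|_].
  by rewrite cabs0 cabs_ge0.
set nu := snorm (embedded ev) (ev xd).
have nu0 : 0 < nu.
  rewrite lt_neqAle snorm_ge0 andbT eq_sym; apply/eqP => nu_eq0.
  have : `|xd| = 0.
    have := normr_ge0 xd; rewrite lecE => /andP[/eqP im _].
    apply/eqP; rewrite eq_complex /= -snorm_ev -/nu nu_eq0 eqxx /=.
    by rewrite im.
  move/normr0_eq0 => xd0; move: (congr1 (fun f => f n) xdE).
  rewrite xd0 ev0 /dl eqxx => /eqP; rewrite eq_sym => /eqP [z00].
  by rewrite z00 eqxx in z0n.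
exists (`|C| * z0 n / nu); split; first by rewrite divr_ge0 ?mulr_ge0 // ltW.
move=> q z [z_ge0 zE zq].
(* Rescaled to take the value [z n] at [n], the same sequence is dominated by [z], which bounds
   [z n] by the norm of [z]. *)
pose a := z n / z0 n; have a0 : 0 <= a by rewrite divr_ge0 // ltW.
have [_] : embedded ev (ev (a%:C *: xd)) /\ snorm (embedded ev) (ev (a%:C *: xd)) <=
    C * snorm (embedded ev) (fun n => (z n)%:C).
  apply: hC zE => i; rewrite evZ cabsM cabs_real ger0_norm // xdE /dl.
  case: eqP => [->|_]; last by rewrite cabs0 mulr0 cabs_ge0.
  by rewrite !cabs_real !ger0_norm // ?(ltW z0p) // /a divfK.
rewrite snormZ // -/nu => le1.
have sz : 0 <= snorm (embedded ev) (fun n => (z n)%:C).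
  by case: zE => x _ <-; apply: snorm_ge0.
have le2 : C * snorm (embedded ev) (fun n => (z n)%:C) <= `|C| * q.
  apply: le_trans (_ : `|C| * snorm (embedded ev) (fun n => (z n)%:C) <= _).
    by rewrite ler_wpM2r // ler_norm.
  by rewrite ler_wpM2l.
have : a * nu <= `|C| * q := le_trans le1 le2.
rewrite /a mulrAC ler_pdivrMr // -ler_pdivlMr // => h.
by apply: le_trans h _; apply: ler_eq; ring.
Qed.

End XBalls.

(** * Multilinear operators attached to the estimates *)

Section Operators.
Variables (R : realType) (d p : nat) (D : Zd d -> set (tuples d p)).
Variables (a : Zd d -> tuples d p -> R) (C : R).
Hypothesis a0 : forall n k, 0 <= a n k.

Definition multi_op (y : 'I_p -> Zd d -> R) (n : Zd d) : R :=
  fine (\esum_(k in D n) (a n k * \prod_(j < p) y j (k j))%:E).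

Lemma multi_op_ge0 y n : (forall j i, 0 <= y j i) -> 0 <= multi_op y n.
Proof.
move=> y0; apply/fine_ge0/esum_ge0 => k _.
by rewrite lee_fin mulr_ge0 // prodr_ge0.
Qed.

Lemma multi_op_bound src tgt (y : 'I_p -> Zd d -> R) :
  multilinear_bound D a C src tgt ->
  (forall j n, 0 <= y j n) -> (forall j, src j (fun n => (y j n)%:C)) ->
  [/\ tgt (fun n => (multi_op y n)%:C),
      snorm tgt (fun n => (multi_op y n)%:C) <=
        C * \prod_(j < p) snorm (src j) (fun n => (y j n)%:C) &
      forall n (s : seq (tuples d p)), uniq s -> (forall k, k \in s -> D n k) ->
        \sum_(k <- s) a n k * \prod_(j < p) y j (k j) <= multi_op y n].
Proof.
move=> hb y0 ysrc; have [hs ht hn] := hb _ ysrc.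
have tE n : mterm (fun n k => (a n k)%:C) (fun j n => (y j n)%:C) n =
    fun k => (a n k * \prod_(j < p) y j (k j))%:C.
  by apply/funext => k; rewrite /mterm rmorphM rmorph_prod.
have t0 n k : 0 <= a n k * \prod_(j < p) y j (k j) by rewrite mulr_ge0 ?prodr_ge0.
have mE : multisum D (fun n k => (a n k)%:C) (fun j n => (y j n)%:C) =
    fun n => (multi_op y n)%:C.
  by apply/funext => n; rewrite /multisum tE csum_ge0E.
split; rewrite -?mE // => n s us sD; apply: esum_fin_ge => //.
have := hs n; rewrite tE /abs_summable /summable.
by under eq_esum => k _ do rewrite cabs_real abse_EFin normr_id (ger0_norm (t0 n k)).
Qed.

Section L2.
Variables (s : R).
Hypothesis hb : multilinear_bound D a C (fun=> l2 d s) (l2 d s).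
Hypothesis C0 : 0 <= C.

Lemma multi_op_l2 r y : l2_ball s r y ->
  l2_ball s (C * r ^+ p) (multi_op (fun=> y)) /\
  forall n (t : seq (tuples d p)), uniq t -> (forall k, k \in t -> D n k) ->
    \sum_(k <- t) a n k * lprod y (children k) <= multi_op (fun=> y) n.
Proof.
move=> yE; have [y0 r0 _] := yE; have [yl yr] := l2_ball_real yE.
have [h1 h2 h3] := multi_op_bound hb (fun _ => y0) (fun _ => yl).
split; last first.
  move=> n t ut tD; apply: le_trans (h3 n t ut tD).
  by apply: ler_sum => k _; rewrite lprod_children.
have rp0 : 0 <= C * r ^+ p by rewrite mulr_ge0 // exprn_ge0.
have := (l2_ballP s (fun n => (multi_op (fun=> y) n)%:C) rp0).1.
rewrite (_ : (fun n => cabs _) = multi_op (fun=> y)); last first.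
  by apply/funext => n; rewrite cabs_real ger0_norm // multi_op_ge0.
apply; split=> //; apply: le_trans h2 _; apply: ler_wpM2l => //.
rewrite prodr_const card_ord lerXn2r ?nnegrE //; exact: sqrtr_ge0.
Qed.

End L2.

Section X.
Variables (X : completeNormedModType R[i]) (ev : X -> (Zd d -> R[i])) (s : R).
Hypothesis hX : function_space ev.
Hypothesis C0 : 0 <= C.

Lemma multi_op_l2X r y :
  multilinear_bound D a C (fun=> l2 d s) (embedded ev) -> l2_ball s r y ->
  X_ball ev (C * r ^+ p) (multi_op (fun=> y)) /\
  forall n (t : seq (tuples d p)), uniq t -> (forall k, k \in t -> D n k) ->
    \sum_(k <- t) a n k * lprod y (children k) <= multi_op (fun=> y) n.
Proof.
move=> hb yE; have [y0 r0 _] := yE; have [yl yr] := l2_ball_real yE.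
have [h1 h2 h3] := multi_op_bound hb (fun _ => y0) (fun _ => yl).
split; last first.
  move=> n t ut tD; apply: le_trans (h3 n t ut tD).
  by apply: ler_sum => k _; rewrite lprod_children.
split=> // [n|]; first exact: multi_op_ge0.
apply: le_trans h2 _; apply: ler_wpM2l => //.
rewrite prodr_const card_ord lerXn2r ?nnegrE //; exact: sqrtr_ge0.
Qed.

(** The derivative of the operator at [y] in the direction [z]. The estimate with the j-th argument
    in X is applied to the j-th term, whence a constant [p%:R * C]. *)
Definition diff_op (y z : Zd d -> R) n :=
  \sum_(j < p) multi_op (fun l => if l == j then z else y) n.

Hypothesis hb : forall j : 'I_p,
  multilinear_bound D a C (one_in j (embedded ev) (l2 d s)) (embedded ev).

Lemma diff_op_X r q y z : l2_ball s r y -> X_ball ev q z ->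
  X_ball ev (p%:R * C * r ^+ p.-1 * q) (diff_op y z) /\
  forall n (t : seq (tuples d p)), uniq t -> (forall k, k \in t -> D n k) ->
    \sum_(k <- t) a n k * ldiff y z (children k) <= diff_op y z n.
Proof.
move=> yE zE; have [y0 r0 _] := yE; have [yl yr] := l2_ball_real yE.
have [z0 zl zr] := zE.
pose yz (j l : 'I_p) := if l == j then z else y.
have yz0 j l n : 0 <= yz j l n by rewrite /yz; case: (l == j).
have yzs j l : one_in j (embedded ev) (l2 d s) l (fun n => (yz j l n)%:C).
  by rewrite /one_in /yz; case: (l == j).
have hj j := multi_op_bound (@hb j) (yz0 j) (yzs j).
split; last first.
  move=> n t ut tD.
  under eq_bigr => k _ do rewrite ldiff_children mulr_sumr.
  rewrite exchange_big /=; apply: ler_sum => j _.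
  by case: (hj j) => _ _; apply.
have [_ _ _ _ Xle] := X_ball_norm hX.
have q0 : 0 <= q by apply: le_trans zr; case: zl => x _ <-; apply: snorm_ge0.
have b j : X_ball ev (C * r ^+ p.-1 * q)
    (multi_op (yz j)).
  have [h1 h2 _] := hj j; split=> // [n|].
    exact: multi_op_ge0.
  apply: le_trans h2 _; rewrite -mulrA; apply: ler_wpM2l => //.
  rewrite (bigD1 j) //= /one_in /yz eqxx mulrC; apply: ler_pM => //.
  - apply: prodr_ge0 => l /negPf lj; rewrite lj; exact: sqrtr_ge0.
  - by case: zl => x _ <-; apply: snorm_ge0.
  - rewrite (eq_bigr (fun=> snorm (l2 d s) (fun n => (y n)%:C))); last first.
      by move=> l /negPf lj; rewrite lj.
    rewrite prodr_const cardC1 card_ord lerXn2r ?nnegrE //; exact: sqrtr_ge0.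
have := @norm_balls_sum _ _ _ (X_ball_norm hX) _ (enum 'I_p) (fun=> 1) _ _
  (fun _ _ => ler01) (fun j _ => b j).
rewrite big_enum sumr_const card_ord !mulrA.
rewrite (_ : (fun n => _) = diff_op y z) //.
by apply/funext => n; rewrite big_enum; apply: eq_bigr => j _; rewrite mul1r.
Qed.

End X.
End Operators.

(** * Majorants *)

Section LevelConstants.
Variables (R : realType) (p : nat).
Implicit Types (C c : R).

Definition level_coef c (i : nat) : R := c / 2 ^+ i.

(** Decreasing from [2 * C0] towards [C0]. The drop [C0 / 2 ^ i.+1] from level [i] to the next makes
    room for the operator of level [i], whose coefficient decays at the same rate. *)
Definition level_radius (C0 : R) (i : nat) : R := C0 * (1 + 2^-1 ^+ i).

Definition small_coef C (C0 : R) c := [/\ 0 < c, c <= 1,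
  c * (C * (2 * C0) ^+ p) <= C0 / 2 & c * (C * (2 * C0) ^+ p.-1) <= 1].

Lemma small_coef_exists C (C0 : R) : 0 <= C -> 0 < C0 -> exists c, small_coef C C0 c.
Proof.
move=> C_ge0 C0_gt0.
pose u := 2 * (C * (2 * C0) ^+ p) / C0; pose v := C * (2 * C0) ^+ p.-1.
have u0 : 0 <= u.
  by rewrite divr_ge0 ?(ltW C0_gt0) // mulr_ge0 // mulr_ge0 // exprn_ge0 //
    mulr_ge0 // ltW.
have v0 : 0 <= v by rewrite mulr_ge0 // exprn_ge0 // mulr_ge0 // ltW.
have w0 : 0 < 1 + u + v by lra.
exists (1 + u + v)^-1; split; first by rewrite invr_gt0.
- by rewrite invf_le1 //; lra.
- rewrite mulrC ler_pdivrMr //.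
  have -> : C * (2 * C0) ^+ p = u * C0 / 2 by rewrite /u; field; rewrite gt_eqF.
  nra.
- by rewrite mulrC ler_pdivrMr // mul1r -/v; lra.
Qed.

Section Radius.
Variables (C C0 c : R).
Hypotheses (C_ge0 : 0 <= C) (C0_gt0 : 0 < C0) (hc : small_coef C C0 c).

Lemma level_coef_gt0 i : 0 < level_coef c i.
Proof. by case: hc => c0 _ _ _; rewrite divr_gt0 // exprn_gt0. Qed.

Lemma level_radius_le i : 0 <= level_radius C0 i <= 2 * C0.
Proof.
have h0 : 0 <= (2^-1 : R) ^+ i by rewrite exprn_ge0 // invr_ge0.
have h1 : (2^-1 : R) ^+ i <= 1 by rewrite exprn_ile1 // ?invr_ge0 // invf_le1 // ler1n.
by rewrite /level_radius mulr_ge0 ?(ltW C0_gt0) ?addr_ge0 //= mulrC ler_pM2r //; lra.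
Qed.

Lemma level_radius_init i : (1 + level_coef c i) * C0 <= level_radius C0 i.
Proof.
case: hc => c0 c1 _ _; rewrite mulrC ler_pM2l // lerD2l /level_coef exprVn.
by rewrite ler_pdivrMr ?exprn_gt0 // mulVf // expf_neq0.
Qed.

Lemma level_radius_step i : level_radius C0 i.+1 +
  level_coef c i * (C * level_radius C0 i.+1 ^+ p) <= level_radius C0 i.
Proof.
case: hc => c0 c1 h _; have /andP[r0 r1] := level_radius_le i.+1.
have rp : C * level_radius C0 i.+1 ^+ p <= C * (2 * C0) ^+ p.
  by rewrite ler_wpM2l // lerXn2r ?nnegrE // (le_trans r0).
have cc : level_coef c i * (C * level_radius C0 i.+1 ^+ p) <=
    C0 / 2 * 2^-1 ^+ i.
  rewrite /level_coef -exprVn mulrAC; apply: ler_wpM2r.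
    by rewrite exprn_ge0 // invr_ge0.
  by apply: le_trans h; rewrite ler_pM2l.
have e1 : level_radius C0 i.+1 = C0 + 2^-1 * (C0 * 2^-1 ^+ i).
  by rewrite /level_radius exprS; ring.
have e2 : level_radius C0 i = C0 + C0 * 2^-1 ^+ i by rewrite /level_radius; ring.
apply: le_trans (lerD (lexx _) cc) _.
by rewrite e1 e2 -addrA lerD2l; apply: ler_eq; field.
Qed.

Lemma level_radius_le1 i :
  level_coef c i * (C * level_radius C0 i.+1 ^+ p.-1) <= 1.
Proof.
case: hc => c0 c1 _ h; have /andP[r0 r1] := level_radius_le i.+1.
have rp : C * level_radius C0 i.+1 ^+ p.-1 <= C * (2 * C0) ^+ p.-1.
  by rewrite ler_wpM2l // lerXn2r ?nnegrE // (le_trans r0).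
have cc : level_coef c i <= c.
  rewrite /level_coef ler_pdivrMr ?exprn_gt0 // ler_peMr ?(ltW c0) //.
  by rewrite exprn_ege1 // ler1n.
apply: le_trans h; apply: ler_pM => //; first exact/ltW/level_coef_gt0.
by rewrite mulr_ge0 // exprn_ge0.
Qed.

End Radius.
End LevelConstants.

Section KernelMajorants.
Variables (R : realType) (d p : nat).
Variables (X : completeNormedModType R[i]) (ev : X -> (Zd d -> R[i])).
Hypothesis hX : function_space ev.
Variable (s : R).
Variable Lab : eqType.
Implicit Types (Ker : Lab -> Lab -> Zd d -> tuples d p -> R) (C : R).

Definition finite_decomp (n : Zd d) (t : seq (tuples d p)) :=
  uniq t /\ forall k, k \in t -> decomp n k.

(** The operator [N] is fixed before the finite set [t], so that the bounds are uniform over finite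
    sets of moves. *)
Definition kernel_l2 Ker C :=
  (forall a b n k, 0 <= Ker a b n k) /\
  exists N : Lab -> Lab -> (Zd d -> R) -> Zd d -> R,
  forall a b r y, l2_ball s r y -> l2_ball s (C * r ^+ p) (N a b y) /\
    forall n t, finite_decomp n t ->
      \sum_(k <- t) Ker a b n k * lprod y (children k) <= N a b y n.

Definition kernel_X Ker C :=
  exists M : Lab -> Lab -> (Zd d -> R) -> (Zd d -> R) -> Zd d -> R,
  forall a b r q y z, l2_ball s r y -> X_ball ev q z ->
    X_ball ev (C * r ^+ p.-1 * q) (M a b y z) /\
    forall n t, finite_decomp n t ->
      \sum_(k <- t) Ker a b n k * ldiff y z (children k) <= M a b y z n.

Variables (wt : Lab -> R) (box : nat -> seq Lab).
Hypotheses (wt0 : forall a, 0 <= wt a)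
  (wt1 : forall L, \sum_(a <- box L) wt a <= 2^-1).
Variables (Ker : Lab -> Lab -> Zd d -> tuples d p -> R) (C C0 c : R).
Hypotheses (C_ge0 : 0 <= C) (C0_gt0 : 0 < C0) (hc : small_coef p C C0 c).

Definition move_bound (K : nat) (P : nat -> nat -> Lab -> seq (Zd d) -> R) :=
  forall L i a sg D (g : Zd d * tuples d p * seq (Zd d) -> R) lab,
  (i < K)%N -> (forall n, finite_decomp n (D n)) ->
  (forall v, v \in moves D sg -> lab v \in box L /\
     0 <= g v <= wt (lab v) * Ker a (lab v) v.1.1 v.1.2) ->
  \sum_(v <- moves D sg) g v * P L i.+1 (lab v) v.2 <=
  (level_coef c i)^-1 * P L i a sg.

Lemma l2_majorants K y : kernel_l2 Ker C -> l2_ball s C0 y ->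
  exists P : nat -> nat -> Lab -> seq (Zd d) -> R,
  [/\ forall L i a sg, lprod y sg <= P L i a sg,
      forall L i a sg, (size sg)%:R * lprod y sg <= (level_coef c i)^-1 * P L i a sg,
      move_bound K P &
      forall L a, l2_ball s (4 * C0) (fun n => P L 0 a [:: n])].
Proof.
move=> [Ker0 [N hN]] yE.
have hE := l2_ball_norm d s.
have c0 := level_coef_gt0 hc.
have r0r := level_radius_init C0_gt0 hc.
have rS := level_radius_step C_ge0 C0_gt0 hc.
have r0_ge0 := ltW C0_gt0.
exists (fun L i => pot wt (box L) N (level_coef c) y (K - i) i).
(* The potential does not involve the sets of moves; the bounds that mention no move are obtained
   with empty ones. *)
have D0 n : finite_decomp n [::] by split.
have hN0 a b r y' : l2_ball s r y' -> l2_ball s (C * r ^+ p) (N a b y') /\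
    forall n, \sum_(k <- (fun=> [::]) n) Ker a b n k * lprod y' (children k) <=
      N a b y' n.
  by move=> Ey'; have [h1 h2] := hN a b r y' Ey'; split=> // n; apply: h2.
split.
- by move=> L i a sg; apply: (pot_lprod hE (box L) wt0 hN0 c0 yE r0r rS).
- by move=> L i a sg; apply: (pot_size hE (box L) wt0 hN0 c0 yE r0r rS).
- move=> L i a sg D g lab iK hD hg.
  have hND a' b r y' : l2_ball s r y' -> l2_ball s (C * r ^+ p) (N a' b y') /\
      forall n, \sum_(k <- D n) Ker a' b n k * lprod y' (children k) <= N a' b y' n.
    by move=> Ey'; have [h1 h2] := hN a' b r y' Ey'; split=> // n; apply: h2.
  rewrite -[(K - i)%N](prednK _) ?subn_gt0 // -subnS.
  exact: (pot_move hE wt0 Ker0 hND c0 yE r0r rS _ _ hg).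
- move=> L a; case: hE => _ _ _ _ Ele.
  apply: Ele (potE (l2_ball_norm d s) wt0 (wt1 L) hN0 c0 yE r0_ge0 r0r rS _ _ a) _.
  (* The total weight is at most 2 and the radius of level 0 is [2 * C0]. *)
  by rewrite /level_radius expr0; lra.
Qed.

Lemma X_majorants K y q z : kernel_l2 Ker C -> kernel_X Ker C ->
  l2_ball s C0 y -> X_ball ev q z -> 0 <= q ->
  exists F : nat -> nat -> Lab -> seq (Zd d) -> R,
  [/\ forall L i a sg, 0 <= F L i a sg,
      forall L a sg, ldiff y z sg <= F L K a sg,
      move_bound K F &
      forall L a, X_ball ev (2 * (q * 2 ^+ K)) (fun n => F L 0 a [:: n])].
Proof.
move=> [Ker0 [N hN]] [M hM] yE zX q0.
have hE := l2_ball_norm d s.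
have hXb := X_ball_norm hX.
have c0 := level_coef_gt0 hc.
have r0r := level_radius_init C0_gt0 hc.
have rS := level_radius_step C_ge0 C0_gt0 hc.
have r1 := level_radius_le1 C_ge0 C0_gt0 hc.
exists (fun L i => dpot wt (box L) N M (level_coef c) y z (K - i) i).
have hND D a b r y' : (forall n, finite_decomp n (D n)) ->
    l2_ball s r y' -> l2_ball s (C * r ^+ p) (N a b y') /\
    forall n, \sum_(k <- D n) Ker a b n k * lprod y' (children k) <= N a b y' n.
  by move=> hD Ey'; have [h1 h2] := hN a b r y' Ey'; split=> // n; apply: h2.
have hMD D a b r q' y' z' : (forall n, finite_decomp n (D n)) ->
    l2_ball s r y' -> X_ball ev q' z' ->
    X_ball ev (C * r ^+ p.-1 * q') (M a b y' z') /\
    forall n, \sum_(k <- D n) Ker a b n k * ldiff y' z' (children k) <=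
      M a b y' z' n.
  move=> hD Ey' Xz'; have [h1 h2] := hM a b r q' y' z' Ey' Xz'.
  by split=> // n; apply: h2.
have D0 n : finite_decomp n ((fun=> [::]) n) by split.
have hN0 a b r y' := hND _ a b r y' D0.
have hM0 a b r q' y' z' := hMD _ a b r q' y' z' D0.
split.
- move=> L i a sg; apply: sumr_ge0 => l _; apply: mulr_ge0.
    exact: seq_wt_ge0.
  apply: ldiff_ge0 => n.
    exact: (ymaj_ge0 hE hN0 c0 yE r0r rS).
  exact: (zmaj_ge0 hE hXb hN0 hM0 c0 yE r0r rS r1 zX q0).
- move=> L a sg; rewrite subnn.
  exact: (dpot_ldiff hE hXb wt (box L) hN0 hM0 c0 yE r0r rS r1 zX q0).
- move=> L i a sg D g lab iK hD hg.
  rewrite -[(K - i)%N](prednK _) ?subn_gt0 // -subnS.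
  exact: (dpot_move hE hXb wt0 Ker0 (fun a b r y' => @hND D a b r y' hD)
    (fun a b r q' y' z' => @hMD D a b r q' y' z' hD) c0 yE r0r rS r1 zX q0 _ _ hg).
- move=> L a.
  have := dpotX hE hXb wt0 (wt1 L) hN0 hM0 c0 yE r0r rS r1 zX q0 (K - 0) 0 a.
  by rewrite subn0.
Qed.

End KernelMajorants.

(** * Kernels given by the multilinear estimates *)

Section Kernels.
Variables (R : realType) (d p : nat).
Variables (X : completeNormedModType R[i]) (ev : X -> (Zd d -> R[i])).
Hypothesis hX : function_space ev.
Variable (s : R).
Implicit Types (C : R).

Lemma kernel_l2_le (Lab : eqType) (Ker : Lab -> Lab -> Zd d -> tuples d p -> R) C C' :
  kernel_l2 s Ker C -> C <= C' -> kernel_l2 s Ker C'.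
Proof.
move=> [K0 [N hN]] CC; split=> //; exists N => a b r y yE.
have [h1 h2] := hN a b r y yE; split=> //; case: (l2_ball_norm d s) => _ _ _ _ Ele.
apply: Ele h1 _; rewrite ler_wpM2r // exprn_ge0 //; by case: yE.
Qed.

Lemma kernel_l2_domin (Lab : eqType) (Ker Ker' : Lab -> Lab -> Zd d -> tuples d p -> R) C :
  kernel_l2 s Ker C -> (forall a b n k, 0 <= Ker' a b n k <= Ker a b n k) ->
  kernel_l2 s Ker' C.
Proof.
move=> [K0 [N hN]] KK; split; first by move=> a b n k; case/andP: (KK a b n k).
exists N => a b r y yE; have [h1 h2] := hN a b r y yE; split=> // n t nt.
apply: le_trans (h2 n t nt); apply: ler_sum => k _.
by apply: ler_wpM2r; [apply: lprod_ge0; case: yE|case/andP: (KK a b n k)].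
Qed.

Lemma kernel_X_le (Lab : eqType) (Ker : Lab -> Lab -> Zd d -> tuples d p -> R) C C' :
  kernel_X ev s Ker C -> C <= C' -> kernel_X ev s Ker C'.
Proof.
move=> [M hM] CC; exists M => a b r q y z yE zE.
have [h1 h2] := hM a b r q y z yE zE; split=> //.
case: (X_ball_norm hX) => _ _ _ _ Ele.
apply: Ele h1 _; rewrite -!mulrA ler_wpM2r // mulr_ge0 //.
  by rewrite exprn_ge0 //; case: yE.
by case: zE => _ [x _ <-]; apply/le_trans/snorm_ge0.
Qed.

Lemma kernel_l2_const (a : Zd d -> tuples d p -> R) C : (forall n k, 0 <= a n k) -> 0 <= C ->
  multilinear_bound (@decomp d p) a C (fun=> l2 d s) (l2 d s) ->
  kernel_l2 s (fun _ _ : unit => a) C.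
Proof.
move=> a0 C0 hb; split=> //.
exists (fun _ _ y => multi_op (@decomp d p) a (fun=> y)) => _ _ r y yE.
have [h1 h2] := multi_op_l2 a0 hb C0 yE; split=> // n t [ut tD]; exact: h2.
Qed.

Lemma kernel_X_const (a : Zd d -> tuples d p -> R) C : (forall n k, 0 <= a n k) -> 0 <= C ->
  (forall j : 'I_p, multilinear_bound (@decomp d p) a C
     (one_in j (embedded ev) (l2 d s)) (embedded ev)) ->
  kernel_X ev s (fun _ _ : unit => a) (p%:R * C).
Proof.
move=> a0 C0 hb.
exists (fun _ _ y z => diff_op (@decomp d p) a y z) => _ _ r q y z yE zE.
have [h1 h2] := diff_op_X a0 hX C0 hb yE zE; split=> // n t [ut tD]; exact: h2.
Qed.

Variables (phi : Zd d -> tuples d p -> R) (m : Zd d -> tuples d p -> R[i]).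
Let absm n k := cabs (m n k).

Definition win_ind (mu : int) n (k : tuples d p) : R :=
  if mu%:~R <= phi n k < mu%:~R + 1 then 1 else 0.

Lemma win_ind_ge0 mu n k : 0 <= win_ind mu n k.
Proof. by rewrite /win_ind; case: ifP. Qed.

(* If a and b are the integer parts of the phases before and after a move,
   then the phase of the move itself lies in one of two adjacent windows. *)
Definition win_ker (a b : int) n k : R :=
  absm n k * (win_ind (b - a) n k + win_ind (b - a - 1) n k).

Lemma win_ker_ge0 a b n k : 0 <= win_ker a b n k.
Proof. by rewrite mulr_ge0 ?cabs_ge0 // addr_ge0 ?win_ind_ge0. Qed.

Lemma win_ker_floor alpha n k :
  absm n k <= win_ker (Num.floor alpha) (Num.floor (alpha + phi n k)) n k.
Proof.
rewrite /win_ker ler_peMr ?cabs_ge0 //.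
have i1 := win_ind_ge0; move: (i1 (Num.floor (alpha + phi n k) - Num.floor alpha - 1) n k).
move: (i1 (Num.floor (alpha + phi n k) - Num.floor alpha) n k) => {i1}.
rewrite /win_ind.
set f := phi n k; set a := Num.floor alpha; set b := Num.floor (alpha + f).
have a1 : a%:~R <= alpha := floor_le alpha.
have a2 : alpha < a%:~R + 1 by have := floorD1_gt alpha; rewrite intrD1.
have b1 : b%:~R <= alpha + f := floor_le _.
have b2 : alpha + f < b%:~R + 1 by have := floorD1_gt (alpha + f); rewrite intrD1.
rewrite !rmorphB /=.
(* [f] lies strictly between [b - a - 1] and [b - a + 1]; the comparison decides which window
   contains it. *)
have [h|h] := leP (b%:~R - a%:~R) f.
  have -> : f < b%:~R - a%:~R + 1 by lra.
  by move=> _ /=; lra.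
have -> : b%:~R - a%:~R - 1 <= f by lra.
have -> : f < b%:~R - a%:~R - 1 + 1 by lra.
by move=> /= _ _; rewrite add0r.
Qed.

Lemma win_sum (mu : int) n (t : seq (tuples d p)) (g : tuples d p -> R) :
  \sum_(k <- t) absm n k * win_ind mu n k * g k =
  \sum_(k <- [seq k <- t | mu%:~R <= phi n k < mu%:~R + 1]) absm n k * g k.
Proof.
rewrite big_filter [RHS]big_mkcond; apply: eq_bigr => k _ /=.
by rewrite /win_ind; case: ifP => _; rewrite ?mulr1 // mulr0 mul0r.
Qed.

Lemma win_finite (mu : int) n t : finite_decomp n t ->
  let t' := [seq k <- t | mu%:~R <= phi n k < mu%:~R + 1] in
  uniq t' /\ forall k, k \in t' -> window phi mu n k.
Proof.
move=> [ut tD] t'; split; first exact: filter_uniq.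
by move=> k; rewrite mem_filter => /andP[h /tD].
Qed.

Lemma absm_ge0 n k : 0 <= absm n k.
Proof. exact: cabs_ge0. Qed.

Lemma kernel_l2_win C : 0 <= C ->
  (forall mu : int, multilinear_bound (window phi mu) absm C (fun=> l2 d s) (l2 d s)) ->
  kernel_l2 s win_ker (2 * C).
Proof.
move=> C0 hb; split; first exact: win_ker_ge0.
exists (fun a b y n => multi_op (window phi (b - a)) absm (fun=> y) n +
  multi_op (window phi (b - a - 1)) absm (fun=> y) n) => a b r y yE.
have [h1 h2] := multi_op_l2 absm_ge0 (hb (b - a)) C0 yE.
have [h3 h4] := multi_op_l2 absm_ge0 (hb (b - a - 1)) C0 yE.
split.
  case: (l2_ball_norm d s) => _ _ ED _ _.
  by have := ED _ _ _ _ h1 h3; rewrite -mulrA mulr_natl mulr2n.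
move=> n t nt.
under eq_bigr => k _ do rewrite /win_ker mulrDr mulrDl.
rewrite big_split /= !win_sum.
have [u1 v1] := win_finite (b - a) nt.
have [u2 v2] := win_finite (b - a - 1) nt.
by apply: lerD; [apply: h2|apply: h4].
Qed.

Lemma kernel_X_win C : 0 <= C ->
  (forall (mu : int) (j : 'I_p), multilinear_bound (window phi mu) absm C
     (one_in j (embedded ev) (l2 d s)) (embedded ev)) ->
  kernel_X ev s win_ker (2 * (p%:R * C)).
Proof.
move=> C0 hb.
exists (fun a b y z n => diff_op (window phi (b - a)) absm y z n +
  diff_op (window phi (b - a - 1)) absm y z n) => a b r q y z yE zE.
have [h1 h2] := diff_op_X absm_ge0 hX C0 (hb (b - a)) yE zE.
have [h3 h4] := diff_op_X absm_ge0 hX C0 (hb (b - a - 1)) yE zE.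
split.
  case: (X_ball_norm hX) => _ _ ED _ _.
  have -> : 2 * (p%:R * C) * r ^+ p.-1 * q =
    p%:R * C * r ^+ p.-1 * q + p%:R * C * r ^+ p.-1 * q by ring.
  exact: ED h1 h3.
move=> n t nt.
under eq_bigr => k _ do rewrite /win_ker mulrDr mulrDl.
rewrite big_split /= !win_sum.
have [u1 v1] := win_finite (b - a) nt.
have [u2 v2] := win_finite (b - a - 1) nt.
by apply: lerD; [apply: h2|apply: h4].
Qed.

End Kernels.

(** * Majorants under (A) and under (B) *)

Section Majorants.
Variables (R : realType) (d p : nat).
Variables (phi : Zd d -> tuples d p -> R) (m : Zd d -> tuples d p -> R[i]).

(** Real phases replace the labels. The condition on [L] keeps their integer parts in a finite
    box. *)
Definition phase_bound (c : nat -> R) (om : R -> R -> R) K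
    (P : nat -> nat -> R -> seq (Zd d) -> R) :=
  forall L i al sg D, (i < K)%N -> (forall n, finite_decomp n (D n)) ->
  (forall v, v \in moves D sg -> `|al + phi v.1.1 v.1.2| <= L%:R) ->
  \sum_(v <- moves D sg) cabs (m v.1.1 v.1.2) * om al (phi v.1.1 v.1.2) *
     P L i.+1 (al + phi v.1.1 v.1.2) v.2 <=
  (c i)^-1 * P L i al sg.

(* P bounds the products of y over a state, and is controlled in l2_s; F bounds
   what is left after K steps, and is controlled through X. A move costs a factor
   1 / c i, whatever the finite sets of moves of phase at most L. *)
Record majorants (s : R) (c : nat -> R) (om omX : R -> R -> R) (K : nat)
    (C1 : R) (Cn : Zd d -> R) (y : Zd d -> R)
    (P F : nat -> nat -> R -> seq (Zd d) -> R) : Prop := Majorants {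
  maj_lprod : forall L i al sg, lprod y sg <= P L i al sg;
  maj_size : forall L i al sg, (size sg)%:R * lprod y sg <= (c i)^-1 * P L i al sg;
  maj_move : phase_bound c om K P;
  maj_ge0 : forall L i al sg, 0 <= F L i al sg;
  maj_last : forall L al sg D, (forall n, finite_decomp n (D n)) ->
    \sum_(v <- moves D sg) cabs (m v.1.1 v.1.2) * lprod y v.2 <= F L K al sg;
  maj_moveX : phase_bound c omX K F;
  maj_l2 : forall L, l2_ball s C1 (fun n => P L 0 0 [:: n]);
  maj_point : forall L n, F L 0 0 [:: n] <= Cn n * 2 ^+ K }.

(** The order of quantifiers matters: [c] and [Cn] come before [K] and [y], since the thresholds and
    the growth rate derived from [c] must depend neither on the number of steps nor on time. *)
Definition has_majorants s om omX := forall C0 : R, 0 < C0 ->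
  exists c (Cn : Zd d -> R), [/\ 0 < c, c <= 1, forall n, 0 <= Cn n &
    forall K y, l2_ball s C0 y -> exists P F,
      majorants s (level_coef c) om omX K (4 * C0) Cn y P F].

Variables (X : completeNormedModType R[i]) (ev : X -> (Zd d -> R[i])).
Hypotheses (hX : function_space ev) (hsolid : solid (embedded ev)).
Variable (s : R).

Lemma sum_moves_le_ldiff (y z : Zd d -> R) D sg : (forall n, 0 <= y n) ->
  (forall n (t : seq (tuples d p)), uniq t -> (forall k, k \in t -> decomp n k) ->
    \sum_(k <- t) cabs (m n k) * lprod y (children k) <= z n) ->
  (forall n, finite_decomp n (D n)) ->
  \sum_(v <- moves D sg) cabs (m v.1.1 v.1.2) * lprod y v.2 <= ldiff y z sg.
Proof.
move=> y0 hz hD; rewrite (sum_moves_lprod D (fun n k => cabs (m n k)) y sg).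
by apply: le_ldiff => // n; case: (hD n) => u h; apply: hz.
Qed.

Lemma bracket_ge1 (x : R) : 1 <= bracket x.
Proof.
by rewrite /bracket -[leLHS]sqrtr1 ler_wsqrtr // lerDl sqr_ge0.
Qed.

Lemma bracket_le (x : R) : bracket x <= 1 + `|x|.
Proof.
have h : 0 <= 1 + `|x| by rewrite addr_ge0.
rewrite /bracket -(ger0_norm h) -sqrtr_sqr ler_wsqrtr // sqrrD expr1n mul1r.
by rewrite real_normK ?num_real // -addrA lerD2l lerDr mulrn_wge0.
Qed.

(** (A1) and (A2) do not see the phases of earlier moves: a single label of weight 1/2 suffices,
    whence the factor [2^-1] in both weights. *)
Lemma majorants_A (delta C : R) : 0 < delta < 2^-1 -> 0 < C ->
  multilinear_bound (@decomp d p)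
    (fun n k => cabs (m n k) / bracket (phi n k) `^ 2^-1) C
    (fun=> l2 d s) (l2 d s) ->
  (forall j : 'I_p, multilinear_bound (@decomp d p)
    (fun n k => cabs (m n k) / bracket (phi n k) `^ (1 - delta)) C
    (one_in j (embedded ev) (l2 d s)) (embedded ev)) ->
  multilinear_bound (@decomp d p) (fun n k => cabs (m n k)) C
    (fun=> l2 d s) (embedded ev) ->
  has_majorants s (fun _ f => 2^-1 * (1 + `|f|) `^ (- 2^-1))
    (fun _ f => 2^-1 * (1 + `|f|) `^ (- (1 - delta))).
Proof.
move=> /andP[de0 de1] C_gt0 A1 A2 A3 C0 C0_gt0; have C_ge0 := ltW C_gt0.
have de2 : 0 <= 1 - delta by lra.
set a1 := fun n k => _ in A1; set a2 := fun n k => _ in A2.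
have a10 n k : 0 <= a1 n k by rewrite /a1 divr_ge0 ?cabs_ge0 ?powR_ge0.
have a20 n k : 0 <= a2 n k by rewrite /a2 divr_ge0 ?cabs_ge0 ?powR_ge0.
(* The potential of the remainder needs one kernel bounded both in l2_s and through X. As
   [1 - delta] exceeds 1/2, the kernel of (A2) inherits the bound (A1). *)
have a21 n k : a2 n k <= a1 n k.
  rewrite /a2 /a1 ler_wpM2l ?cabs_ge0 // -!powRN ler_powR ?bracket_ge1 //; lra.
pose C' := C + p%:R * C.
have C'0 : 0 <= C' by rewrite addr_ge0 ?mulr_ge0.
have k1 : kernel_l2 s (fun _ _ : unit => a1) C'.
  by apply: kernel_l2_le (kernel_l2_const a10 C_ge0 A1) _; rewrite lerDl mulr_ge0.
have k2 : kernel_l2 s (fun _ _ : unit => a2) C'.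
  by apply: kernel_l2_domin k1 _ => _ _ n k; rewrite a20 a21.
have k3 : kernel_X ev s (fun _ _ : unit => a2) C'.
  by apply: (kernel_X_le hX) (kernel_X_const hX a20 C_ge0 A2) _; rewrite lerDr.
have [c hc] := small_coef_exists p C'0 C0_gt0.
have [cn [cn0 hcn]] := X_ball_point hX hsolid.
(* The bound in X that (A3) gives for the image of [y], available before [y] is known. *)
pose q := C * C0 ^+ p.
have q0 : 0 <= q by rewrite mulr_ge0 // exprn_ge0 // ltW.
exists c, (fun n => cn n * (2 * q)); split; try by case: hc.
  by move=> n; rewrite mulr_ge0 // mulr_ge0.
move=> K y yE; have [y0 _ _] := yE.
have [zX hz] := multi_op_l2X (fun n k => cabs_ge0 (m n k)) C_ge0 A3 yE.
have wt0 : forall a : unit, 0 <= (fun=> 2^-1 : R) a by move=> _; rewrite invr_ge0.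
have wt1 : forall L : nat, \sum_(a <- (fun=> [:: tt]) L) (fun=> 2^-1 : R) a <= 2^-1.
  by move=> L; rewrite big_seq1.
have [P [P1 P2 P3 P4]] := l2_majorants wt0 wt1 C'0 C0_gt0 hc K k1 yE.
have [F [F1 F2 F3 F4]] := X_majorants hX wt0 wt1 C'0 C0_gt0 hc K k2 k3 yE zX q0.
have dom (e : R) n k : 0 <= cabs (m n k) * (2^-1 * (1 + `|phi n k|) `^ (- e)) /\
    (0 <= e -> cabs (m n k) * (2^-1 * (1 + `|phi n k|) `^ (- e)) <=
      2^-1 * (cabs (m n k) / bracket (phi n k) `^ e)).
  split; first by rewrite !mulr_ge0 ?cabs_ge0 ?powR_ge0 ?invr_ge0.
  move=> e0; rewrite mulrCA ler_wpM2l ?invr_ge0 // ler_wpM2l ?cabs_ge0 //.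
  have b0 : 0 < bracket (phi n k) := lt_le_trans ltr01 (bracket_ge1 _).
  rewrite powRN lef_pV2 ?posrE ?powR_gt0 ?ltr_wpDr //.
  by rewrite ge0_ler_powR ?nnegrE ?(ltW b0) ?addr_ge0 ?bracket_le.
exists (fun L i _ sg => P L i tt sg), (fun L i _ sg => F L i tt sg); split=> //.
- move=> L i al sg D iK hD _; apply: P3 => // v _; split=> //.
  have [h1 h2] := dom 2^-1 v.1.1 v.1.2; rewrite h1 /=; apply: h2.
  by rewrite invr_ge0.
- move=> L al sg D hD; apply: le_trans (F2 L tt sg).
  by apply: sum_moves_le_ldiff.
- move=> L i al sg D iK hD _; apply: F3 => // v _; split=> //.
  have [h1 h2] := dom (1 - delta) v.1.1 v.1.2; rewrite h1 /=; exact: h2.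
- by move=> L n; have := hcn _ _ n (F4 L tt); rewrite !mulrA.
Qed.

Lemma l2_ball_shift (s' r : R) (y : Zd d -> R) : l2_ball s r y ->
  l2_ball s' r (fun n => bracketZ R n `^ (s - s') * y n).
Proof.
move=> [y0 r0 hy]; split=> // [n|F uF]; first by rewrite mulr_ge0 ?powR_ge0.
rewrite (eq_bigr (fun n => (bracketZ R n `^ s * y n) ^+ 2)); first exact: hy.
move=> n _; rewrite mulrA -powRD; first by rewrite subrKC.
by rewrite (gt_eqF (bracketZ_gt0 R n)) implybT.
Qed.

Lemma l2_ball_gmean (th s1 s2 r : R) (y1 y2 : Zd d -> R) : 0 < th < 1 -> th * s1 + (1 - th) * s2 = s ->
  l2_ball s1 r y1 -> l2_ball s2 r y2 -> l2_ball s r (fun n => gmean th (y1 n) (y2 n)).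
Proof.
move=> /andP[th0 th1] hs [y10 r0 hy1] [y20 _ hy2]; split=> // [n|F uF].
  exact: gmean_ge0.
apply: le_trans (_ : gmean th (r ^+ 2) (r ^+ 2) <= _); last first.
  by rewrite gmeanxx ?sqr_ge0.
apply: le_trans (le_gmean th0 th1 _ _ (hy1 F uF) (hy2 F uF)); last first.
- by apply: sumr_ge0 => n _; apply: sqr_ge0.
- by apply: sumr_ge0 => n _; apply: sqr_ge0.
apply: le_trans (sum_gmean th0 th1 F _ _) => [|n|n]; try exact: sqr_ge0.
apply: ler_eq; apply: eq_bigr => n _.
have b0 := bracketZ_gt0 R n.
have -> : bracketZ R n `^ s = gmean th (bracketZ R n `^ s1) (bracketZ R n `^ s2).
  rewrite /gmean -!powRrM (mulrC s1) (mulrC s2) -powRD.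
    by rewrite hs.
  by rewrite (gt_eqF b0) implybT.
by rewrite -gmeanM ?powR_ge0 // !expr2 [RHS]gmeanM ?mulr_ge0 ?powR_ge0.
Qed.

Lemma floor_box (x : R) (L : nat) : `|x| <= L%:R -> Num.floor x \in int_box L.+1.
Proof.
rewrite ler_norml => /andP[h1 h2]; apply: mem_int_box.
have f1 := floor_le x; have := floorD1_gt x; rewrite intrD1 => f2.
have g1 : Num.floor x <= L%:Z.
  by rewrite -(ler_int R); apply: le_trans f1 _.
have g2 : - (L.+1)%:Z <= Num.floor x.
  rewrite -(ler_int R) rmorphN /= -pmulrn -natr1; lra.
lia.
Qed.

Lemma floor_abs (x : R) : 2 + `|Num.floor x|%N%:R <= 3 + `|x|.
Proof.
have f1 := floor_le x; have := floorD1_gt x; rewrite intrD1 => f2.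
have -> : `|Num.floor x|%N%:R = `|(Num.floor x)%:~R : R|.
  by rewrite -intr_norm natr_absz.
have [h|h] := leP 0 (Num.floor x).
  rewrite ger0_norm ?ler0z //; have := ler_norm x; lra.
rewrite ltr0_norm ?ltrz0 //; have := ler_norm (- x); rewrite normrN; lra.
Qed.

(** The potential in l2_{s1} carries the labels and all the decay in the phase, the one in l2_{s2}
    has a single label. Their geometric mean obeys the same rules because Hölder's inequality
    applies to the sum over the moves. *)
Lemma majorants_B (s1 s2 C : R) : s1 < s < s2 -> 0 < C ->
  let absm := fun n k => cabs (m n k) in
  (forall mu : int, multilinear_bound (window phi mu) absm C
     (fun=> l2 d s1) (l2 d s1)) ->
  multilinear_bound (@decomp d p) absm C (fun=> l2 d s2) (l2 d s2) ->
  (forall (mu : int) (j : 'I_p), multilinear_bound (window phi mu) absm C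
     (one_in j (embedded ev) (l2 d s1)) (embedded ev)) ->
  (forall j : 'I_p, multilinear_bound (@decomp d p) absm C
     (one_in j (embedded ev) (l2 d s2)) (embedded ev)) ->
  multilinear_bound (@decomp d p) absm C (fun=> l2 d s) (embedded ev) ->
  exists w0 th, [/\ 0 < w0, 0 < th, th < 1 &
    let om := fun al f => w0 * (3 + `|al + f|) `^ (- th) in
    has_majorants s om om].
Proof.
move=> /andP[ss1 ss2] C_gt0 absm B1 B1' B2 B2' B3; have C_ge0 := ltW C_gt0.
have am0 n k : 0 <= absm n k by apply: cabs_ge0.
have s12 : 0 < s2 - s1 by lra.
pose th := (s2 - s) / (s2 - s1).
have th0 : 0 < th by rewrite divr_gt0 // subr_gt0.
have th1 : th < 1 by rewrite ltr_pdivrMr // mul1r; lra.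
have ths : th * s1 + (1 - th) * s2 = s by rewrite /th; field; rewrite gt_eqF.
(* Summable weights on the labels need an exponent [1 + e] above 1, while the interpolated exponent
   [(1 + e) * th = (1 + th) / 2] must stay below 1 for the division by a large phase to win. *)
pose e := (th^-1 - 1) / 2.
have e0 : 0 < e by rewrite divr_gt0 // subr_gt0 invf_gt1.
have the : (1 + e) * th = (1 + th) / 2 by rewrite /e; field; rewrite gt_eqF.
pose w0 := gmean th (e / 4) 2^-1.
have w00 : 0 < w0.
  by apply: mulr_gt0; apply: powR_gt0 => //; apply: divr_gt0.
exists w0, ((1 + th) / 2); split=> //; [lra|lra|].
move=> om C0 C0_gt0.
(* The 3 in place of the 2 of [int_wt_lower] covers the passage from integer parts to phases, see
   [floor_abs]. *)
pose om1 (be : R) := e / 4 * (3 + `|be|) `^ (- (1 + e)).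
have om1_ge0 be : 0 <= om1 be by rewrite mulr_ge0 ?powR_ge0 // divr_ge0 // ltW.
have half0 : 0 <= 2^-1 :> R by rewrite invr_ge0.
have omE al f : om al f = gmean th (om1 (al + f)) 2^-1.
  have e4 : 0 <= e / 4 by rewrite divr_ge0 // ltW.
  rewrite /om /om1 /w0 /gmean (powRM _ e4) ?powR_ge0 //.
  rewrite -powRrM mulNr the; ring.
pose C' := 2 * C + 2 * (p%:R * C).
have C'0 : 0 <= C' by rewrite addr_ge0 ?mulr_ge0.
have pC0 : 0 <= p%:R * C by rewrite mulr_ge0.
have k1 : kernel_l2 s1 (win_ker phi m) C'.
  by apply: kernel_l2_le (kernel_l2_win C_ge0 B1) _; rewrite /C'; lra.
have k1X : kernel_X ev s1 (win_ker phi m) C'.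
  by apply: (kernel_X_le hX) (kernel_X_win hX C_ge0 B2) _; rewrite /C'; lra.
have k2 : kernel_l2 s2 (fun _ _ : unit => absm) C'.
  by apply: kernel_l2_le (kernel_l2_const am0 C_ge0 B1') _; rewrite /C'; lra.
have k2X : kernel_X ev s2 (fun _ _ : unit => absm) C'.
  by apply: (kernel_X_le hX) (kernel_X_const hX am0 C_ge0 B2') _; rewrite /C'; lra.
have [c hc] := small_coef_exists p C'0 C0_gt0.
have [cn [cn0 hcn]] := X_ball_point hX hsolid.
pose q := C * C0 ^+ p.
have q0 : 0 <= q by rewrite mulr_ge0 // exprn_ge0 // ltW.
exists c, (fun n => cn n * (2 * q)); split; try by case: hc.
  by move=> n; rewrite mulr_ge0 // mulr_ge0.
have ci0 i : 0 <= (level_coef c i)^-1 by rewrite invr_ge0 ltW // (level_coef_gt0 hc).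
move=> K y yE; have [y0 _ _] := yE.
have [zX hz] := multi_op_l2X am0 C_ge0 B3 yE.
set z := multi_op _ _ _ in zX hz.
have z0 n : 0 <= z n by case: zX.
(* [y1] and [y2] have in l2_{s1} and l2_{s2} the norm of [y] in l2_s, and [y] is their geometric
   mean. X is the same at both ends, so [z] is interpolated with itself. *)
pose y1 n := bracketZ R n `^ (s - s1) * y n.
pose y2 n := bracketZ R n `^ (s - s2) * y n.
have y1E : l2_ball s1 C0 y1 by apply: l2_ball_shift.
have y2E : l2_ball s2 C0 y2 by apply: l2_ball_shift.
have [y10 _ _] := y1E; have [y20 _ _] := y2E.
have yy : y = fun n => gmean th (y1 n) (y2 n).
  apply/funext => n; rewrite /y1 /y2 gmeanM ?powR_ge0 // gmeanxx //.
  rewrite /gmean -!powRrM -powRD.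
    have -> : (s - s1) * th + (s - s2) * (1 - th) = 0 by rewrite -ths; ring.
    by rewrite powRr0 mul1r.
  by rewrite (gt_eqF (bracketZ_gt0 R n)) implybT.
have zz : z = fun n => gmean th (z n) (z n).
  by apply/funext => n; rewrite gmeanxx.
have wt0 : forall a : unit, 0 <= (fun=> 2^-1 : R) a by move=> _.
have wt1 : forall L : nat, \sum_(a <- (fun=> [:: tt]) L) (fun=> 2^-1 : R) a <= 2^-1.
  by move=> L; rewrite big_seq1.
have iwt0 := int_wt_ge0 e0.
have iwt1 L := sum_int_wt e L.+1.
have [P [P1 P2 P3 P4]] := l2_majorants iwt0 iwt1 C'0 C0_gt0 hc K k1 y1E.
have [P' [P1' P2' P3' P4']] := l2_majorants wt0 wt1 C'0 C0_gt0 hc K k2 y2E.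
have [F [F1 F2 F3 F4]] := X_majorants hX iwt0 iwt1 C'0 C0_gt0 hc K k1 k1X y1E zX q0.
have [F' [F1' F2' F3' F4']] := X_majorants hX wt0 wt1 C'0 C0_gt0 hc K k2 k2X y2E zX q0.
have P0 L i a sg : 0 <= P L i a sg by apply: le_trans (P1 _ _ _ _); apply: lprod_ge0.
have P0' L i a sg : 0 <= P' L i a sg by apply: le_trans (P1' _ _ _ _); apply: lprod_ge0.
have interp K1 (G : nat -> nat -> int -> seq (Zd d) -> R)
      (G' : nat -> nat -> unit -> seq (Zd d) -> R) :
    (forall L i a sg, 0 <= G L i a sg) ->
    (forall L i a sg, 0 <= G' L i a sg) ->
    move_bound (int_wt e) (fun L => int_box L.+1) (win_ker phi m) c K1 G ->
    move_bound (fun=> 2^-1) (fun=> [:: tt]) (fun _ _ => absm) c K1 G' ->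
    phase_bound (level_coef c) om K1
      (fun L i al sg => gmean th (G L i (Num.floor al) sg) (G' L i tt sg)).
  move=> G0 G0' hG hG' L i al sg D iK hD hL.
  pose g1 (v : Zd d * tuples d p * seq (Zd d)) :=
    absm v.1.1 v.1.2 * om1 (al + phi v.1.1 v.1.2).
  pose g2 (v : Zd d * tuples d p * seq (Zd d)) := absm v.1.1 v.1.2 * 2^-1.
  have g10 v : 0 <= g1 v by rewrite mulr_ge0.
  have g20 v : 0 <= g2 v by rewrite mulr_ge0.
  have h1 := hG L i (Num.floor al) sg D g1
    (fun v => Num.floor (al + phi v.1.1 v.1.2)) iK hD _.
  have h2 := hG' L i tt sg D g2 (fun=> tt) iK hD _.
  apply: le_trans (_ : \sum_(v <- moves D sg)
      gmean th (g1 v * G L i.+1 (Num.floor (al + phi v.1.1 v.1.2)) v.2)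
               (g2 v * G' L i.+1 tt v.2) <= _).
    apply: ler_sum => v _; rewrite omE gmeanM // /g1 /g2 gmeanM //.
    by rewrite gmeanxx.
  apply: le_trans (sum_gmean th0 th1 _ _ _) _ => [v|v|]; try exact: mulr_ge0.
  rewrite -[X in _ <= X * _](gmeanxx th) // -gmeanM //.
  apply: le_gmean => //; try by apply: sumr_ge0 => v _; apply: mulr_ge0.
    apply: h1 => v vs; split; first exact/floor_box/hL.
    rewrite g10 /= /g1 mulrC.
    apply: ler_pM => //; last exact: win_ker_floor.
    apply: le_trans (int_wt_lower e0 _).
    rewrite /om1 ler_wpM2l //; first by rewrite divr_ge0 // ltW.
    rewrite !powRN lef_pV2 ?posrE ?powR_gt0 ?ltr_wpDr ?normr_ge0 ?ler0n //.
    by apply: ge0_ler_powR; rewrite ?nnegrE ?addr_ge0 ?floor_abs ?(ltW e0).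
  by apply: h2 => v _; split=> //; rewrite g20 /g2 mulrC lexx.
exists (fun L i al sg => gmean th (P L i (Num.floor al) sg) (P' L i tt sg)),
  (fun L i al sg => gmean th (F L i (Num.floor al) sg) (F' L i tt sg)); split.
- move=> L i al sg; rewrite yy lprod_gmean //; apply: le_gmean => //; exact: lprod_ge0.
- move=> L i al sg; rewrite yy lprod_gmean //.
  rewrite -[X in X * _ <= _](gmeanxx th) // -gmeanM ?lprod_ge0 //.
  rewrite -[X in _ <= X * _](gmeanxx th) // -gmeanM //.
  by apply: le_gmean; rewrite ?mulr_ge0 ?lprod_ge0.
- exact: interp.
- by move=> *; apply: gmean_ge0.
- move=> L al sg D hD; apply: le_trans (_ : ldiff y z sg <= _).
    exact: sum_moves_le_ldiff.
  rewrite {1}yy {1}zz; apply: le_trans (ldiff_gmean th0 th1 _ _ _ _ _) _ => //.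
  by apply: le_gmean; rewrite ?ldiff_ge0.
- exact: interp.
- move=> L; apply: l2_ball_gmean ths _ _ => //; first by rewrite th0.
- move=> L n.
  have Q0 : 0 <= cn n * (2 * q) * 2 ^+ K.
    by apply: mulr_ge0; [apply: mulr_ge0 => //; apply: mulr_ge0|apply: exprn_ge0].
  rewrite -[leRHS](gmeanxx th) //.
  apply: le_gmean => //.
    by have := hcn _ _ n (F4 L (Num.floor 0)); rewrite !mulrA.
  by have := hcn _ _ n (F4' L tt); rewrite !mulrA.
Qed.

End Majorants.

(** * Normal form reduction *)

Section RealDerivatives.
Variable R : realType.
Implicit Types (f g : R -> R) (x : R).

Lemma derivable_of f x l : is_derive x 1 f l -> derivable f x 1.
Proof. by case. Qed.

Lemma derive1_of f x l : is_derive x 1 f l -> derive1 f x = l.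
Proof. by move=> h; rewrite derive1E derive_val. Qed.

Lemma is_derive_continuous f x l : is_derive x 1 f l -> {for x, continuous f}.
Proof. by move=> /derivable_of h; apply/differentiable_continuous/derivable1_diffP. Qed.

Lemma derivable_continuous f : (forall x, derivable f x 1) -> continuous f.
Proof. by move=> h x; apply/differentiable_continuous/derivable1_diffP. Qed.

Lemma is_derive_mul f g x a b : is_derive x 1 f a -> is_derive x 1 g b ->
  is_derive x 1 (fun r => f r * g r) (a * g x + f x * b).
Proof.
move=> hf hg; have := @is_deriveM _ _ f g x 1 a b hf hg.
by rewrite /GRing.scale /= addrC (mulrC a).
Qed.

Lemma is_derive_add f g x a b : is_derive x 1 f a -> is_derive x 1 g b ->
  is_derive x 1 (fun r => f r + g r) (a + b).
Proof. by move=> hf hg; exact: is_deriveD. Qed.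

Lemma is_derive_sub f g x a b : is_derive x 1 f a -> is_derive x 1 g b ->
  is_derive x 1 (fun r => f r - g r) (a - b).
Proof. by move=> hf hg; exact: is_deriveB. Qed.

Lemma is_derive_inv f x a : f x != 0 -> is_derive x 1 f a ->
  is_derive x 1 (fun r => (f r)^-1) (- a / f x ^+ 2).
Proof.
move=> fx hf; have := @is_deriveV R f x a 1 fx hf.
move/is_derive_eq; apply; rewrite /GRing.scale /= mulNr mulrC mulNr //.
Qed.

Lemma is_derive_affine (a b : R) x : is_derive x 1 (fun r => a * r + b) a.
Proof.
have h : is_derive x 1 (fun r : R => a * r) a.
  rewrite (_ : (fun r => _) = a *: (id : R -> R)) //.
  by apply: is_derive_eq; rewrite /GRing.scale /= mulr1.
by have := is_derive_add h (is_derive_cst b x 1); rewrite addr0.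
Qed.

End RealDerivatives.

Section ComplexCurves.
Variable R : realType.
Implicit Types (f g : R -> R[i]) (t : R).

Definition cderiv f t (l : R[i]) :=
  is_derive t 1 (fun r => complex.Re (f r)) (complex.Re l) /\
  is_derive t 1 (fun r => complex.Im (f r)) (complex.Im l).

Definition ccont f := continuous (fun r => complex.Re (f r)) /\
  continuous (fun r => complex.Im (f r)).

Lemma ReM (x y : R[i]) : complex.Re (x * y) =
  complex.Re x * complex.Re y - complex.Im x * complex.Im y.
Proof. by case: x; case: y. Qed.

Lemma ImM (x y : R[i]) : complex.Im (x * y) =
  complex.Re x * complex.Im y + complex.Im x * complex.Re y.
Proof. by case: x; case: y. Qed.

Lemma complex_ext (x y : R[i]) : complex.Re x = complex.Re y ->
  complex.Im x = complex.Im y -> x = y.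
Proof. by case: x; case: y => a b c e /= -> ->. Qed.

Lemma cderiv_cst (c : R[i]) t : cderiv (fun=> c) t 0.
Proof. by split; apply: is_derive_cst. Qed.

Lemma cderivD f g t a b : cderiv f t a -> cderiv g t b ->
  cderiv (fun r => f r + g r) t (a + b).
Proof.
move=> [f1 f2] [g1 g2]; split.
  by under eq_fun => r do rewrite ReD; rewrite ReD; apply: is_derive_add.
by under eq_fun => r do rewrite ImD; rewrite ImD; apply: is_derive_add.
Qed.

Lemma cderivM f g t a b : cderiv f t a -> cderiv g t b ->
  cderiv (fun r => f r * g r) t (a * g t + f t * b).
Proof.
move=> [f1 f2] [g1 g2]; split.
  under eq_fun => r do rewrite ReM.
  have := is_derive_sub (is_derive_mul f1 g1) (is_derive_mul f2 g2).
  by move/is_derive_eq; apply; rewrite ReD !ReM; ring.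
under eq_fun => r do rewrite ImM.
have := is_derive_add (is_derive_mul f1 g2) (is_derive_mul f2 g1).
by move/is_derive_eq; apply; rewrite ImD !ImM; ring.
Qed.

Lemma cderivZ (c : R[i]) f t a : cderiv f t a -> cderiv (fun r => c * f r) t (c * a).
Proof.
by move=> fa; have := cderivM (cderiv_cst c t) fa; rewrite mul0r add0r.
Qed.

Lemma cderivB f g t a b : cderiv f t a -> cderiv g t b ->
  cderiv (fun r => f r - g r) t (a - b).
Proof.
move=> fa gb; have := cderivD fa (cderivZ (-1) gb); rewrite mulN1r.
by rewrite (_ : (fun r => _) = fun r => f r - g r) //; apply/funext => r; rewrite mulN1r.
Qed.

Lemma cderiv_sum (J : Type) (s : seq J) (P : pred J) (f : J -> R -> R[i]) a t :
  (forall j, cderiv (f j) t (a j)) ->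
  cderiv (fun r => \sum_(j <- s | P j) f j r) t (\sum_(j <- s | P j) a j).
Proof.
move=> h; elim: s => [|j s IH].
  rewrite big_nil (_ : (fun r => _) = fun=> 0); first exact: cderiv_cst.
  by apply/funext => r; rewrite big_nil.
rewrite big_cons; case: ifP => Pj.
  rewrite (_ : (fun r => _) = fun r => f j r + \sum_(i <- s | P i) f i r).
    exact: cderivD.
  by apply/funext => r; rewrite big_cons Pj.
rewrite (_ : (fun r => _) = fun r => \sum_(i <- s | P i) f i r) //.
by apply/funext => r; rewrite big_cons Pj.
Qed.

Lemma cderiv_expi (al t : R) :
  cderiv (fun r => expi (r * al)) t ((0 +i* al) * expi (t * al)).
Proof.
have lin : is_derive t 1 (fun r => r * al) al.
  by have := is_derive_affine al 0 t; under eq_fun => r do rewrite addr0 mulrC.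
split.
  have := @is_derive1_comp R _ _ t _ _ (is_derive_cos (t * al)) lin.
  by move/is_derive_eq; apply; rewrite /= mul0r sub0r mulNr mulrC.
have := @is_derive1_comp R _ _ t _ _ (is_derive_sin (t * al)) lin.
by move/is_derive_eq; apply; rewrite /= mul0r add0r mulrC.
Qed.

Lemma ccontD f g : ccont f -> ccont g -> ccont (fun r => f r + g r).
Proof.
move=> [f1 f2] [g1 g2]; split=> t.
  under eq_fun => r do rewrite ReD.
  by apply: continuousD; [apply: f1|apply: g1].
under eq_fun => r do rewrite ImD.
by apply: continuousD; [apply: f2|apply: g2].
Qed.

Lemma ccontM f g : ccont f -> ccont g -> ccont (fun r => f r * g r).
Proof.
move=> [f1 f2] [g1 g2]; split=> t.
  under eq_fun => r do rewrite ReM.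
  exact: continuousB (continuousM (f1 t) (g1 t)) (continuousM (f2 t) (g2 t)).
under eq_fun => r do rewrite ImM.
exact: continuousD (continuousM (f1 t) (g2 t)) (continuousM (f2 t) (g1 t)).
Qed.

Lemma ccont_cst (c : R[i]) : ccont (fun=> c).
Proof. by split => t; apply: cst_continuous. Qed.

Lemma ccontB f g : ccont f -> ccont g -> ccont (fun r => f r - g r).
Proof.
move=> hf hg; have := ccontD hf (ccontM (ccont_cst (-1)) hg).
by rewrite (_ : (fun r => _) = fun r => f r - g r) //; apply/funext => r; rewrite mulN1r.
Qed.

Lemma ccont_sum (J : Type) (s : seq J) (P : pred J) (f : J -> R -> R[i]) :
  (forall j, ccont (f j)) -> ccont (fun r => \sum_(j <- s | P j) f j r).
Proof.
move=> h; elim: s => [|j s IH].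
  rewrite (_ : (fun r => _) = fun=> 0); first exact: ccont_cst.
  by apply/funext => r; rewrite big_nil.
have [Pj|Pj] := boolP (P j).
  rewrite (_ : (fun r => _) = fun r => f j r + \sum_(i <- s | P i) f i r).
    exact: ccontD.
  by apply/funext => r; rewrite big_cons Pj.
rewrite (_ : (fun r => _) = fun r => \sum_(i <- s | P i) f i r) //.
by apply/funext => r; rewrite big_cons (negPf Pj).
Qed.

Lemma ccont_lprod (I : eqType) (u : R -> I -> R[i]) (sg : seq I) :
  (forall n, ccont (fun t => u t n)) -> ccont (fun t => lprod (u t) sg).
Proof.
move=> hu; elim: sg => [|n sg IH].
  under eq_fun => t do rewrite lprod_nil; exact: ccont_cst.
under eq_fun => t do rewrite lprod_cons; exact: ccontM.
Qed.

Lemma ccont_expi (al : R) : ccont (fun r => expi (r * al)).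
Proof.
by have d t := cderiv_expi al t; split=> t; case: (d t) => *; apply: is_derive_continuous.
Qed.

Lemma expiD (x y : R) : expi (x + y) = expi x * expi y.
Proof.
apply: complex_ext; first by rewrite ReM /= cosD.
by rewrite ImM /= sinD addrC.
Qed.

Lemma expi0 : expi (0 : R) = 1.
Proof. by rewrite /expi cos0 sin0. Qed.

End ComplexCurves.

(** * Integration by parts along chains of moves *)

Section NormalForm.
Variables (R : realType) (d p : nat).
Variables (phi : Zd d -> tuples d p -> R) (m : Zd d -> tuples d p -> R[i]).
Local Notation move := (Zd d * tuples d p * seq (Zd d))%type.
Variables (c : nat -> R) (om omX : R -> R -> R) (s : R).

(* A move of phase f from a state of phase al is nonresonant at level i when
   NR i al f holds; it is then integrated by parts. *)
Definition thresholds (b : R) (e : nat -> R -> R) (NR : nat -> R -> R -> bool) :=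
  [/\ forall i al f, NR i al f -> al + f != 0 /\
        (1 + b) / `|al + f| <= c i * b * om al f /\
        4 / `|al + f| <= c i * omX al f,
      forall i al f, NR i al f ->
        e i.+1 (al + f) / `|al + f| <= 2^-1 * (c i * e i al * om al f),
      forall i al f, ~~ NR i al f -> 1 <= 2^-1 * (c i * e i al * om al f),
      forall i al, (c i)^-1 <= 2^-1 * e i al &
      (forall al f, 0 <= om al f) /\ (forall al f, 0 <= omX al f)].

Variables (b : R) (e : nat -> R -> R) (NR : nat -> R -> R -> bool).
Hypotheses (b0 : 0 <= b) (c0 : forall i, 0 < c i) (hthr : thresholds b e NR).

Variables (T : R) (V dV : seq (Zd d) -> R -> R[i]) (g : R -> R) (Y : R -> Zd d -> R).
Hypotheses (Y0 : forall t n, 0 <= Y t n) (g0 : forall t, 0 <= g t).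
Hypotheses (V_cont : forall sg, ccont (V sg)) (V_0 : forall sg, V sg 0 = 0).
Hypothesis dV_deriv : forall sg t, 0 < t < T -> cderiv (V sg) t (dV sg t).
Hypothesis V_le : forall sg t, 0 <= t <= T -> cabs (V sg t) <= g t * lprod (Y t) sg.
Hypothesis dV_expand : forall sg eta, 0 < eta ->
  exists D, (forall n, finite_decomp n (D n)) /\ forall t, 0 < t < T ->
    cabs (dV sg t - \sum_(v <- moves D sg)
            expi (t * phi v.1.1 v.1.2) * m v.1.1 v.1.2 * V v.2 t) <=
    g t * ((size sg)%:R * lprod (Y t) sg) + eta.

Variables (K : nat) (C1 : R) (Cn : Zd d -> R).
Variables (P F : R -> nat -> nat -> R -> seq (Zd d) -> R).
Hypothesis maj : forall t, 0 <= t <= T ->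
  majorants phi m s c om omX K C1 Cn (Y t) (P t) (F t).

(** Equal to 1 after the last step and to [4 ^- K] at level 0: each integration by parts gains a
    factor 4 on the remainder, more than the growth 2 of its norm. *)
Let rem_coef i : R := 4 ^+ i / 4 ^+ K.

Let max_seq (J : eqType) (r : seq J) (f : J -> nat) j :
  j \in r -> (f j <= \max_(i <- r) f i)%N.
Proof.
elim: r => // i r IH; rewrite inE big_cons => /orP[/eqP ->|/IH h].
  exact: leq_maxl.
exact: leq_trans h (leq_maxr _ _).
Qed.

(** Downward induction on the level. A nonresonant term [expi (t * be) * V] is the derivative of its
    quotient by the imaginary number of part [be], up to a term in [dV] to which the next level
    applies. All bounds are pointwise in [t], so [P] and [F] may vary with time arbitrarily. They
    hold for every large [L], so that finitely many successors can share one. *)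
Lemma normal_form i : (i <= K)%N -> forall sg al eta, 0 < eta ->
  exists (B dB : R -> R[i]) (L0 : nat), [/\ ccont B, B 0 = 0,
    forall t, 0 < t < T -> cderiv B t (dB t) &
    forall L, (L0 <= L)%N ->
      (forall t, 0 <= t <= T -> cabs (B t) <= g t * (b * P t L i al sg)) /\
      (forall t, 0 < t < T -> cabs (expi (t * al) * dV sg t - dB t) <=
        g t * (e i al * P t L i al sg + rem_coef i * F t L i al sg) + eta)].
Proof.
(* [thr1] closes the bound on boundary terms, to which a nonresonant move contributes [V] and the
   next boundary term, hence [1 + b]; it also gains the factor 4 on the remainder. [thr2] and [thr3]
   give half of [e i al] to the nonresonant and resonant moves together, [thr4] gives the other half
   to the size term. *)
case: hthr => thr1 thr2 thr3 thr4 [om0 omX0].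
have oo t : 0 < t < T -> 0 <= t <= T by move=> /andP[h1 h2]; rewrite !ltW.
have P0 t L i' al sg : 0 <= t <= T -> 0 <= P t L i' al sg.
  by move=> /maj h; apply: le_trans (maj_lprod h L i' al sg); apply: lprod_ge0.
have e0 i' al : 0 <= e i' al.
  have := thr4 i' al; have : 0 < (c i')^-1 by rewrite invr_gt0.
  lra.
have rem0 i' : 0 <= rem_coef i' by rewrite divr_ge0 ?exprn_ge0.
have cabs_move t (v : move) (x : R[i]) :
    cabs (expi t * m v.1.1 v.1.2 * x) = cabs (m v.1.1 v.1.2) * cabs x.
  by rewrite !cabsM cabs_expi mul1r.
move=> iK; move: (K - i)%N (subnKC iK) => j {iK}.
elim: j i => [|j IH] i iK sg al eta eta0.
  rewrite addn0 in iK; rewrite iK.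
  have [D [hD hdV]] := dV_expand sg eta0.
  exists (fun=> 0), (fun=> 0), 0%N; split=> //.
  - exact: ccont_cst.
  - by move=> t _; apply: cderiv_cst.
  move=> L _; split=> t ht.
    by rewrite cabs0 mulr_ge0 // mulr_ge0 // P0.
  have ht' := oo t ht; have M := maj ht'.
  rewrite subr0 cabsM cabs_expi mul1r.
  have -> : rem_coef K = 1 by rewrite /rem_coef divff // expf_neq0.
  rewrite mul1r; move: (hdV t ht); set S := \sum_(v <- _) _ => hdVt.
  have hS : cabs S <= g t * F t L K al sg.
    rewrite /S; apply: le_trans (cabs_sum _ _ _) _.
    apply: le_trans (ler_wpM2l (g0 t) (maj_last M L al sg hD)).
    rewrite mulr_sumr; apply: ler_sum => v _.
    rewrite cabs_move mulrCA ler_wpM2l ?cabs_ge0 //; exact: V_le.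
  have hP := P0 t L K al sg ht'.
  have h1 : (size sg)%:R * lprod (Y t) sg <= e K al * P t L K al sg.
    apply: le_trans (maj_size M L K al sg) _; apply: ler_wpM2r => //.
    by apply: le_trans (thr4 K al) _; have := e0 K al; lra.
  have := ler_wpM2l (g0 t) h1.
  have := cabsD (dV sg t - S) S; rewrite subrK; lra.
have eta2 : 0 < eta / 2 by rewrite divr_gt0.
have [D [hD hdV]] := dV_expand sg eta2.
pose mv := moves D sg.
pose be (v : move) := al + phi v.1.1 v.1.2.
pose nr (v : move) := NR i al (phi v.1.1 v.1.2).
pose am (v : move) := cabs (m v.1.1 v.1.2).
pose omv (v : move) := om al (phi v.1.1 v.1.2).
pose Sm := \sum_(v <- mv) am v / `|be v|.
have am0 v : 0 <= am v by apply: cabs_ge0.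
have omv0 v : 0 <= omv v by apply: om0.
have ci0 : 0 <= c i by apply: ltW.
have Sm0 : 0 <= Sm by apply: sumr_ge0 => v _; rewrite divr_ge0.
(* The errors of the successors are recombined with coefficients of sum at most [Sm]. *)
have eta' : 0 < eta / 2 / (1 + Sm) by rewrite divr_gt0 // ltr_wpDr.
rewrite addnS -addSn in iK.
have /choice[Bv hBv] : forall v : move,
    exists x : (R -> R[i]) * (R -> R[i]) * nat,
    [/\ ccont x.1.1, x.1.1 0 = 0,
    forall t, 0 < t < T -> cderiv x.1.1 t (x.1.2 t) &
    forall L, (x.2 <= L)%N ->
      (forall t, 0 <= t <= T -> cabs (x.1.1 t) <= g t * (b * P t L i.+1 (be v) v.2)) /\
      (forall t, 0 < t < T -> cabs (expi (t * be v) * dV v.2 t - x.1.2 t) <=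
        g t * (e i.+1 (be v) * P t L i.+1 (be v) v.2 +
               rem_coef i.+1 * F t L i.+1 (be v) v.2) + eta / 2 / (1 + Sm))].
  move=> v; have [B [dB [L0 h]]] := IH i.+1 iK v.2 (be v) _ eta'.
  by exists (B, dB, L0).
pose kap (v : move) := m v.1.1 v.1.2 / (0 +i* be v).
have kapE v : cabs (kap v) = am v / `|be v|.
  by rewrite /kap cabsM cabsV [cabs (_ +i* _)]cabsE /= expr0n /= add0r sqrtr_sqr.
have kapM v : nr v -> kap v * (0 +i* be v) = m v.1.1 v.1.2.
  move=> /thr1[nz _]; rewrite /kap divfK //.
  by apply: contra nz => /eqP[/eqP].
have iltK : (i < K)%N by rewrite -iK leq_addr.
have lvl v : nr v -> [/\ 1 + b <= c i * b * omv v * `|be v|,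
    e i.+1 (be v) <= 2^-1 * (c i * e i al * omv v) * `|be v|,
    4 <= c i * omX al (phi v.1.1 v.1.2) * `|be v| & 0 < `|be v|].
  move=> nv; have [nz [h1 h2]] := thr1 _ _ _ nv; have h3 := thr2 _ _ _ nv.
  have bp : 0 < `|be v| by rewrite normr_gt0.
  by split=> //; rewrite -ler_pdivrMr.
exists (fun t => \sum_(v <- mv | nr v) kap v * (expi (t * be v) * V v.2 t - (Bv v).1.1 t)).
exists (fun t => \sum_(v <- mv | nr v) kap v *
  ((0 +i* be v) * expi (t * be v) * V v.2 t + expi (t * be v) * dV v.2 t - (Bv v).1.2 t)).
(* Large enough for all successors, and above the phases of all the moves. *)
exists (\max_(v <- mv) maxn (Bv v).2 (Num.trunc `|be v|).+1)%N; split.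
- apply: ccont_sum => v; apply: ccontM; first exact: ccont_cst.
  apply: ccontB; last by case: (hBv v).
  apply: ccontM => //; exact: ccont_expi.
- rewrite big1 // => v _; have [_ -> _ _] := hBv v.
  by rewrite V_0 mulr0 subr0 mulr0.
- move=> t ht; apply: cderiv_sum => v; apply: cderivZ; apply: cderivB.
    apply: cderivM; [exact: cderiv_expi|exact: dV_deriv].
  by have [_ _ h _] := hBv v; apply: h.
move=> L hL.
have hLv v : v \in mv -> ((Bv v).2 <= L)%N /\ `|be v| <= L%:R.
  move=> vm; have := leq_trans (max_seq _ vm) hL; rewrite geq_max => /andP[h1 h2].
  split=> //; apply: le_trans (ltW (truncnS_gt _)) _.
  by rewrite ler_nat.
have hbox v : v \in moves D sg -> `|al + phi v.1.1 v.1.2| <= L%:R.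
  by move=> /hLv[].
split=> t ht.
  have M := maj ht.
  have step := maj_move M iltK hD hbox.
  apply: le_trans (cabs_sum _ _ _) _.
  apply: le_trans (_ : \sum_(v <- mv) g t * (c i * b * (am v * omv v *
      P t L i.+1 (be v) v.2)) <= _); last first.
    rewrite -mulr_sumr ler_wpM2l // -mulr_sumr.
    have := ler_wpM2l (mulr_ge0 (ltW (c0 i)) b0) step.
    by rewrite -!mulrA (mulrCA b) mulVKf ?gt_eqF.
  rewrite big_mkcond big_seq [leRHS]big_seq; apply: ler_sum => v vm.
  have [hv1 _] := hLv v vm.
  have Pv := P0 t L i.+1 (be v) v.2 ht.
  case: ifP => [nv|_]; last first.
    by rewrite !mulr_ge0.
  have [l1 _ _ bp] := lvl v nv.
  rewrite cabsM kapE.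
  have [_ _ _ /(_ L hv1)[hB _]] := hBv v.
  have k1 : cabs (expi (t * be v) * V v.2 t - (Bv v).1.1 t) <=
      g t * ((1 + b) * P t L i.+1 (be v) v.2).
    apply: le_trans (cabsB _ _) _; rewrite cabsM cabs_expi mul1r.
    rewrite mulrDl mul1r mulrDr; apply: lerD; last exact: hB.
    apply: le_trans (V_le _ ht) _; rewrite ler_wpM2l //; exact: maj_lprod M _ _ _ _.
  have amb : 0 <= am v / `|be v| by rewrite divr_ge0.
  apply: le_trans (ler_wpM2l amb k1) _.
  rewrite mulrCA ler_wpM2l //.
  have -> : c i * b * (am v * omv v * P t L i.+1 (be v) v.2) =
    am v * (c i * b * omv v) * P t L i.+1 (be v) v.2 by ring.
  rewrite mulrA; apply: ler_wpM2r => //.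
  by rewrite mulrAC ler_pdivrMr // -(mulrA (am v)); apply: ler_wpM2l.
have ht' := oo t ht; have M := maj ht'.
have step := maj_move M iltK hD hbox.
have stepX := maj_moveX M iltK hD hbox.
move: (hdV t ht); set S := \sum_(v <- _) _ => hdVt.
pose res := \sum_(v <- mv | ~~ nr v) expi (t * be v) * m v.1.1 v.1.2 * V v.2 t.
pose tail := \sum_(v <- mv | nr v) kap v * (expi (t * be v) * dV v.2 t - (Bv v).1.2 t).
have -> : expi (t * al) * dV sg t - (\sum_(v <- mv | nr v) kap v *
    ((0 +i* be v) * expi (t * be v) * V v.2 t + expi (t * be v) * dV v.2 t -
     (Bv v).1.2 t)) = expi (t * al) * (dV sg t - S) + (res - tail).
  have -> : expi (t * al) * (dV sg t - S) + (res - tail) =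
      expi (t * al) * dV sg t - (expi (t * al) * S - res + tail) by ring.
  congr (_ - _); rewrite /S /res mulr_sumr.
  have -> : \sum_(v <- moves D sg) expi (t * al) *
      (expi (t * phi v.1.1 v.1.2) * m v.1.1 v.1.2 * V v.2 t) =
      \sum_(v <- mv) expi (t * be v) * m v.1.1 v.1.2 * V v.2 t.
    by apply: eq_bigr => v _; rewrite /be mulrDr expiD; ring.
  rewrite [X in _ = X - _ + _](bigID nr) /= addrK -big_split; apply: eq_bigr => v nv /=.
  rewrite -(kapM v nv); ring.
have res_le : cabs res <= g t * \sum_(v <- mv | ~~ nr v) am v * P t L i.+1 (be v) v.2.
  apply: le_trans (cabs_sum _ _ _) _; rewrite mulr_sumr; apply: ler_sum => v _.
  rewrite cabs_move -/(am v) mulrCA; apply: ler_wpM2l => //.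
  apply: le_trans (V_le _ ht') _.
  by rewrite ler_wpM2l //; exact: maj_lprod M _ _ _ _.
have tail_le : cabs tail <= g t * (\sum_(v <- mv | nr v)
      am v / `|be v| * (e i.+1 (be v) * P t L i.+1 (be v) v.2) +
    \sum_(v <- mv | nr v) am v / `|be v| * (rem_coef i.+1 * F t L i.+1 (be v) v.2)) +
    eta / 2.
  apply: le_trans (cabs_sum _ _ _) _.
  apply: le_trans (_ : \sum_(v <- mv | nr v) (g t * (am v / `|be v| *
      (e i.+1 (be v) * P t L i.+1 (be v) v.2) +
      am v / `|be v| * (rem_coef i.+1 * F t L i.+1 (be v) v.2)) +
      am v / `|be v| * (eta / 2 / (1 + Sm))) <= _).
    rewrite big_seq_cond [leRHS]big_seq_cond; apply: ler_sum => v /andP[vm nv].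
    have [hv1 _] := hLv v vm.
    have [_ _ _ /(_ L hv1)[_ hB]] := hBv v.
    rewrite cabsM kapE; have amb : 0 <= am v / `|be v| by rewrite divr_ge0.
    apply: le_trans (ler_wpM2l amb (hB t ht)) _.
    by apply: ler_eq; ring.
  rewrite big_split /= -mulr_sumr -big_split /= lerD2l -mulr_suml.
  apply: le_trans (_ : Sm * (eta / 2 / (1 + Sm)) <= _).
    apply: ler_wpM2r; first exact: ltW.
    rewrite [leRHS](bigID nr) /= lerDl; apply: sumr_ge0 => v _; rewrite divr_ge0 //.
  rewrite mulrA ler_pdivrMr ?ltr_wpDr // mulrC ler_wpM2l ?(ltW eta2) //; lra.
have main_le : \sum_(v <- mv | ~~ nr v) am v * P t L i.+1 (be v) v.2 +
    \sum_(v <- mv | nr v) am v / `|be v| * (e i.+1 (be v) * P t L i.+1 (be v) v.2) <=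
    2^-1 * (e i al * P t L i al sg).
  apply: le_trans (_ : \sum_(v <- mv) 2^-1 * (c i * e i al) *
      (am v * omv v * P t L i.+1 (be v) v.2) <= _); last first.
    rewrite -mulr_sumr.
    have ce : 0 <= 2^-1 * (c i * e i al).
      by rewrite mulr_ge0 ?invr_ge0 // mulr_ge0 // ltW.
    apply: le_trans (ler_wpM2l ce step) _.
    by apply: ler_eq; field; rewrite gt_eqF.
  rewrite [leRHS](bigID nr) /= [leLHS]addrC; apply: lerD; apply: ler_sum => v nv.
    have [_ l2 _ bp] := lvl v nv; have Pv := P0 t L i.+1 (be v) v.2 ht'.
    have -> : 2^-1 * (c i * e i al) * (am v * omv v * P t L i.+1 (be v) v.2) =
      am v * (2^-1 * (c i * e i al * omv v)) * P t L i.+1 (be v) v.2 by ring.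
    rewrite mulrA; apply: ler_wpM2r => //.
    by rewrite mulrAC ler_pdivrMr // -(mulrA (am v)); apply: ler_wpM2l.
  have Pv := P0 t L i.+1 (be v) v.2 ht'.
  have -> : 2^-1 * (c i * e i al) * (am v * omv v * P t L i.+1 (be v) v.2) =
    am v * (2^-1 * (c i * e i al * omv v)) * P t L i.+1 (be v) v.2 by ring.
  by rewrite ler_wpM2r // ler_peMr // thr3.
have X_le : \sum_(v <- mv | nr v) am v / `|be v| *
    (rem_coef i.+1 * F t L i.+1 (be v) v.2) <= rem_coef i * F t L i al sg.
  apply: le_trans (_ : \sum_(v <- mv) rem_coef i * c i *
      (am v * omX al (phi v.1.1 v.1.2) * F t L i.+1 (be v) v.2) <= _); last first.
    rewrite -mulr_sumr.
    have ce : 0 <= rem_coef i * c i by rewrite mulr_ge0 // ltW.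
    apply: le_trans (ler_wpM2l ce stepX) _.
    by apply: ler_eq; field; rewrite gt_eqF.
  rewrite big_mkcond; apply: ler_sum => v _; case: ifP => nv; last first.
    by rewrite !mulr_ge0 ?(maj_ge0 M).
  have [_ _ l3 bp] := lvl v nv; have Fv := maj_ge0 M L i.+1 (be v) v.2.
  have -> : rem_coef i.+1 = rem_coef i * 4 by rewrite /rem_coef exprS; ring.
  have -> : am v / `|be v| * (rem_coef i * 4 * F t L i.+1 (be v) v.2) =
    rem_coef i * (am v * 4 / `|be v| * F t L i.+1 (be v) v.2) by ring.
  rewrite -[leRHS]mulrA; apply: ler_wpM2l => //.
  have -> : c i * (am v * omX al (phi v.1.1 v.1.2) * F t L i.+1 (be v) v.2) =
    am v * (c i * omX al (phi v.1.1 v.1.2)) * F t L i.+1 (be v) v.2 by ring.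
  apply: ler_wpM2r => //.
  by rewrite ler_pdivrMr // -(mulrA (am v)); apply: ler_wpM2l.
have sz_le : (size sg)%:R * lprod (Y t) sg <= 2^-1 * (e i al * P t L i al sg).
  apply: le_trans (maj_size M L i al sg) _; rewrite mulrA; apply: ler_wpM2r.
    exact: P0.
  exact: thr4.
apply: le_trans (cabsD _ _) _; rewrite cabsM cabs_expi mul1r.
have := cabsB res tail.
have := ler_wpM2l (g0 t) main_le.
have := ler_wpM2l (g0 t) X_le.
have := ler_wpM2l (g0 t) sz_le.
lra.
Qed.

End NormalForm.

(** * Choice of the thresholds of resonance *)

Section Thresholds.
Variable R : realType.
Implicit Types (A B M Q ga : R).

Lemma large_base ga : 0 < ga -> exists M, 16 <= M /\ 2 <= M `^ ga.
Proof.
move=> ga0; exists (16 * 2 `^ ga^-1).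
have h : 1 <= (2 : R) `^ ga^-1.
  by rewrite -[leLHS](powRr0 2); apply: ler_powR; rewrite ?ler1n // invr_ge0 ltW.
split; first by rewrite ler_peMr.
rewrite powRM ?powR_ge0 // -powRrM mulVf ?gt_eqF // powRr1 //.
rewrite ler_peMl // -[leLHS](powRr0 16); apply: ler_powR; rewrite ?ler1n //; exact: ltW.
Qed.

Lemma large_start ga Q : 0 < ga -> 0 <= Q -> exists A, 1 <= A /\ Q <= A `^ ga.
Proof.
move=> ga0 Q0; exists ((1 + Q) `^ ga^-1).
have h : 1 <= 1 + Q by rewrite lerDl.
split; first by rewrite -[leLHS](powRr0 (1 + Q)); apply: ler_powR; rewrite // invr_ge0 ltW.
by rewrite -powRrM mulVf ?gt_eqF // powRr1 ?addr_ge0 // lerDr.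
Qed.

(** Beyond the threshold [A * M ^+ i], a power of the phase pays for the loss [2 ^+ i] hidden in
    [level_coef]. *)
Lemma geometric_growth ga A M Q B i : 0 < ga -> 1 <= A -> 1 <= M ->
  0 <= Q -> Q <= A `^ ga -> 2 <= M `^ ga -> A * M ^+ i <= B -> Q * 2 ^+ i <= B `^ ga.
Proof.
move=> ga0 A1 M1 Q0 QA M2 h.
have A0 : 0 <= A by apply: le_trans A1.
have M0 : 0 <= M by apply: le_trans M1.
have Mi0 : 0 <= M ^+ i by apply: exprn_ge0.
apply: le_trans (_ : (A * M ^+ i) `^ ga <= _); last first.
  by apply: ge0_ler_powR; rewrite ?nnegrE ?(ltW ga0) ?mulr_ge0 // (le_trans _ h) ?mulr_ge0.
rewrite powRM // -(powR_mulrn i M0) -powRrM (mulrC _ ga) powRrM powR_mulrn ?powR_ge0 //.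
by apply: ler_pM; rewrite ?exprn_ge0 // lerXn2r ?nnegrE ?powR_ge0.
Qed.

Lemma powR_half_sqr B : 0 <= B -> B `^ 2^-1 * B `^ 2^-1 = B.
Proof. by move=> B0; rewrite powR12_sqrt // -expr2 sqr_sqrtr. Qed.

(** The weight times the phase [B] after the move is of order [B] to the power [1 - th], which beats
    the constants beyond the threshold. Below it the weight is at least of order [1 / (A * M ^+ i)],
    and [e] is as large as the inverse demands. *)
Lemma thresholds_B (c0 w0 th b : R) : 0 < c0 -> c0 <= 1 -> 0 < w0 -> 0 < th ->
  th < 1 -> 0 < b -> b <= 1 ->
  let om := fun al f => w0 * (3 + `|al + f|) `^ (- th) in
  exists e NR, thresholds (level_coef c0) om om b e NR.
Proof.
move=> c0p c01 w0p th0 th1 bp b1 om.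
pose ga := 1 - th; have ga0 : 0 < ga by rewrite subr_gt0.
have [M [M16 M2]] := large_base ga0.
have M0 : 0 < M by apply: lt_le_trans M16.
have cw : 0 < c0 * w0 * b by rewrite !mulr_gt0.
(* It makes the coefficient times weight times phase at least [4 * M], twice the ratio [2 * M] of
   successive errors [e]; a further factor 4 is lost in comparing [3 + B] with [B]. *)
pose Q := 16 * M / (c0 * w0 * b).
have Q0 : 0 <= Q by rewrite divr_ge0 ?mulr_ge0 // ltW.
have [A [A1 QA]] := large_start ga0 Q0.
have A0 : 0 < A by apply: lt_le_trans A1.
(* The first term serves the resonant moves, the second the lower bound [(c i)^-1] on the error. *)
pose E := 8 * A / (c0 * w0) + 2 / c0.
exists (fun i _ => E * (2 * M) ^+ i), (fun i al f => A * M ^+ i < `|al + f|).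
have ci0 i : 0 < level_coef c0 i by rewrite divr_gt0 ?exprn_gt0.
have M1 : 1 <= M by lra.
have big i : 1 <= A * M ^+ i by rewrite mulr_ege1 // exprn_ege1.
have om0 al f : 0 <= om al f by rewrite mulr_ge0 ?powR_ge0 // ltW.
have low i al f : A * M ^+ i < `|al + f| -> [/\ 0 < `|al + f|,
    4 * M <= level_coef c0 i * b * om al f * `|al + f| &
    4 * M <= level_coef c0 i * om al f * `|al + f|].
  move=> h; set B := `|al + f| in h *.
  have B1 : 1 <= B by apply: le_trans (big i) (ltW h).
  have B0 : 0 < B by apply: lt_le_trans B1.
  have h1 : w0 * B `^ ga <= B * (4 * om al f).
    rewrite /om -/B (_ : B `^ ga = B * B `^ (- th)); last first.
      by rewrite /ga powRB ?gt_eqF ?implybT // powRr1 ?powRN // ltW.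
    have -> : B * (4 * (w0 * (3 + B) `^ (- th))) = w0 * (B * (4 * (3 + B) `^ (- th))).
      by ring.
    rewrite ler_pM2l // ler_pM2l //.
    apply: le_trans (_ : 4 * (4 * B) `^ (- th) <= _).
      rewrite powRM // ?(ltW B0) // mulrA ler_peMl ?powR_ge0 //.
      rewrite powRN -ler_pdivrMr ?invr_gt0 ?powR_gt0 // mul1r invrK.
      by apply: ler1_powR; rewrite ?ler1n // ltW.
    rewrite ler_pM2l // !powRN lef_pV2 ?posrE ?powR_gt0 ?mulr_gt0 ?addr_gt0 //.
    apply: ge0_ler_powR; rewrite ?nnegrE ?(ltW th0) ?addr_ge0 ?mulr_ge0 ?(ltW B0) //; lra.
  have h2 : 16 * M <= level_coef c0 i * b * (w0 * B `^ ga).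
    have := geometric_growth ga0 A1 M1 Q0 QA M2 (ltW h).
    rewrite /Q -ler_pdivlMr ?exprn_gt0 // ler_pdivrMr // => /le_trans; apply.
    by apply: ler_eq; rewrite /level_coef; ring.
  have cb0 : 0 <= level_coef c0 i * b by rewrite mulr_ge0 // ltW.
  have h3 : 4 * M <= level_coef c0 i * b * om al f * B.
    have := le_trans h2 (ler_wpM2l cb0 h1); lra.
  split=> //; apply: le_trans h3 _; apply: ler_wpM2r; first exact: ltW.
  by apply: ler_wpM2r => //; rewrite ler_piMr // ltW.
have p2 i : 0 < (2 : R) ^+ i by rewrite exprn_gt0.
split=> [i al f nr|i al f nr|i al f nnr|i al|].
- have [B0 h1 h2] := low i al f nr; split; first by rewrite -normr_gt0.
  by split; rewrite ler_pdivrMr //; lra.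
- have [B0 _ h2] := low i al f nr; set B := `|al + f| in B0 h2 *.
  have E0 : 0 <= E * (2 * M) ^+ i.
    by rewrite mulr_ge0 ?exprn_ge0 ?addr_ge0 ?divr_ge0 ?mulr_ge0 // ltW // mulr_gt0.
  rewrite ler_pdivrMr // exprS.
  have -> : E * (2 * M * (2 * M) ^+ i) = E * (2 * M) ^+ i * (2 * M) by ring.
  have -> : 2^-1 * (level_coef c0 i * (E * (2 * M) ^+ i) * om al f) * B =
    E * (2 * M) ^+ i * (level_coef c0 i * om al f * B / 2) by field.
  by apply: ler_wpM2l => //; lra.
- rewrite -leNgt in nnr; set B := `|al + f| in nnr *.
  have B0 : 0 <= B by apply: normr_ge0.
  have o1 : w0 * (4 * A * M ^+ i)^-1 <= om al f.
    rewrite /om -/B ler_pM2l // powRN lef_pV2 ?posrE ?powR_gt0 ?mulr_gt0 ?exprn_gt0 ?ltr_wpDr //.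
    have b4 : 3 + B <= 4 * A * M ^+ i by rewrite -mulrA; have := big i; lra.
    apply: le_trans b4; apply: ler1_powR; last exact: ltW.
    by lra.
  have Ege : 8 * A / (c0 * w0) <= E by rewrite /E lerDl divr_ge0 // ltW.
  apply: le_trans (_ : 2^-1 * (level_coef c0 i * (8 * A / (c0 * w0) * (2 * M) ^+ i) *
     (w0 * (4 * A * M ^+ i)^-1)) <= _).
    rewrite /level_coef exprMn; apply: ler_eq; field.
    by rewrite !expf_neq0 ?gt_eqF.
  rewrite ler_pM2l ?invr_gt0 //; apply: ler_pM => //.
  + by rewrite !mulr_ge0 ?invr_ge0 ?exprn_ge0 ?mulr_ge0 // ltW.
  + by rewrite !mulr_ge0 ?invr_ge0 ?exprn_ge0 ?mulr_ge0 ?exprn_ge0 // ltW.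
  + apply: ler_wpM2l; first exact: ltW.
    apply: ler_wpM2r => //; apply: exprn_ge0; apply: mulr_ge0 => //; exact: ltW.
- have Ege : 2 / c0 <= E by rewrite /E lerDr divr_ge0 ?mulr_ge0 // ltW.
  have h : (2 : R) ^+ i <= (2 * M) ^+ i.
    by rewrite lerXn2r ?nnegrE ?mulr_ge0 ?(ltW M0) // ler_peMr.
  rewrite /level_coef invf_div.
  have -> : 2 ^+ i / c0 = 2^-1 * (2 / c0 * 2 ^+ i) by field; rewrite gt_eqF.
  have q0 : 0 <= 2 / c0 by rewrite divr_ge0 // ltW.
  by rewrite ler_pM2l ?invr_gt0 //; exact: ler_pM q0 (ltW (p2 i)) Ege h.
- by split.
Qed.

(** Here the weight decays in the phase [f] of the move itself. Calling a move nonresonant when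
    [|al + f|] exceeds [M * rho], with [rho] at least [|al|], keeps [|f|] comparable to [|al + f|].
    The error, of order the square root of [rho], compensates the decay 1/2 for resonant moves; for
    the others [rho] becomes [|al + f|], and dividing by it leaves exactly that decay. *)
Lemma thresholds_A (c0 delta b : R) : 0 < c0 -> c0 <= 1 -> 0 < delta ->
  delta < 2^-1 -> 0 < b -> b <= 1 ->
  let om := fun _ f : R => 2^-1 * (1 + `|f|) `^ (- 2^-1) in
  let omX := fun _ f : R => 2^-1 * (1 + `|f|) `^ (- (1 - delta)) in
  exists e NR, thresholds (level_coef c0) om omX b e NR.
Proof.
move=> c0p c01 de0 de1 bp b1 om omX.
have [M [M16 M2]] := large_base de0.
have M0 : 0 < M by apply: lt_le_trans M16.
have M1 : 1 <= M by lra.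
have cb : 0 < c0 * b by rewrite mulr_gt0.
pose Q := 32 / (c0 * b).
have Q0 : 0 <= Q by rewrite divr_ge0 // ltW.
have [A [A1 QA]] := large_start de0 Q0.
have A0 : 0 < A by apply: lt_le_trans A1.
pose rho i (al : R) := Num.max (A * M ^+ i) `|al|.
pose E := 8 * (M + 2) / c0.
have E0 : 0 <= E by rewrite divr_ge0 ?mulr_ge0 ?addr_ge0 // ltW.
exists (fun i al => E * 4 ^+ i * rho i al `^ 2^-1), (fun i al f => M * rho i al < `|al + f|).
have p2 i : 0 < (2 : R) ^+ i by rewrite exprn_gt0.
have ci0 i : 0 < level_coef c0 i by rewrite divr_gt0 ?exprn_gt0.
have big i : 1 <= A * M ^+ i by rewrite mulr_ege1 // exprn_ege1.
have rho1 i al : 1 <= rho i al by rewrite le_max big.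
have rho0 i al : 0 < rho i al by apply: lt_le_trans (rho1 i al).
(* Every quantity above the start A M^i of level i beats the loss 2^i. *)
have beats i B : A * M ^+ i <= B -> 32 <= level_coef c0 i * b * B `^ delta.
  move=> h; have := geometric_growth de0 A1 M1 Q0 QA M2 h.
  rewrite /Q -ler_pdivlMr // ler_pdivrMr // => /le_trans; apply.
  by rewrite /level_coef; apply: ler_eq; ring.
have beats2 i B : A * M ^+ i <= B -> 32 <= level_coef c0 i * b * B `^ 2^-1.
  move=> h; apply: le_trans (beats i B h) _; apply: ler_wpM2l.
    by rewrite mulr_ge0 // ltW.
  by apply: ler_powR; [exact: le_trans (big i) h|exact: ltW].
have beats3 i B : A * M ^+ i <= B -> 32 <= level_coef c0 i * B `^ 2^-1.
  move=> h; apply: le_trans (beats2 i B h) _; rewrite ler_wpM2r ?powR_ge0 //.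
  by rewrite ler_piMr // ltW.
have nrP i al f : M * rho i al < `|al + f| ->
    [/\ 1 <= `|al + f|, A * M ^+ i.+1 <= `|al + f|, rho i al <= `|al + f| &
        1 + `|f| <= 4 * `|al + f|].
  move=> h; have r1 := rho1 i al.
  have hA : A * M ^+ i <= rho i al by rewrite le_max lexx.
  have hal : `|al| <= rho i al by rewrite le_max lexx orbT.
  have hM : rho i al <= M * rho i al by rewrite ler_peMl // ltW.
  have h1 : A * M ^+ i.+1 <= `|al + f|.
    apply: le_trans (ltW h); rewrite exprS mulrCA; apply: ler_wpM2l => //; exact: ltW.
  have hf : `|f| <= `|al + f| + `|al|.
    by rewrite -[X in `|X| <= _](addKr al) addrC (le_trans (ler_normD _ _)) // normrN.
  split=> //; lra.
have half_ge (x y : R) : 0 < x -> x <= 4 * y -> (4 * y `^ 2^-1)^-1 <= 2^-1 * x `^ (- 2^-1).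
  move=> x0 xy; have y0 : 0 < y by lra.
  have -> : 4 * y `^ 2^-1 = 2 * (4 * y) `^ 2^-1.
    have s4 : (4 : R) `^ 2^-1 = 2.
      rewrite powR12_sqrt // (_ : 4 = 2 ^+ 2 :> R); last by ring.
      by rewrite sqrtr_sqr ger0_norm.
    rewrite powRM ?(ltW y0) // s4; ring.
  rewrite invfM ler_pM2l ?invr_gt0 // powRN lef_pV2 ?posrE ?powR_gt0 ?mulr_gt0 //.
  by apply: ge0_ler_powR; rewrite ?nnegrE ?invr_ge0 ?(ltW x0) ?mulr_ge0 ?(ltW y0).
have omX_ge (x y : R) : 0 < x -> x <= 4 * y -> 1 <= y ->
    y `^ delta / (8 * y) <= 2^-1 * x `^ (- (1 - delta)).
  move=> x0 xy y1; have y0 : 0 < y by lra.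
  have -> : y `^ delta / (8 * y) = 2^-1 * (4 * y `^ (1 - delta))^-1.
    have -> : y `^ (1 - delta) = y / y `^ delta.
      by rewrite powRB ?(gt_eqF y0) ?implybT // powRr1 // ltW.
    have yd0 : 0 < y `^ delta by apply: powR_gt0.
    by field; rewrite (gt_eqF y0) (gt_eqF yd0).
  rewrite ler_pM2l ?invr_gt0 // powRN lef_pV2 ?posrE ?powR_gt0 ?mulr_gt0 ?powR_gt0 //.
  apply: le_trans (_ : (4 * y) `^ (1 - delta) <= _).
    by apply: ge0_ler_powR; rewrite ?nnegrE ?(ltW x0) ?mulr_ge0 ?(ltW y0) //; lra.
  rewrite powRM ?(ltW y0) // ler_wpM2r ?powR_ge0 //; apply: ler1_powR; lra.
split=> [i al f nr|i al f nr|i al f nnr|i al|].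
- have [B1 hA hr hf] := nrP i al f nr; set B := `|al + f| in B1 hA hr hf *.
  have B0 : 0 < B by lra.
  have hAi : A * M ^+ i <= B.
    apply: le_trans hA; rewrite ler_pM2l // exprS ler_peMl // exprn_ge0 //; exact: ltW.
  have f0 : 0 < 1 + `|f| by rewrite ltr_wpDr.
  split; first by rewrite -normr_gt0.
  split; rewrite ler_pdivrMr //.
    have h1 := half_ge _ _ f0 hf; have h2 := beats2 i B hAi.
    set h := B `^ 2^-1 in h1 h2.
    have hh : h * h = B by apply: powR_half_sqr; apply: ltW.
    have h0 : 0 < h by apply: powR_gt0.
    have k : level_coef c0 i * b * (4 * h)^-1 <= level_coef c0 i * b * om al f.
      by rewrite ler_wpM2l // mulr_ge0 // ltW.
    apply: le_trans (ler_wpM2r (ltW B0) k).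
    rewrite -[X in _ <= _ * X]hh invfM.
    have -> : level_coef c0 i * b * (4^-1 * h^-1) * (h * h) =
      4^-1 * (level_coef c0 i * b * h) by field; rewrite gt_eqF.
    lra.
  have h1 := omX_ge _ _ f0 hf B1; have h2 := beats i B hAi.
  have k : level_coef c0 i * (B `^ delta / (8 * B)) <= level_coef c0 i * omX al f.
    by rewrite ler_wpM2l // ltW.
  apply: le_trans (ler_wpM2r (ltW B0) k).
  have -> : level_coef c0 i * (B `^ delta / (8 * B)) * B =
    8^-1 * (level_coef c0 i * B `^ delta) by field; rewrite gt_eqF.
  have : level_coef c0 i * b * B `^ delta <= level_coef c0 i * B `^ delta.
    by rewrite ler_wpM2r ?powR_ge0 // ler_piMr // ltW.
  lra.
- have [B1 hA hr hf] := nrP i al f nr; set B := `|al + f| in B1 hA hr hf *.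
  have B0 : 0 < B by lra.
  have f0 : 0 < 1 + `|f| by rewrite ltr_wpDr.
  have -> : rho i.+1 (al + f) = B by apply/max_idPr.
  have h1 := half_ge _ _ f0 hf.
  have h2 : 32 <= level_coef c0 i * rho i al `^ 2^-1.
    by apply: beats3; rewrite le_max lexx.
  set h := B `^ 2^-1 in h1 *; set r := rho i al `^ 2^-1 in h2 *.
  have hh : h * h = B by apply: powR_half_sqr; apply: ltW.
  have h0 : 0 < h by apply: powR_gt0.
  rewrite ler_pdivrMr //.
  have c2 : 0 <= level_coef c0 i * r by lra.
  have Ei : 0 <= E * 4 ^+ i by rewrite mulr_ge0 // exprn_ge0.
  have k : 2^-1 * (E * 4 ^+ i * (level_coef c0 i * r)) * (4 * h)^-1 <=
      2^-1 * (level_coef c0 i * (E * 4 ^+ i * r) * om al f).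
    have -> : 2^-1 * (level_coef c0 i * (E * 4 ^+ i * r) * om al f) =
      2^-1 * (E * 4 ^+ i * (level_coef c0 i * r)) * om al f by ring.
    by apply: ler_wpM2l => //; apply: mulr_ge0 (mulr_ge0 Ei c2); rewrite invr_ge0.
  apply: le_trans (ler_wpM2r (ltW B0) k).
  rewrite -[X in _ <= _ * X]hh.
  have -> : 2^-1 * (E * 4 ^+ i * (level_coef c0 i * r)) * (4 * h)^-1 * (h * h) =
    E * 4 ^+ i * (8^-1 * (level_coef c0 i * r)) * h by field; rewrite gt_eqF.
  apply: ler_wpM2r; first exact: ltW.
  rewrite exprS mulrCA (mulrC 4) ler_wpM2l //; lra.
- rewrite -leNgt in nnr; set B := `|al + f| in nnr *.
  have r1 := rho1 i al; have r0 := rho0 i al.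
  have hal : `|al| <= rho i al by rewrite le_max lexx orbT.
  have hf : `|f| <= B + `|al|.
    by rewrite -[X in `|X| <= _](addKr al) addrC (le_trans (ler_normD _ _)) // normrN.
  have f0 : 0 < 1 + `|f| by rewrite ltr_wpDr.
  have M20 : 0 < M + 2 by lra.
  have hf4 : 1 + `|f| <= 4 * ((M + 2) * rho i al) by nra.
  have h1 := half_ge _ _ f0 hf4.
  set r := rho i al `^ 2^-1.
  have r20 : 0 < r by apply: powR_gt0.
  have rr : ((M + 2) * rho i al) `^ 2^-1 <= (M + 2) * r.
    rewrite powRM ?(ltW M20) ?(ltW r0) // ler_wpM2r ?powR_ge0 //.
    apply: ler1_powR; lra.
  have o1 : (4 * ((M + 2) * r))^-1 <= om al f.
    have q1 : 0 < 4 * ((M + 2) * r) by apply: mulr_gt0 => //; apply: mulr_gt0.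
    have q2 : 0 < 4 * ((M + 2) * rho i al) `^ 2^-1.
      by apply: mulr_gt0 => //; apply: powR_gt0; apply: mulr_gt0.
    by apply: le_trans h1; rewrite lef_pV2 ?posrE // ler_pM2l.
  have c4 : level_coef c0 i * 4 ^+ i = c0 * 2 ^+ i.
    rewrite /level_coef; have -> : (4 : R) ^+ i = 2 ^+ i * 2 ^+ i.
      by rewrite -exprMn; congr (_ ^+ _); ring.
    by field; rewrite gt_eqF.
  apply: le_trans (_ : 2^-1 * (level_coef c0 i * (E * 4 ^+ i * r) *
      (4 * ((M + 2) * r))^-1) <= _); last first.
    rewrite ler_pM2l ?invr_gt0 //; apply: ler_wpM2l => //.
    apply: mulr_ge0; first exact: ltW.
    by apply: mulr_ge0; [apply: mulr_ge0 => //; apply: exprn_ge0|apply: ltW].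
  have -> : 2^-1 * (level_coef c0 i * (E * 4 ^+ i * r) * (4 * ((M + 2) * r))^-1) =
      2^-1 * (level_coef c0 i * 4 ^+ i) * (E / (4 * (M + 2))).
    by field; rewrite (gt_eqF r20) (gt_eqF M20).
  rewrite c4 /E.
  have -> : 2^-1 * (c0 * 2 ^+ i) * (8 * (M + 2) / c0 / (4 * (M + 2))) = 2 ^+ i.
    by field; rewrite (gt_eqF c0p) (gt_eqF M20).
  by rewrite exprn_ege1 // ler1n.
- have r1 : 1 <= rho i al `^ 2^-1.
    by rewrite -[leLHS](powRr0 (rho i al)); apply: ler_powR; rewrite ?invr_ge0.
  have E2 : 2 / c0 <= E by rewrite /E ler_pM2r ?invr_gt0 //; lra.
  have E40 : 0 <= E * 4 ^+ i by rewrite mulr_ge0 // exprn_ge0.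
  rewrite /level_coef invf_div.
  have -> : 2 ^+ i / c0 = 2^-1 * (2 / c0 * 2 ^+ i) by field; rewrite gt_eqF.
  rewrite ler_pM2l ?invr_gt0 //; apply: le_trans (ler_peMr E40 r1).
  have q0 : 0 <= 2 / c0 by rewrite divr_ge0 // ltW.
  have h24 : (2 : R) ^+ i <= 4 ^+ i.
    by rewrite lerXn2r ?nnegrE // ler_nat.
  exact: ler_pM q0 (ltW (p2 i)) E2 h24.
- by split=> al f; rewrite mulr_ge0 ?powR_ge0.
Qed.

End Thresholds.

(** * Weak derivatives of continuous functions *)

Section Smooth.
Variable R : realType.
Implicit Types (f g : R -> R) (x : R).

Lemma is_derive_flat0 f (C : R) : (forall t, `|f t| <= C * t ^+ 2) -> is_derive (0 : R) 1 f 0.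
Proof.
move=> hf; have f00 : f 0 = 0.
  by apply/eqP; rewrite -normr_le0; have := hf 0; rewrite expr0n mulr0.
have C0 : 0 <= C.
  by have := le_trans (normr_ge0 _) (hf 1); rewrite expr1n mulr1.
have g0 : f 0 / 0 = 0 by rewrite invr0 mulr0.
apply/is_derive1_caratheodory; exists (fun z => f z / z); split=> //.
  move=> z; rewrite f00 !subr0; have [->|z0] := eqVneq z 0; first by rewrite f00 mulr0.
  by rewrite divfK.
rewrite /prop_for /continuous_at g0; apply/cvgrPdist_le => eps eps0.
have C1 : 0 < C + 1 by rewrite ltr_wpDl.
near=> h; rewrite sub0r normrN normrM normfV.
have hd : `|h| < eps / (C + 1).
  by near: h; apply: (@nbhs0_lt _ R); rewrite divr_gt0.
have [->|h0] := eqVneq h 0; first by rewrite normr0 invr0 mulr0 ltW.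
rewrite ler_pdivrMr ?normr_gt0 //.
apply: le_trans (hf h) _; rewrite -real_normK ?num_real // expr2 mulrA.
apply: ler_wpM2r => //.
have : C * `|h| <= C * (eps / (C + 1)) by rewrite ler_wpM2l // ltW.
move/le_trans; apply; rewrite mulrA ler_pdivrMr // mulrC ler_wpM2l ?(ltW eps0) //.
by rewrite lerDl.
Unshelve. all: by end_near. Qed.

Fixpoint smooth k f : Prop :=
  if k is k'.+1 then (forall x, derivable f x 1) /\ smooth k' (derive1 f) else True.

Lemma smooth_derive1n k f : smooth k.+1 f -> forall x, derivable (derive1n k f) x 1.
Proof.
elim: k f => [|k IH] f [h1 h2] x; first exact: h1.
by rewrite /derive1n iterSr; apply: IH.
Qed.

Lemma smoothS k f g : (forall x, is_derive x 1 f (g x)) -> smooth k g -> smooth k.+1 f.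
Proof.
move=> h sg; split=> [x|]; first exact: derivable_of (h x).
by rewrite (_ : derive1 f = g) //; apply/funext => x; apply: derive1_of.
Qed.

Lemma smooth_is_derive k f x : smooth k.+1 f -> is_derive x 1 f (derive1 f x).
Proof. by move=> [h _]; rewrite derive1E; apply/derivableP/h. Qed.

Lemma smooth_pred k f : smooth k.+1 f -> smooth k f.
Proof. by elim: k f => [//|k IH] f [h1 h2]; split=> //; apply: IH. Qed.

Lemma smooth_cst k (c : R) : smooth k (fun=> c).
Proof.
by elim: k c => [//|k IH] c; apply: (@smoothS _ _ (fun=> 0)) => // x; apply: is_derive_cst.
Qed.

Lemma smoothD k f g : smooth k f -> smooth k g -> smooth k (fun x => f x + g x).
Proof.
elim: k f g => [//|k IH] f g sf sg.
have h x := is_derive_add (smooth_is_derive x sf) (smooth_is_derive x sg).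
by apply: (smoothS h); apply: IH; [case: sf|case: sg].
Qed.

Lemma smoothM k f g : smooth k f -> smooth k g -> smooth k (fun x => f x * g x).
Proof.
elim: k f g => [//|k IH] f g sf sg.
have h x := is_derive_mul (smooth_is_derive x sf) (smooth_is_derive x sg).
apply: (smoothS h); apply: smoothD; apply: IH; by [case: sf|case: sg|apply: smooth_pred].
Qed.

Lemma smoothV k f : (forall x, f x != 0) -> smooth k f -> smooth k (fun x => (f x)^-1).
Proof.
move=> f0; elim: k => [//|k IH] sf.
have h x : is_derive x 1 (fun x => (f x)^-1)
    (-1 * derive1 f x * ((f x)^-1 * (f x)^-1)).
  have := is_derive_inv (f0 x) (smooth_is_derive x sf).
  by move/is_derive_eq; apply; rewrite expr2 invfM; ring.
apply: (smoothS h).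
have sV := IH (smooth_pred sf).
apply: smoothM; last exact: smoothM.
by apply: smoothM; [exact: smooth_cst|case: sf].
Qed.

Lemma smooth_affine k f (a b : R) : smooth k f -> smooth k (fun x => f (a * x + b)).
Proof.
elim: k f => [//|k IH] f sf.
have h x : is_derive x 1 (fun x => f (a * x + b)) (a * derive1 f (a * x + b)).
  have := @is_derive1_comp R f (fun r => a * r + b) x _ _
    (smooth_is_derive (a * x + b) sf) (is_derive_affine a b x).
  by rewrite mulrC.
apply: (smoothS h); apply: smoothM; first exact: smooth_cst.
by apply: IH; case: sf.
Qed.

(** The parameter [k] makes this family, which starts from [exp(-1/x)], stable under differentiation
    up to linear combinations, so that smoothness follows by induction. *)
Definition flat (k : nat) x : R := if 0 < x then x^-1 ^+ k * expR (- x^-1) else 0.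

Lemma flat_ge0 k x : 0 <= flat k x.
Proof.
rewrite /flat; case: ltP => // x0.
by rewrite mulr_ge0 ?expR_ge0 // exprn_ge0 // invr_ge0 ltW.
Qed.

Lemma flat_gt0 k x : 0 < x -> 0 < flat k x.
Proof. by move=> x0; rewrite /flat x0 mulr_gt0 ?expR_gt0 // exprn_gt0 // invr_gt0. Qed.

Lemma flat_le0 k x : x <= 0 -> flat k x = 0.
Proof. by move=> x0; rewrite /flat ltNge x0. Qed.

(** The exponential of [1/x] dominates its Taylor term of order [k + 2]; the two spare powers give
    the derivative 0 at the origin. *)
Lemma flat_bound k x : `|flat k x| <= (k.+2)`!%:R * x ^+ 2.
Proof.
rewrite ger0_norm ?flat_ge0 // /flat; case: ltP => [x0|_]; last first.
  by rewrite mulr_ge0 ?sqr_ge0.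
have y0 : 0 < x^-1 by rewrite invr_gt0.
have := expR_ge1Dxn k.+1 (ltW y0).
set y := x^-1 in y0 *; have -> : x ^+ 2 = y ^- 2 by rewrite exprVn invrK.
set q : R := (k.+2)`!%:R; have q0 : 0 < q by rewrite ltr0n fact_gt0.
move=> h; rewrite expRN ler_pdivrMr ?expR_gt0 //.
have h1 : y ^+ k.+2 / q <= expR y by apply: le_trans h; rewrite lerDr.
have -> : y ^+ k = q * y ^- 2 * (y ^+ k.+2 / q).
  by rewrite !exprS; field; rewrite !gt_eqF.
by rewrite ler_wpM2l // mulr_ge0 ?invr_ge0 ?exprn_ge0 // ltW.
Qed.

Lemma flat_derive k x : is_derive x 1 (flat k) (flat k.+2 x - k%:R * flat k.+1 x).
Proof.
have [x0|x0|->] := ltgtP x 0.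
- have near0 : \near x, (cst 0 : R -> R) x = flat k x.
    by near=> y; rewrite flat_le0 // ltW //; near: y; exact: lt_nbhsl.
  have := near_eq_is_derive near0 (is_derive_cst 0 x 1).
  by rewrite !(flat_le0 _ (ltW x0)) mulr0 subr0.
- have nearE : \near x, x^-1 ^+ k * expR (- x^-1) = flat k x.
    by near=> y; rewrite /flat ifT //; near: y; exact: lt_nbhsr.
  have dV : is_derive x 1 (fun y : R => y^-1) (- x^-1 ^+ 2).
    have := @is_derive_inv R id x 1 (lt0r_neq0 x0) (is_derive_id x 1).
    by move/is_derive_eq; apply; rewrite exprVn mulN1r.
  have dP : is_derive x 1 (fun y : R => y^-1 ^+ k) (- k%:R * x^-1 ^+ k.+1).
    elim: (k) => [|k' IH].
      by have := is_derive_cst (1 : R) x (1 : R); rewrite oppr0 mul0r.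
    under eq_fun => y do rewrite exprS.
    have := is_derive_mul dV IH; move/is_derive_eq; apply.
    rewrite -natr1 !exprS; ring.
  have dN : is_derive x 1 (fun y : R => - y^-1) (x^-1 ^+ 2).
    by have := @is_deriveN _ _ _ (fun y : R => y^-1) x 1 _ dV; rewrite opprK.
  have dE := @is_derive1_comp R expR (fun y : R => - y^-1) x _ _
    (is_derive_expR (- x^-1)) dN.
  have := near_eq_is_derive nearE (is_derive_mul dP dE).
  move/is_derive_eq; apply; rewrite /flat x0 /= !exprS; ring.
- rewrite !flat_le0 // mulr0 subr0; exact: is_derive_flat0 (flat_bound k).
Unshelve. all: by end_near. Qed.

Lemma smooth_flat j k : smooth j (flat k).
Proof.
elim: j k => [//|j IH] k.
apply: (smoothS (flat_derive k)).
rewrite (_ : (fun x => _) = fun x => flat k.+2 x + (- k%:R) * flat k.+1 x).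
  by apply: smoothD => //; apply: smoothM => //; apply: smooth_cst.
by apply/funext => x; rewrite mulNr.
Qed.

(** The classical smooth step: 0 up to the origin and 1 from [e] on. *)
Definition sstep (e x : R) := flat 0 x / (flat 0 x + flat 0 (-1 * x + e)).

Lemma sstep_den e x : 0 < e -> 0 < flat 0 x + flat 0 (-1 * x + e).
Proof.
move=> e0; have [x0|x0] := ltP 0 x; first by rewrite ltr_wpDr ?flat_ge0 ?flat_gt0.
by rewrite ltr_wpDl ?flat_ge0 ?flat_gt0 //; lra.
Qed.

Lemma sstep_smooth k e : 0 < e -> smooth k (sstep e).
Proof.
move=> e0; apply: smoothM; first exact: smooth_flat.
apply: smoothV => [x|]; first by rewrite gt_eqF // sstep_den.
apply: smoothD; first exact: smooth_flat.
by apply: (@smooth_affine k (flat 0)); apply: smooth_flat.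
Qed.

Lemma sstep_le0 e x : x <= 0 -> sstep e x = 0.
Proof. by move=> x0; rewrite /sstep flat_le0 // mul0r. Qed.

Lemma sstep_ge e x : 0 < e -> e <= x -> sstep e x = 1.
Proof.
move=> e0 ex; rewrite /sstep (@flat_le0 0 (-1 * x + e)); last by lra.
by rewrite addr0 divff // gt_eqF // flat_gt0 // (lt_le_trans e0).
Qed.

Lemma sstep_derive e x : 0 < e -> exists l, [/\ is_derive x 1 (sstep e) l, 0 <= l &
  0 < x < e -> 0 < l].
Proof.
move=> e0; set u := flat 0 x; set v := flat 0 (-1 * x + e).
have duv : 0 < u + v := sstep_den x e0.
have du := flat_derive 0 x; rewrite mul0r subr0 in du.
have dv0 := flat_derive 0 (-1 * x + e); rewrite mul0r subr0 in dv0.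
have dv := @is_derive1_comp R (flat 0) (fun r => -1 * r + e) x _ _ dv0
  (is_derive_affine (-1) e x).
have dinv := @is_derive_inv R (fun r => flat 0 r + flat 0 (-1 * r + e)) x _
  (lt0r_neq0 duv) (is_derive_add du dv).
have := is_derive_mul du dinv; rewrite /= -/u -/v.
set u2 := flat 2 x; set v2 := flat 2 (-1 * x + e) => h.
exists ((u2 * v + u * v2) / (u + v) ^+ 2); split.
- move: h; move/is_derive_eq; apply; field; exact: lt0r_neq0.
- by rewrite divr_ge0 ?sqr_ge0 ?addr_ge0 ?mulr_ge0 ?flat_ge0.
- move=> /andP[x0 xe]; rewrite divr_gt0 ?exprn_gt0 //.
  by rewrite ltr_wpDr ?mulr_ge0 ?flat_ge0 // mulr_gt0 ?flat_gt0 //; lra.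
Qed.

End Smooth.

Section Distributions.
Variable R : realType.
Implicit Types (f g u : R -> R) (T : R).
Local Notation mu := (@lebesgue_measure R).

Lemma derive_le0_le (H dH : R -> R) (a b : R) : a <= b ->
  (forall x, a < x < b -> is_derive x 1 H (dH x)) ->
  (forall x, a < x < b -> dH x <= 0) ->
  (forall x, a <= x <= b -> {for x, continuous H}) -> H b <= H a.
Proof.
move=> ab dd dle cH.
have [->//|nab] := eqVneq a b.
have lt_ab : a < b by rewrite lt_neqAle nab.
have dd' x : x \in `]a, b[ -> is_derive x 1 H (dH x) by rewrite in_itv; apply: dd.
have cH' : {within `[a, b], continuous H}.
  by apply: continuous_in_subspaceT => y /set_mem; rewrite /= in_itv /=; apply: cH.
have [y] := MVT lt_ab dd' cH'.
rewrite in_itv /= => hy E'; rewrite -subr_le0 E'.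
by apply: mulr_le0_ge0; [exact: dle|rewrite subr_ge0].
Qed.

(** The margin of length 1 on either side makes the primitive differentiable at 0 and [T] too. *)
Lemma primitive_exists T g : 0 < T -> continuous g ->
  exists G : R -> R, forall x, -1 < x < T + 1 -> is_derive x 1 G (g x).
Proof.
move=> T0 cg; exists (fun x => \int[mu]_(t in `[(-1 : R), x]) g t)%R => x /andP[x1 xT].
have ig : mu.-integrable `[(-1 : R), (T + 1)] (EFin \o g).
  apply: continuous_compact_integrable; first exact: segment_compact.
  exact: continuous_subspaceT.
have [d e] := continuous_FTC1_closed xT ig x1 (cg x).
by have := derivableP d; rewrite -derive1E e.
Qed.

Lemma primitive_integral T (G g : R -> R) : 0 < T -> continuous g ->
  (forall x, -1 < x < T + 1 -> is_derive x 1 G (g x)) ->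
  (\int[mu]_(x in `]0%R, T[) g x)%R = G T - G 0.
Proof.
move=> T0 cg hG.
have cG x : -1 < x < T + 1 -> {for x, continuous G}.
  by move=> /hG /is_derive_continuous.
have := @continuous_FTC2 R g G 0 T T0 (continuous_subspaceT cg) _ _.
move=> h; have {}h : (\int[mu]_(x in `[0%R, T]) (g x)%:E = (G T)%:E - (G 0)%:E)%E.
  apply: h.
    split.
    - move=> x; rewrite in_itv /= => /andP[x0 xT].
      by apply: derivable_of (hG x _); lra.
    - by apply: cvg_at_right_filter; apply: cG; lra.
    - by apply: cvg_at_left_filter; apply: cG; lra.
  move=> x; rewrite in_itv /= => /andP[x0 xT].
  by apply: derive1_of; apply: hG; lra.
have ig : mu.-integrable `[0, T] (EFin \o g).
  apply: continuous_compact_integrable; first exact: segment_compact.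
  exact: continuous_subspaceT.
rewrite Rintegral_itv_obnd_cbnd; last first.
  by apply: integrableS ig => //; apply: subset_itv_oo_cc.
rewrite Rintegral_itv_bndo_bndc; last first.
  by apply: integrableS ig => //; apply: subset_itv_co_cc.
by rewrite /Rintegral h.
Qed.

(* If h a < c < h b for h = u - F, choose psi equal to 1 between a and b: then
   psi' (h - c) <= 0, and its integral cannot vanish. *)
Lemma weak_derivative T u f : 0 < T -> continuous u -> continuous f ->
  (forall psi, test_function T psi ->
     - (\int[mu]_(x in `]0%R, T[) (derive1 psi x * u x))%R =
     (\int[mu]_(x in `]0%R, T[) (psi x * f x))%R) ->
  forall F, (forall x, -1 < x < T + 1 -> is_derive x 1 F (f x)) ->
  forall a b, 0 < a -> a < b -> b < T -> ~ (u a - F a < u b - F b).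
Proof.
move=> T0 cu cf hpsi F hF a b a0 ab bT lt_ab.
have cF (x : R) : -1 < x < T + 1 -> {for x, continuous F}.
  by move=> /hF /is_derive_continuous.
pose h x := u x - F x.
have ch (x : R) : 0 < x < T -> {for x, continuous h}.
  move=> hx; apply: continuousB; [exact: cu|apply: cF; lra].
pose c := (h a + h b) / 2.
have hac : h a < c by rewrite /c; move: lt_ab; rewrite -/(h a) -/(h b); lra.
have hcb : c < h b by rewrite /c; move: lt_ab; rewrite -/(h a) -/(h b); lra.
have cva : h x @[x --> a] --> h a by apply: ch; lra.
have cvb : h x @[x --> b] --> h b by apply: ch; lra.
have na : \forall x \near a, h x < c by exact: cvgr_lt cva _ hac.
have nb : \forall x \near b, c < h x by exact: cvgr_gt cvb _ hcb.
move/nbhs_ballP: na => [ra /= ra0 hra]; move/nbhs_ballP: nb => [rb /= rb0 hrb].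
(* The steps of [psi], of width [e] after [a] and after [b], must lie where [h < c] and [h > c]
   respectively, be disjoint, and stay below [T]. *)
pose e := Num.min (Num.min ra rb) (Num.min (b - a) (T - b)) / 2.
have e0 : 0 < e by rewrite divr_gt0 // !lt_min ra0 rb0 !subr_gt0 ab bT.
have he : e < Num.min (Num.min ra rb) (Num.min (b - a) (T - b)).
  by rewrite /e ltr_pdivrMr // mulr_natr mulr2n ltrDl; move: e0; rewrite /e; lra.
move: he; rewrite !lt_min => /andP[/andP[era erb] /andP[eab ebT]].
pose psi x := sstep e (1 * x + - a) + (-1) * sstep e (1 * x + - b).
have spsi k : smooth k psi.
  apply: smoothD; first by apply: (@smooth_affine _ k (sstep e)); apply: sstep_smooth.
  apply: smoothM; first exact: smooth_cst.
  by apply: (@smooth_affine _ k (sstep e)); apply: sstep_smooth.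
have psi0 (x : R) : ~ (a <= x <= b + e) -> psi x = 0.
  move=> nx; have [xa|xa] := ltP x a.
    by rewrite /psi !sstep_le0 ?mulr0 ?addr0 //; lra.
  by rewrite /psi !sstep_ge ?mulr1 ?subrr //; lra.
have tpsi : test_function T psi.
  split; first by move=> k x; apply: smooth_derive1n.
  exists `[a, (b + e)]%classic; split; first exact: segment_compact.
    by move=> x; rewrite /= !in_itv /= => /andP[h1 h2]; lra.
  by move=> x nx; apply: psi0; move=> hx; apply: nx; rewrite /= in_itv.
have dpsi (x : R) : is_derive x 1 psi (derive1 psi x) := smooth_is_derive x (spsi 1%N).
have dsgn (x : R) : exists l1 l2, [/\ derive1 psi x = l1 - l2, 0 <= l1, 0 <= l2 &
    [/\ ~ (a <= x <= a + e) -> l1 = 0, ~ (b <= x <= b + e) -> l2 = 0 &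
       a < x < a + e -> 0 < l1]].
  have comp (y : R) : exists l, [/\ is_derive x 1 (fun r => sstep e (1 * r + - y)) l, 0 <= l,
      ~ (y <= x <= y + e) -> l = 0 & y < x < y + e -> 0 < l].
    have [l [dl l0 lp]] := sstep_derive (1 * x + - y) e0.
    have dl' := @is_derive1_comp R (sstep e) (fun r => 1 * r + - y) x _ _ dl
      (is_derive_affine 1 (- y) x).
    rewrite mulr1 in dl'.
    exists l; split=> // [nx|hx]; last by apply: lp; lra.
    have loc (k : R) : (\near x, k = sstep e (1 * x + - y)) -> l = 0.
      move=> near_k; have d0 := near_eq_is_derive near_k (is_derive_cst k x 1).
      by rewrite -(derive1_of dl') (derive1_of d0).
    have [xy|xy] := ltP x y.
      apply: (loc 0); near=> z; rewrite sstep_le0 //.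
      have : z < y by near: z; exact: lt_nbhsl.
      lra.
    have xy' : y + e < x by lra.
    apply: (loc 1); near=> z; rewrite sstep_ge //.
    have : y + e < z by near: z; exact: lt_nbhsr.
    lra.
  have [l1 [d1 l10 z1 p1]] := comp a; have [l2 [d2 l20 z2 p2]] := comp b.
  exists l1, l2; split=> //.
  have := is_derive_add d1 (is_derive_mul (is_derive_cst (-1 : R) x 1) d2).
  by move/derive1_of => ->; rewrite mul0r add0r mulN1r.
have cdpsi : continuous (derive1 psi).
  exact: derivable_continuous (@smooth_derive1n _ 1%N psi (spsi 2%N)).
have cpsi : continuous psi by move=> x; apply: is_derive_continuous (dpsi x).
have cg1 : continuous (fun x => derive1 psi x * u x).
  by move=> x; apply: continuousM; [exact: cdpsi|exact: cu].
have cg2 : continuous (fun x => psi x * f x).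
  by move=> x; apply: continuousM; [exact: cpsi|exact: cf].
have [G1 hG1] := primitive_exists T0 cg1.
have [G2 hG2] := primitive_exists T0 cg2.
have E := hpsi psi tpsi.
rewrite (primitive_integral T0 cg1 hG1) (primitive_integral T0 cg2 hG2) in E.
(* A primitive of [psi' * (h - c)]; the weak equation says that its values at 0 and [T] agree. Being
   monotone, it is constant. *)
pose H x := G1 x + G2 x - psi x * F x - c * psi x.
have dH (x : R) : -1 < x < T + 1 -> is_derive x 1 H (derive1 psi x * (h x - c)).
  move=> hx.
  have d1 := is_derive_add (hG1 x hx) (hG2 x hx).
  have d2 := is_derive_sub d1 (is_derive_mul (dpsi x) (hF x hx)).
  have d3 := is_derive_sub d2 (is_derive_mul (is_derive_cst c x 1) (dpsi x)).
  move: d3 => /is_derive_eq; apply; rewrite /h /=; ring.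
have H0T : H 0 = H T.
  by rewrite /H !psi0; [lra|lra|lra].
have dH_le (x : R) : 0 < x < T -> derive1 psi x * (h x - c) <= 0.
  move=> hx; have [l1 [l2 [-> l10 l20 [z1 z2 _]]]] := dsgn x.
  have [xa|nxa] := pselect (a <= x <= a + e).
    rewrite (z2 _); last by lra.
    rewrite subr0; apply: mulr_ge0_le0 => //; rewrite subr_le0; apply: ltW; apply: hra.
    by rewrite /ball /= distrC ger0_norm; lra.
  rewrite (z1 nxa) sub0r; have [xb|nxb] := pselect (b <= x <= b + e).
    apply: mulr_le0_ge0; first by rewrite oppr_le0.
    rewrite subr_ge0; apply: ltW; apply: hrb.
    by rewrite /ball /= distrC ger0_norm; lra.
  by rewrite (z2 nxb) oppr0 mul0r.
have cH (x : R) : -1 < x < T + 1 -> {for x, continuous H}.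
  by move=> /dH /is_derive_continuous.
have H_nincr x y : 0 <= x -> x <= y -> y <= T -> H y <= H x.
  move=> x0 xy yT; apply: derive_le0_le xy _ _ _ => z hz.
  - by apply: dH; lra.
  - by apply: dH_le; lra.
  - by apply: cH; lra.
have Hcst x : 0 <= x <= T -> H 0 = H x.
  move=> /andP[x0 xT]; apply/eqP; rewrite eq_le (H_nincr 0 x) // andbT H0T.
  exact: H_nincr.
(* In the middle of the first step [psi'] is positive and [h < c], which contradicts a constant
   [H]. *)
pose x0 := a + e / 2.
have x0T : 0 < x0 < T by rewrite /x0; lra.
have near_cst : \near x0, H 0 = H x0.
  near=> z; apply: Hcst.
  have : 0 < z by near: z; apply: lt_nbhsr; lra.
  have : z < T by near: z; apply: lt_nbhsl; lra.
  lra.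
have d0 := near_eq_is_derive near_cst (is_derive_cst (H 0) x0 1).
have d1 : is_derive x0 1 H (derive1 psi x0 * (h x0 - c)) by apply: dH; lra.
have := derive1_of d1; rewrite (derive1_of d0).
have [l1 [l2 [-> _ _ [_ z2 p1]]]] := dsgn x0.
rewrite (z2 _) ?subr0; last by rewrite /x0; lra.
have l1p : 0 < l1 by apply: p1; rewrite /x0; lra.
have hx0 : h x0 < c.
  by apply: hra; rewrite /ball /= distrC ger0_norm /x0; lra.
move/eqP; rewrite eq_sym mulf_eq0 => /orP[]/eqP; lra.
Unshelve. all: by end_near.
Qed.

(** Used for [u] and for its opposite, [weak_derivative] shows that [u] minus a primitive of [f] is
    constant on the open interval. *)
Lemma weak_is_derive T u f : 0 < T -> continuous u -> continuous f ->
  (forall psi, test_function T psi ->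
     - (\int[mu]_(x in `]0%R, T[) (derive1 psi x * u x))%R =
     (\int[mu]_(x in `]0%R, T[) (psi x * f x))%R) ->
  forall t : R, 0 < t < T -> is_derive t 1 u (f t).
Proof.
move=> T0 cu cf hpsi t ht.
have intN (g : R -> R) : continuous g ->
    (\int[mu]_(x in `]0%R, T[) (- g x))%R = - (\int[mu]_(x in `]0%R, T[) g x)%R.
  move=> cg; have [G hG] := primitive_exists T0 cg.
  have cNg : continuous (fun x => - g x) by move=> x; apply: continuousN; apply: cg.
  have hNG x : -1 < x < T + 1 -> is_derive x 1 (fun y => - G y) (- g x).
    by move=> hx; exact: (@is_deriveN _ _ _ G x 1 _ (hG x hx)).
  by rewrite (primitive_integral T0 cNg hNG) (primitive_integral T0 cg hG); ring.
have [F hF] := primitive_exists T0 cf.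
have cNu : continuous (fun x => - u x) by move=> x; apply: continuousN; apply: cu.
have cNf : continuous (fun x => - f x) by move=> x; apply: continuousN; apply: cf.
have hNF (x : R) : -1 < x < T + 1 -> is_derive x 1 (fun y => - F y) (- f x).
  by move=> hx; exact: (@is_deriveN _ _ _ F x 1 _ (hF x hx)).
have hNpsi psi : test_function T psi ->
     - (\int[mu]_(x in `]0%R, T[) (derive1 psi x * - u x))%R =
     (\int[mu]_(x in `]0%R, T[) (psi x * - f x))%R.
  move=> tpsi; have spsi := tpsi.1.
  have c1 : continuous (fun x => derive1 psi x * u x).
    by move=> x; apply: continuousM; [exact: (derivable_continuous (spsi 1%N))|exact: cu].
  have c2 : continuous (fun x => psi x * f x).
    by move=> x; apply: continuousM; [exact: (derivable_continuous (spsi 0%N))|exact: cf].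
  under eq_Rintegral => x _ do rewrite mulrN.
  under [RHS]eq_Rintegral => x _ do rewrite mulrN.
  by rewrite (intN _ c1) (intN _ c2) hpsi.
have le1 := weak_derivative T0 cu cf hpsi hF.
have le2 := weak_derivative T0 cNu cNf hNpsi hNF.
have eqs (a b : R) : 0 < a -> a < b -> b < T -> u a - F a = u b - F b.
  move=> a0 ab bT; have := le1 a b a0 ab bT; have := le2 a b a0 ab bT.
  move=> /negP; rewrite -leNgt => h1 /negP; rewrite -leNgt => h2.
  by apply/eqP; rewrite eq_le; apply/andP; split; lra.
have near_eq : \forall x \near t, F x + (u (t / 2) - F (t / 2)) = u x.
  near=> z.
  have z1 : t / 2 < z by near: z; apply: lt_nbhsr; lra.
  have z2 : z < T by near: z; apply: lt_nbhsl; lra.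
  by rewrite (eqs (t / 2) z) ?subrKC //; lra.
have htT : -1 < t < T + 1 by lra.
have := near_eq_is_derive near_eq
  (is_derive_add (hF t htT) (is_derive_cst (u (t / 2) - F (t / 2)) t 1)).
by rewrite addr0.
Unshelve. all: by end_near.
Qed.

End Distributions.

(** * Solutions as classical curves *)

Section Clamp.
Variables (R : realType) (T : R).
Hypothesis T0 : 0 <= T.
Implicit Types t : R.

(* Curves are extended beyond [0, T] by their end values, so as to be bounded
   and continuous on all of R. *)
Definition clamp t := Num.max 0 (Num.min t T).

Lemma clamp_itv t : 0 <= clamp t <= T.
Proof.
by rewrite /clamp le_max lexx /= ge_max T0 ge_min lexx orbT.
Qed.

Lemma clamp_id t : 0 <= t <= T -> clamp t = t.
Proof.
by move=> /andP[h1 h2]; rewrite /clamp (min_idPl h2) (max_idPr h1).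
Qed.

Lemma clamp_continuous : continuous clamp.
Proof.
move=> t; apply: (@continuous_max R R (fun=> 0) (fun x => Num.min x T)).
  exact: cst_continuous.
apply: (@continuous_min R R (fun x => x) (fun=> T)); last exact: cst_continuous.
exact: cvg_id.
Qed.

End Clamp.

Section Curves.
Variables (R : realType) (d : nat) (s : R).
Implicit Types (w : Zd d -> R[i]) (u : R -> Zd d -> R[i]).

Lemma l2_sub w w' : l2 d s w -> l2 d s w' -> l2 d s (w \- w').
Proof.
move=> /l2_ball_snorm h /l2_ball_snorm h'.
have [_ _ ED _ _] := l2_ball_norm d s; have hD := ED _ _ _ _ h h'.
have [_ r0 _] := hD.
apply: (proj1 ((l2_ballP s _ r0).2 _)); apply: l2_ball_le hD _ => n.
by rewrite cabs_ge0 /= cabsB.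
Qed.

Lemma l2_ball_add r r' w w' : l2_ball s r (fun n => cabs (w n)) ->
  l2_ball s r' (fun n => cabs (w' n - w n)) -> l2_ball s (r + r') (fun n => cabs (w' n)).
Proof.
move=> h h'; have [_ _ ED _ _] := l2_ball_norm d s.
apply: l2_ball_le (ED _ _ _ _ h h') _ => n; rewrite cabs_ge0 /=.
by rewrite addrC; have := cabsD (w' n - w n) (w n); rewrite subrK.
Qed.

Definition l2_continuous u := forall t0 h, 0 < h ->
  \forall t \near t0, l2_ball s h (fun n => cabs (u t n - u t0 n)).

Lemma CTl2_continuous T u : 0 <= T -> CTl2 T s u ->
  l2_continuous (fun t => u (clamp T t)).
Proof.
move=> T0 hu t0 h h0.
have ct0 := clamp_itv T0 t0; have [ut0 cv] := hu _ ct0.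
have /cvgrPdist_lt/(_ h h0) near1 := cv.
have : \forall t \near clamp T t0, 0 <= t <= T ->
    snorm (l2 d s) (u t \- u (clamp T t0)) < h.
  have near2 : nbhs (clamp T t0) (fun t => t \in `[0, T] ->
      `|0 - snorm (l2 d s) (u t \- u (clamp T t0))| < h) := near1.
  apply: filterS near2 => t near2 ht; have := near2 ht.
  by rewrite sub0r normrN ger0_norm // sqrtr_ge0.
move=> near2.
have near3 : nbhs t0 (fun t => 0 <= clamp T t <= T ->
    snorm (l2 d s) (u (clamp T t) \- u (clamp T t0)) < h).
  exact: (@clamp_continuous R T t0 _ near2).
apply: filterS near3 => t /(_ (clamp_itv T0 t)) lt_h.
have [_ _ _ _ Ele] := l2_ball_norm d s.
apply: Ele (ltW lt_h); apply: l2_ball_snorm; apply: l2_sub => //.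
by have [] := hu _ (clamp_itv T0 t).
Qed.

Lemma CTl2_bounded T u : 0 <= T -> CTl2 T s u -> exists B, 0 <= B /\
  forall t, 0 <= t <= T -> snorm (l2 d s) (u t) <= B.
Proof.
move=> T0 hu; pose N t := snorm (l2 d s) (u (clamp T t)).
have ul t : l2 d s (u (clamp T t)) by have [] := hu _ (clamp_itv T0 t).
have tri t t' r : l2_ball s r (fun n => cabs (u (clamp T t) n - u (clamp T t') n)) ->
    N t <= N t' + r.
  move=> h; have := l2_ball_add (l2_ball_snorm (ul t')) h => h1.
  by have [_ r0 _] := h1; apply: (proj2 ((l2_ballP s _ r0).2 h1)).
have cN : continuous N.
  move=> t0; apply/cvgrPdist_le => e e0.
  apply: filterS (CTl2_continuous T0 hu t0 e0) => t h.
  have h' : l2_ball s e (fun n => cabs (u (clamp T t0) n - u (clamp T t) n)).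
    by apply: l2_ball_le h _ => n; rewrite cabs_ge0 cabs_distC lexx.
  by have := tri _ _ _ h; have := tri _ _ _ h'; rewrite ler_norml; lra.
have [c _ hc] := EVT_max T0 (continuous_subspaceT cN).
exists (N c); split; first exact: sqrtr_ge0.
move=> t ht; have := hc t ht; by rewrite /N clamp_id.
Qed.

Lemma l2_continuous_ccont u n : l2_continuous u -> ccont (fun t => u t n).
Proof.
move=> hu.
have key t0 e : 0 < e -> \forall t \near t0, cabs (u t n - u t0 n) <= e.
  move=> e0; pose b := bracketZ R n `^ s.
  have b0 : 0 < b by rewrite powR_gt0 // bracketZ_gt0.
  apply: filterS (hu t0 _ (mulr_gt0 b0 e0)) => t /(@l2_ball_point _ _ _ _ _ n).
  by rewrite ler_pM2l.
split=> t0; apply/cvgrPdist_le => e e0; apply: filterS (key t0 e e0) => t ht.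
  by rewrite distrC -ReN -ReD; apply: le_trans (cabs_Re _) ht.
by rewrite distrC -ImN -ImD; apply: le_trans (cabs_Im _) ht.
Qed.

Lemma ccont_approx (f : R -> R[i]) : (forall e, 0 < e -> exists h, ccont h /\
  forall t, cabs (f t - h t) <= e) -> ccont f.
Proof.
move=> hf.
have key (pr : R[i] -> R) : (forall x, `|pr x| <= cabs x) ->
    (forall x y, pr (x - y) = pr x - pr y) ->
    (forall h, ccont h -> continuous (fun t => pr (h t))) ->
    continuous (fun t => pr (f t)).
  move=> pr1 pr2 pr3 t0; apply/cvgrPdist_le => e e0.
  have e3 : 0 < e / 3 by rewrite divr_gt0.
  have [h [hc hfh]] := hf _ e3.
  have /cvgrPdist_le/(_ _ e3) := pr3 h hc t0; apply: filterS => t.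
  have := le_trans (pr1 _) (hfh t); have := le_trans (pr1 _) (hfh t0).
  rewrite !pr2 !ler_norml; lra.
split; apply: key => [x|x y|h []//].
- exact: cabs_Re.
- by rewrite ReD ReN.
- exact: cabs_Im.
- by rewrite ImD ImN.
Qed.

End Curves.

(** * Differences of products along two sequences *)

Section ProductDifferences.
Variables (I : eqType) (R : realType).
Implicit Types (sg : seq I) (y dd u : I -> R) (a b : I -> R[i]).

(* The left side gathers the terms with at least one factor dd. *)
Lemma lprod_perturb y dd (la : R) sg : (forall n, 0 <= y n) -> (forall n, 0 <= dd n) -> 1 <= la ->
  la * (lprod (fun n => y n + dd n) sg - lprod y sg) <=
  lprod (fun n => y n + la * dd n) sg - lprod y sg.
Proof.
move=> y0 d0 la1; have la0 : 0 <= la by lra.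
elim: sg => [|n sg IH]; first by rewrite !lprod_nil; lra.
rewrite !lprod_cons.
have le1 : lprod (fun n => y n + dd n) sg <= lprod (fun n => y n + la * dd n) sg.
  apply: le_lprod => i; first by rewrite addr_ge0.
  by rewrite lerD2l ler_peMl.
have h1 := ler_wpM2l (y0 n) IH.
have h2 := ler_wpM2l (mulr_ge0 la0 (d0 n)) le1.
lra.
Qed.

Lemma cabs_lprod a sg : cabs (lprod a sg) = lprod (fun n => cabs (a n)) sg.
Proof. exact: cabs_prod. Qed.

Lemma cabs_ldiff a b sg :
  cabs (ldiff a b sg) <= ldiff (fun n => cabs (a n)) (fun n => cabs (b n)) sg.
Proof.
elim: sg => [|n sg IH]; first by rewrite (_ : ldiff a b [::] = 0) // cabs0.
rewrite /=; apply: le_trans (cabsD _ _) _; rewrite !cabsM cabs_lprod lerD2l.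
by rewrite ler_wpM2l // cabs_ge0.
Qed.

Section Differences.
Variables (a a' b b' : I -> R[i]) (u dd : I -> R) (la : R).
Hypotheses (au : forall n, cabs (a n) <= u n) (a'u : forall n, cabs (a' n) <= u n).
Hypotheses (bu : forall n, cabs (b n) <= u n) (b'u : forall n, cabs (b' n) <= u n).
Hypotheses (ad : forall n, cabs (a n - a' n) <= dd n)
  (bd : forall n, cabs (b n - b' n) <= dd n) (la0 : 0 < la).

Let u0 n : 0 <= u n. Proof. exact: le_trans (cabs_ge0 _) (au n). Qed.
Let dd0 n : 0 <= dd n. Proof. exact: le_trans (cabs_ge0 _) (ad n). Qed.
Let y n := u n + la * dd n.
Let y0 n : 0 <= y n. Proof. by rewrite addr_ge0 ?mulr_ge0 // ltW. Qed.
Let uy n : u n <= y n. Proof. by rewrite lerDl mulr_ge0 // ltW. Qed.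

Let cabs_lprod_le c sg : (forall n, cabs (c n) <= u n) -> cabs (lprod c sg) <= lprod y sg.
Proof.
move=> cu; rewrite cabs_lprod; apply: le_lprod => n; first exact: cabs_ge0.
exact: le_trans (cu n) (uy n).
Qed.

Let mixed (x x' z z' : R[i]) (q S e e' : R) : cabs (x - x') <= q -> cabs z <= S ->
  cabs x' <= e' -> cabs (z - z') <= e -> cabs (x * z - x' * z') <= q * S + e' * e.
Proof.
have -> : x * z - x' * z' = (x - x') * z + x' * (z - z') by ring.
move=> h1 h2 h3 h4; apply: le_trans (cabsD _ _) _; rewrite !cabsM.
by apply: lerD; apply: ler_pM; rewrite ?cabs_ge0.
Qed.

(** Replacing one factor at a time, the recursion closes with equality since
    [dd + la^-1 * u = la^-1 * y]. With [la] the inverse of the size of the gap, [y] stays in a fixed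
    ball. *)
Lemma lprod_diff sg : cabs (lprod a sg - lprod a' sg) <= la^-1 * lprod y sg.
Proof.
elim: sg => [|n sg IH].
  by rewrite !lprod_nil subrr cabs0 mulr1 invr_ge0 ltW.
rewrite !lprod_cons.
apply: le_trans (mixed (ad n) (cabs_lprod_le sg au) (a'u n) IH) _.
by apply: ler_eq; rewrite /y; field; rewrite gt_eqF.
Qed.

Lemma ldiff_diff sg : cabs (ldiff a b sg - ldiff a' b' sg) <=
  la^-1 * ((size sg)%:R * lprod y sg).
Proof.
elim: sg => [|n sg IH].
  by rewrite (_ : ldiff a b [::] = 0) // subrr cabs0 mul0r mulr0.
have hL : cabs (ldiff a b sg) <= (size sg)%:R * lprod y sg.
  apply: le_trans (cabs_ldiff _ _ _) _; rewrite -ldiff_diag.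
  apply: le_ldiff2 => i; rewrite ?cabs_ge0 //; exact: le_trans (uy i).
have h1 := mixed (bd n) (cabs_lprod_le sg au) (b'u n) (lprod_diff sg).
have h2 := mixed (ad n) hL (a'u n) IH.
rewrite /= opprD addrACA; apply: le_trans (cabsD _ _) _.
apply: le_trans (lerD h1 h2) _; rewrite lprod_cons -natr1.
by apply: ler_eq; rewrite /y; field; rewrite gt_eqF.
Qed.

End Differences.
End ProductDifferences.

Section Tails.
Variables (R : realType) (d p : nat) (s : R).
Variables (a : tuples d p -> R) (D : set (tuples d p)) (c : R).
Hypotheses (a0 : forall k, 0 <= a k) (c0 : 0 <= c).
Hypothesis hc : forall r y, l2_ball s r y -> forall t, uniq t ->
  (forall k, k \in t -> D k) -> \sum_(k <- t) a k * lprod y (children k) <= c * r ^+ p.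

(** At a fixed time the tail is small by summability. At nearby times, [lprod_perturb] with a large
    [la] bounds the change by [la^-1] times a bounded sum, and compactness makes the rank
    uniform. *)
Lemma uniform_tails (u : R -> Zd d -> R[i]) (B : R) (A : set R) :
  (forall t, l2_ball s B (fun n => cabs (u t n))) -> l2_continuous s u -> compact A ->
  forall eta, 0 < eta -> exists N0 : nat, forall N t r, (N0 <= N)%N -> A t -> uniq r ->
    (forall k : tuples d p, k \in r -> D k /\ (N <= choice.pickle k)%N) ->
    \sum_(k <- r) a k * cabs (lprod (u t) (children k)) <= eta.
Proof.
move=> uB uc cA eta eta0.
pose tail (N : nat) (t : R) := forall r : seq (tuples d p), uniq r ->
    (forall k, k \in r -> D k /\ (N <= choice.pickle k)%N) ->
    \sum_(k <- r) a k * cabs (lprod (u t) (children k)) <= eta.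
suff : \forall N \near \oo, A `<=` tail N.
  move=> [N0 _ hN0]; exists N0 => N t r N0N At.
  by apply: (hN0 N N0N t At).
move/compact_near_coveringP: cA; apply => t0 _.
have B0 : 0 <= B by case: (uB t0).
pose y n := cabs (u t0 n); have y0 n : 0 <= y n by apply: cabs_ge0.
pose f k := a k * lprod y (children k).
have f0 k : 0 <= f k by rewrite mulr_ge0 ?lprod_ge0.
have ffin : (\esum_(k in D) (f k)%:E < +oo)%E.
  apply: le_lt_trans (ltry (c * B ^+ p)); apply: esum_le_seq => // r ur rD.
  by apply: hc => //; apply: uB.
have eta2 : 0 < eta / 2 by rewrite divr_gt0.
have [r0 [ur0 r0D hr0]] := esum_approx f0 ffin eta2.
pose N0 := (\max_(k <- r0) choice.pickle k).+1.
have tail0 r : uniq r -> (forall k, k \in r -> D k /\ (N0 <= choice.pickle k)%N) ->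
    \sum_(k <- r) f k <= eta / 2.
  move=> ur hr.
  have : \sum_(k <- r0 ++ r) f k <= fine (\esum_(k in D) (f k)%:E).
    apply: esum_fin_ge => //.
      rewrite cat_uniq ur0 ur andbT /=; apply/hasPn => k /hr[_ kN].
      apply/negP => kr0; move: kN; rewrite leqNgt ltnS => /negP; apply.
      exact: leq_bigmax_seq.
    by move=> k; rewrite mem_cat => /orP[/r0D|/hr[]].
  by rewrite big_cat /=; lra.
pose la := 1 + c * (B + 1) ^+ p * 2 / eta.
have cB0 : 0 <= c * (B + 1) ^+ p by rewrite mulr_ge0 // exprn_ge0 // addr_ge0.
have la1 : 1 <= la by rewrite lerDl divr_ge0 ?(ltW eta0) // mulr_ge0.
have la0 : 0 < la by lra.
have hla : c * (B + 1) ^+ p <= la * (eta / 2).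
  have -> : la * (eta / 2) = eta / 2 + c * (B + 1) ^+ p.
    by rewrite /la; field; rewrite gt_eqF.
  by rewrite lerDr ltW.
have lai0 : 0 < la^-1 by rewrite invr_gt0.
have near1 := uc t0 _ lai0.
near=> t N.
have hdd : l2_ball s la^-1 (fun n => cabs (u t n - u t0 n)).
  by near: t; exact: near1.
have hN : (N0 <= N)%N by near: N; exists N0.
move=> r ur hr; pose dd n := cabs (u t n - u t0 n).
have dd0 n : 0 <= dd n by apply: cabs_ge0.
have bnd k : a k * cabs (lprod (u t) (children k)) <= f k +
   la^-1 * (a k * lprod (fun n => y n + la * dd n) (children k)).
  have h1 : cabs (lprod (u t) (children k)) <= lprod (fun n => y n + dd n) (children k).
    rewrite cabs_lprod; apply: le_lprod => n; first exact: cabs_ge0.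
    by rewrite addrC; have := cabsD (u t n - u t0 n) (u t0 n); rewrite subrK.
  have h2 := lprod_perturb (children k) y0 dd0 la1.
  have h3 := lprod_ge0 (children k) y0.
  have h4 : lprod (fun n => y n + dd n) (children k) <= lprod y (children k) +
      la^-1 * lprod (fun n => y n + la * dd n) (children k).
    rewrite -lerBlDl ler_pdivlMl //; lra.
  have := ler_wpM2l (a0 k) (le_trans h1 h4); rewrite /f mulrDr mulrCA; lra.
apply: le_trans (ler_sum _ (fun k _ => bnd k)) _; rewrite big_split /= -mulr_sumr.
have h1 : \sum_(k <- r) f k <= eta / 2.
  by apply: tail0 => // k /hr[kD kN]; split=> //; apply: leq_trans kN.
have yla : l2_ball s (B + 1) (fun n => y n + la * dd n).
  have [_ _ ED EZ _] := l2_ball_norm d s.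
  have := ED _ _ _ _ (uB t0) (EZ _ _ _ (ltW la0) hdd).
  by rewrite divff // gt_eqF.
have h2 := hc yla ur (fun k kr => (hr k kr).1).
have h3 : la^-1 * \sum_(k <- r) a k * lprod (fun n => y n + la * dd n) (children k) <= eta / 2.
  by rewrite ler_pdivrMl //; apply: le_trans h2 hla.
lra.
Unshelve. all: by end_near.
Qed.

End Tails.

(** * Classical equation for each frequency *)

Section SolutionCurves.
Variables (R : realType) (d p : nat) (s T : R).
Variables (phi : Zd d -> tuples d p -> R) (m : Zd d -> tuples d p -> R[i]).
Hypothesis T0 : 0 < T.
Implicit Types (n : Zd d) (N : nat) (t eta : R).
Hypothesis hm : forall n, exists c : R, 0 <= c /\ forall r y, l2_ball s r y ->
  forall t : seq (tuples d p), finite_decomp n t ->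
  \sum_(k <- t) cabs (m n k) * lprod y (children k) <= c * r ^+ p.

Definition trunc (n : Zd d) (N : nat) : seq (tuples d p) :=
  [seq k : tuples d p <- undup (pmap (@choice.unpickle {ffun 'I_p -> Zd d}) (iota 0 N)) |
    n == \sum_(j < p) k j].

Lemma trunc_finite n N : finite_decomp n (trunc n N).
Proof.
split; first by rewrite filter_uniq // undup_uniq.
by move=> k; rewrite mem_filter => /andP[/eqP].
Qed.

Lemma mem_trunc n N (k : tuples d p) : decomp n k -> (choice.pickle k < N)%N ->
  k \in trunc n N.
Proof.
move=> kn kN; rewrite mem_filter mem_undup; apply/andP; split; first exact/eqP.
by rewrite mem_pmap -(choice.pickleK k) map_f // mem_iota.
Qed.

Variables (Rem : (R -> Zd d -> R[i]) -> (R -> Zd d -> R[i])).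
Variables (w0 : Zd d -> R[i]) (w : R -> Zd d -> R[i]).
Hypothesis (sol : solution T s phi m Rem w0 w) (hRw : CTl2 T s (Rem w)).

Let u t := w (clamp T t).
Let ru t := Rem w (clamp T t).

(** The right-hand side along the clamped curve: it agrees with [rhs] inside the time interval and
    is continuous on all of R. *)
Definition field (n : Zd d) (t : R) : R[i] :=
  multisum (@decomp d p) (fun n k => expi (t * phi n k) * m n k) (fun=> u t) n + ru t n.

Let T0' := ltW T0.
Let uc : l2_continuous s u. Proof. by case: sol => h *; apply: CTl2_continuous. Qed.

Lemma curve_ccont n : ccont (fun t => u t n).
Proof. exact: l2_continuous_ccont uc. Qed.

Lemma field_approx n eta : 0 < eta -> exists N0 : nat, forall N, (N0 <= N)%N -> forall t,
  cabs (field n t - ru t n - \sum_(k <- trunc n N)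
     expi (t * phi n k) * m n k * lprod (u t) (children k)) <= eta.
Proof.
move=> eta0; have eta2 : 0 < eta / 2 by rewrite divr_gt0.
have [c [c0 hc]] := hm n.
have [B [B0 hB]] : exists B, 0 <= B /\ forall t, 0 <= t <= T -> snorm (l2 d s) (w t) <= B.
  by case: sol => h *; apply: CTl2_bounded T0' h.
have uB t : l2_ball s B (fun n => cabs (u t n)).
  apply/l2_ballP => //; split; last exact/hB/clamp_itv.
  by case: sol => /(_ _ (clamp_itv T0' t))[].
have [N0 hN0] := uniform_tails (fun k => cabs_ge0 (m n k)) c0
  (fun r y yB q uq qD => hc r y yB q (conj uq qD)) uB uc
  (@segment_compact R 0 T) eta2.
exists N0 => N N0N t.
rewrite /field /multisum addrK.
have -> : eta = 2 * (eta / 2) by rewrite mulrCA divff ?mulr1.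
rewrite (eq_bigr (mterm (fun n k => expi (t * phi n k) * m n k) (fun=> u t) n)); last first.
  by move=> k _; rewrite lprod_children.
apply: csum_close => [||//|r ur hr].
- exact: (trunc_finite n N).1.
- exact: (trunc_finite n N).2.
- exact: ltW.
have := hN0 N (clamp T t) r N0N (clamp_itv T0' t) ur.
rewrite /u clamp_id ?clamp_itv // -/(u t) => h.
rewrite (eq_bigr (fun k => cabs (m n k) * cabs (lprod (u t) (children k)))).
  apply: h => k /hr[kn kN]; split=> //.
  by rewrite leqNgt; apply/negP => kN'; move: kN; rewrite mem_trunc.
by move=> k _; rewrite /mterm lprod_children !cabsM cabs_expi mul1r.
Qed.

Lemma field_ccont n : ccont (field n).
Proof.
apply: ccont_approx => e e0; have [N0 hN0] := field_approx n e0.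
exists (fun t => ru t n + \sum_(k <- trunc n N0)
   expi (t * phi n k) * m n k * lprod (u t) (children k)); split; last first.
  by move=> t; rewrite opprD addrA; apply: hN0.
apply: ccontD; first exact: l2_continuous_ccont (CTl2_continuous T0' hRw).
apply: ccont_sum => k; apply: ccontM.
  by apply: ccontM; [exact: ccont_expi|exact: ccont_cst].
exact: ccont_lprod curve_ccont.
Qed.

Lemma curve_cderiv n t : 0 < t < T -> cderiv (fun r => u r n) t (field n t).
Proof.
have inT r : `]0, T[%classic r -> clamp T r = r.
  by rewrite /= in_itv /= => /andP[h1 h2]; rewrite clamp_id // !ltW.
have fE r : `]0, T[%classic r -> rhs phi m Rem w n r = field n r.
  by move=> hr; rewrite /field /u /ru inT.
case: sol => _ _ hd _; have [uc1 uc2] := curve_ccont n; have [fc1 fc2] := field_ccont n.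
have ImM_real (a : R) (z : R[i]) : complex.Im (a%:C * z) = a * complex.Im z.
  by case: z => x y /=; rewrite mul0r addr0.
have weak (pr : R[i] -> R) : (forall (a : R) z, pr (a%:C * z) = a * pr z) ->
    (forall psi, test_function T psi ->
     - (\int[lebesgue_measure]_(x in `]0%R, T[) pr ((derive1 psi x)%:C * w x n))%R =
       (\int[lebesgue_measure]_(x in `]0%R, T[) pr ((psi x)%:C * rhs phi m Rem w n x))%R) ->
    forall psi, test_function T psi ->
     - (\int[lebesgue_measure]_(x in `]0%R, T[) (derive1 psi x * pr (u x n)))%R =
       (\int[lebesgue_measure]_(x in `]0%R, T[) (psi x * pr (field n x)))%R.
  move=> prM h psi tpsi; transitivity (- (\int[lebesgue_measure]_(x in `]0%R, T[)
      pr ((derive1 psi x)%:C * w x n))%R); last rewrite h //.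
    by congr (- _); apply: eq_Rintegral => x /set_mem hx; rewrite prM /u inT.
  by apply: eq_Rintegral => x /set_mem hx; rewrite prM fE.
move=> ht; split.
  apply: (weak_is_derive T0 uc1 fc1 (weak _ (@ReM_real R) _) ht) => psi.
  by move=> /(hd n psi) /(congr1 (@complex.Re R)); rewrite ReN.
apply: (weak_is_derive T0 uc2 fc2 (weak _ ImM_real _) ht) => psi.
by move=> /(hd n psi) /(congr1 (@complex.Im R)); rewrite ImN.
Qed.

End SolutionCurves.

Section Remainder.
Variables (R : realType) (d : nat) (T s : R) (Rem : (R -> Zd d -> R[i]) -> (R -> Zd d -> R[i])).
Hypothesis T0 : 0 <= T.

Lemma CTl2_norm_ge (u : R -> Zd d -> R[i]) (B t : R) :
  (forall t, 0 <= t <= T -> snorm (l2 d s) (u t) <= B) -> 0 <= t <= T ->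
  snorm (l2 d s) (u t) <= CTl2_norm T s u.
Proof.
move=> hB ht; apply: ub_le_sup; last by exists t.
by exists B => _ [r hr <-]; apply: hB.
Qed.

Lemma CTl2_cst (z : Zd d -> R[i]) : l2 d s z ->
  CTl2 T s (fun=> z) /\ CTl2_norm T s (fun=> z) = snorm (l2 d s) z.
Proof.
move=> zl; split.
  move=> t ht; split=> //; rewrite (_ : (fun=> _) = fun=> 0); first exact: cvg_cst.
  apply/funext => _; apply/eqP; rewrite eq_le sqrtr_ge0 andbT.
  apply: (proj2 ((l2_ballP s _ (lexx 0)).2 _)).
  have [_ E0 _ _ _] := l2_ball_norm d s.
  by apply: l2_ball_le E0 _ => n /=; rewrite subrr cabs0 lexx.
rewrite /CTl2_norm (_ : [set _ | _ in _] = [set snorm (l2 d s) z]) ?sup1 //.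
apply/seteqP; split=> [_ [t _ <-]//|_ ->]; exists 0 => //=.
by rewrite in_itv /= lexx T0.
Qed.

(* Since Rem acts pointwise in time, its Lipschitz bound may be tested on
   curves frozen at time t. *)
Lemma remainder_lipschitz w w' : admissible_remainder T s Rem ->
  CTl2 T s w -> CTl2 T s w' -> exists C, 0 <= C /\
  forall t, 0 <= t <= T -> snorm (l2 d s) (Rem w t \- Rem w' t) <=
    C * snorm (l2 d s) (w t \- w' t).
Proof.
move=> [R1 R2 _ [C [Cmon hC]]] hw hw'.
have [B [B0 hB]] := CTl2_bounded T0 hw; have [B' [B'0 hB']] := CTl2_bounded T0 hw'.
exists (Num.max 0 (C B B')); split; first by rewrite le_max lexx.
move=> t ht; have [wl _] := hw _ ht; have [w'l _] := hw' _ ht.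
have [z z1] := CTl2_cst wl; have [z' z'1] := CTl2_cst w'l.
have -> : Rem w t = Rem (fun=> w t) t by apply: R2.
have -> : Rem w' t = Rem (fun=> w' t) t by apply: R2.
have [D [D0 hD]] := CTl2_bounded T0 (R1 _ z).
have [D' [D'0 hD']] := CTl2_bounded T0 (R1 _ z').
have hsub r : 0 <= r <= T ->
    snorm (l2 d s) (Rem (fun=> w t) r \- Rem (fun=> w' t) r) <= D + D'.
  move=> hr; have [l1 _] := R1 _ z _ hr; have [l2 _] := R1 _ z' _ hr.
  have DD0 : 0 <= D + D' by rewrite addr_ge0.
  apply: (proj2 ((l2_ballP s _ DD0).2 _)).
  have [_ _ ED _ Ele] := l2_ball_norm d s.
  apply: l2_ball_le (ED _ _ _ _ (Ele _ _ _ (l2_ball_snorm l1) (hD r hr))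
    (Ele _ _ _ (l2_ball_snorm l2) (hD' r hr))) _ => n.
  by rewrite cabs_ge0 /= cabsB.
apply: le_trans (CTl2_norm_ge hsub ht) _; apply: le_trans (hC _ _ z z') _.
have [_ ->] := CTl2_cst (l2_sub wl w'l); rewrite z1 z'1.
apply: ler_wpM2r; first exact: sqrtr_ge0.
rewrite le_max; apply/orP; right; apply: Cmon.
  by rewrite hB // sqrtr_ge0.
by rewrite hB' // sqrtr_ge0.
Qed.

End Remainder.

(** * Products along two solutions and their time derivatives *)

Section Difference.
Variables (R : realType) (d p : nat) (s T : R).
Variables (phi : Zd d -> tuples d p -> R) (m : Zd d -> tuples d p -> R[i]).
Variables (u u' r r' : R -> Zd d -> R[i]) (f f' : Zd d -> R -> R[i]) (B : R).
Implicit Types (n : Zd d) (t : R) (sg : seq (Zd d)).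
Hypotheses (uB : forall t, l2_ball s B (fun n => cabs (u t n)))
  (u'B : forall t, l2_ball s B (fun n => cabs (u' t n))).
Hypotheses (uc : forall n, ccont (fun t => u t n)) (u'c : forall n, ccont (fun t => u' t n)).
Hypotheses (ud : forall n t, 0 < t < T -> cderiv (fun t => u t n) t (f n t))
  (u'd : forall n t, 0 < t < T -> cderiv (fun t => u' t n) t (f' n t)).
Hypothesis uu'0 : u 0 = u' 0.

Definition approx_field (v q : R -> Zd d -> R[i]) (h : Zd d -> R -> R[i]) :=
  forall n (eta : R), 0 < eta -> exists N0 : nat, forall N, (N0 <= N)%N -> forall t,
  cabs (h n t - q t n - \sum_(k <- trunc p n N)
     expi (t * phi n k) * m n k * lprod (v t) (children k)) <= eta.

Hypotheses (fA : approx_field u r f) (f'A : approx_field u' r' f').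
Variable (g : R -> R).
Hypothesis g0 : forall t, 0 < g t.

Definition diff_prod sg t : R[i] := lprod (u t) sg - lprod (u' t) sg.

Definition diff_prod_deriv sg t : R[i] :=
  ldiff (u t) (f^~ t) sg - ldiff (u' t) (f'^~ t) sg.

Definition diff_scale t n : R :=
  cabs (u t n) + cabs (u' t n) + cabs (r t n) + cabs (r' t n) +
  (g t)^-1 * (cabs (u t n - u' t n) + cabs (r t n - r' t n)).

Lemma diff_scale_ge0 t n : 0 <= diff_scale t n.
Proof. by rewrite /diff_scale !addr_ge0 ?mulr_ge0 ?addr_ge0 ?cabs_ge0 // invr_ge0 ltW. Qed.

Lemma diff_prod_ccont sg : ccont (diff_prod sg).
Proof.
by apply: ccontB; apply: ccont_lprod.
Qed.

Lemma diff_prod0 sg : diff_prod sg 0 = 0.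
Proof. by rewrite /diff_prod uu'0 subrr. Qed.

Lemma diff_prod_cderiv sg t : 0 < t < T ->
  cderiv (diff_prod sg) t (diff_prod_deriv sg t).
Proof.
move=> ht.
have c (v : R -> Zd d -> R[i]) (h : Zd d -> R -> R[i]) :
    (forall n, cderiv (fun t => v t n) t (h n t)) ->
    cderiv (fun t => lprod (v t) sg) t (ldiff (v t) (h^~ t) sg).
  move=> hv; elim: sg => [|n sg' IH].
    under eq_fun => x do rewrite lprod_nil; exact: cderiv_cst.
  under eq_fun => x do rewrite lprod_cons; exact: cderivM.
by apply: cderivB; apply: c => n; [apply: ud|apply: u'd].
Qed.

Let amp t n := cabs (u t n) + cabs (u' t n) + cabs (r t n) + cabs (r' t n).
Let gap t n := cabs (u t n - u' t n) + cabs (r t n - r' t n).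

Lemma diff_prod_le sg t : cabs (diff_prod sg t) <= g t * lprod (diff_scale t) sg.
Proof.
have gi : 0 < (g t)^-1 by rewrite invr_gt0.
have := @lprod_diff _ _ (u t) (u' t) (amp t) (gap t) _ _ _ _ gi sg.
rewrite invrK; apply=> n; rewrite /amp /gap;
  have := cabs_ge0 (u t n); have := cabs_ge0 (u' t n); have := cabs_ge0 (r t n);
  have := cabs_ge0 (r' t n); have := cabs_ge0 (r t n - r' t n); lra.
Qed.

Lemma diff_prod_expand sg eta : 0 < eta -> exists D : Zd d -> seq (tuples d p),
  (forall n, finite_decomp n (D n)) /\ forall t, 0 < t < T ->
  cabs (diff_prod_deriv sg t - \sum_(v <- moves D sg)
    expi (t * phi v.1.1 v.1.2) * m v.1.1 v.1.2 * diff_prod v.2 t) <=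
  g t * ((size sg)%:R * lprod (diff_scale t) sg) + eta.
Proof.
move=> eta0; have B0 : 0 <= B by case: (uB 0).
pose bnd n := B / bracketZ R n `^ s.
have b0 n : 0 < bracketZ R n `^ s by rewrite powR_gt0 // bracketZ_gt0.
have bnd0 n : 0 <= bnd n by rewrite divr_ge0 // ltW.
have hbnd (v : R -> Zd d -> R[i]) t n : (forall t, l2_ball s B (fun n => cabs (v t n))) ->
    cabs (v t n) <= bnd n.
  by move=> hv; rewrite ler_pdivlMr // mulrC; apply: l2_ball_point (hv t).
(* An error at most [e] in every component of the field changes the derivative of the product by at
   most [e * M], uniformly in time; this occurs once for each solution. *)
pose M := ldiff bnd (fun=> 1) sg; have M0 : 0 <= M by apply: ldiff_ge0.
pose e := eta / (2 * M + 1); have e0 : 0 < e by rewrite divr_gt0 // ltr_wpDl // mulr_ge0.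
have heM : 2 * (e * M) <= eta.
  have : e * (2 * M + 1) = eta by rewrite /e divfK // gt_eqF // ltr_wpDl // mulr_ge0.
  lra.
have /choice[D hD] : forall n, exists D : seq (tuples d p), finite_decomp n D /\ forall t,
    cabs (f n t - r t n - \sum_(k <- D)
      expi (t * phi n k) * m n k * lprod (u t) (children k)) <= e /\
    cabs (f' n t - r' t n - \sum_(k <- D)
      expi (t * phi n k) * m n k * lprod (u' t) (children k)) <= e.
  move=> n; have [N1 h1] := fA n e0; have [N2 h2] := f'A n e0.
  exists (trunc p n (maxn N1 N2)); split; first exact: trunc_finite.
  by move=> t; split; [apply: h1; rewrite leq_maxl|apply: h2; rewrite leq_maxr].
exists D; split=> [n|t ht]; first exact: (hD n).1.
pose Ke n (k : tuples d p) := expi (t * phi n k) * m n k.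
pose par (v : R -> Zd d -> R[i]) n := \sum_(k <- D n) Ke n k * lprod (v t) (children k).
pose tl (v q : R -> Zd d -> R[i]) (h : Zd d -> R -> R[i]) n := h n t - q t n - par v n.
(* The truncated sums yield the moves, the remainder yields the size term, and the tails yield
   [eta]. *)
have split_field (v q : R -> Zd d -> R[i]) (h : Zd d -> R -> R[i]) :
    ldiff (v t) (h^~ t) sg = ldiff (v t) (par v) sg +
      ldiff (v t) (q t) sg + ldiff (v t) (tl v q h) sg.
  rewrite -!ldiffD; congr (ldiff _ _ sg); apply/funext => n; rewrite /tl; ring.
have tail_le (v q : R -> Zd d -> R[i]) (h : Zd d -> R -> R[i]) :
    (forall t, l2_ball s B (fun n => cabs (v t n))) ->
    (forall n, cabs (tl v q h n) <= e) -> cabs (ldiff (v t) (tl v q h) sg) <= e * M.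
  move=> hv ht'; apply: le_trans (cabs_ldiff _ _ _) _.
  apply: le_trans (_ : ldiff bnd (fun=> e * 1) sg <= _).
    by apply: le_ldiff2 => n; rewrite ?cabs_ge0 ?mulr1 ?hbnd.
  rewrite /M; apply: ler_eq.
  by elim: (sg) => [|n l /= ->]; rewrite /= ?mulr0 //; ring.
have h1 := tail_le u r f uB (fun n => ((hD n).2 t).1).
have h2 := tail_le u' r' f' u'B (fun n => ((hD n).2 t).2).
have -> : \sum_(v <- moves D sg) expi (t * phi v.1.1 v.1.2) * m v.1.1 v.1.2 * diff_prod v.2 t =
    ldiff (u t) (par u) sg - ldiff (u' t) (par u') sg.
  rewrite -!(sum_moves_lprod D Ke) -sumrB; apply: eq_bigr => v _.
  by rewrite /diff_prod mulrBr.
have gi : 0 < (g t)^-1 by rewrite invr_gt0.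
have h3 : cabs (ldiff (u t) (r t) sg - ldiff (u' t) (r' t) sg) <=
    g t * ((size sg)%:R * lprod (diff_scale t) sg).
  have := @ldiff_diff _ _ (u t) (u' t) (r t) (r' t) (amp t) (gap t) _ _ _ _ _ _ _ gi sg.
  rewrite invrK; apply=> n; rewrite /amp /gap;
    have := cabs_ge0 (u t n); have := cabs_ge0 (u' t n); have := cabs_ge0 (r t n);
    have := cabs_ge0 (r' t n); have := cabs_ge0 (r t n - r' t n);
    have := cabs_ge0 (u t n - u' t n); lra.
rewrite /diff_prod_deriv (split_field u r f) (split_field u' r' f').
have -> (x1 x2 x3 y1 y2 y3 : R[i]) : x1 + x2 + x3 - (y1 + y2 + y3) - (x1 - y1) =
    (x2 - y2) + (x3 - y3) by ring.
have := cabsD (ldiff (u t) (r t) sg - ldiff (u' t) (r' t) sg)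
  (ldiff (u t) (tl u r f) sg - ldiff (u' t) (tl u' r' f') sg).
have := cabsB (ldiff (u t) (tl u r f) sg) (ldiff (u' t) (tl u' r' f') sg).
lra.
Qed.

End Difference.

(** * Uniqueness *)

Section Halving.
Variables (R : realType) (d p : nat) (s T : R).
Variables (phi : Zd d -> tuples d p -> R) (m : Zd d -> tuples d p -> R[i]).
Variables (u u' r r' : R -> Zd d -> R[i]) (f f' : Zd d -> R -> R[i]) (B CR : R).
Implicit Types (n : Zd d) (t : R).
Hypotheses (uB : forall t, l2_ball s B (fun n => cabs (u t n)))
  (u'B : forall t, l2_ball s B (fun n => cabs (u' t n)))
  (rB : forall t, l2_ball s B (fun n => cabs (r t n)))
  (r'B : forall t, l2_ball s B (fun n => cabs (r' t n))).
Hypothesis CR0 : 0 <= CR.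
Hypothesis rr'B : forall t q, l2_ball s q (fun n => cabs (u t n - u' t n)) ->
  l2_ball s (CR * q) (fun n => cabs (r t n - r' t n)).
Hypotheses (uc : forall n, ccont (fun t => u t n)) (u'c : forall n, ccont (fun t => u' t n)).
Hypotheses (ud : forall n t, 0 < t < T -> cderiv (fun t => u t n) t (f n t))
  (u'd : forall n t, 0 < t < T -> cderiv (fun t => u' t n) t (f' n t)).
Hypotheses (uu'0 : u 0 = u' 0)
  (fA : approx_field phi m u r f) (f'A : approx_field phi m u' r' f').

(** [4 * B] covers the four amplitudes, [1 + CR] the gaps divided by [g], in which the Lipschitz
    constant of the remainder appears. *)
Let C0 := 4 * B + 1 + CR + 1.
Let B0 : 0 <= B. Proof. by case: (uB 0). Qed.
Let C0_gt0 : 0 < C0. Proof. by rewrite /C0; have := B0; have := CR0; lra. Qed.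

Lemma diff_scale_l2 (g : R -> R) t : 0 < g t ->
  l2_ball s (g t) (fun n => cabs (u t n - u' t n)) ->
  l2_ball s C0 (diff_scale u u' r r' g t).
Proof.
move=> gt0 hg; have [_ _ ED EZ Ele] := l2_ball_norm d s.
have gi0 : 0 <= (g t)^-1 by rewrite invr_ge0 ltW.
have := ED _ _ _ _ (ED _ _ _ _ (ED _ _ _ _ (ED _ _ _ _ (uB t) (u'B t)) (rB t)) (r'B t))
  (EZ _ _ _ gi0 (ED _ _ _ _ hg (rr'B hg))).
move=> h; apply: Ele h _; rewrite mulrDr mulVf ?gt_eqF // mulrCA mulVf ?gt_eqF //.
rewrite /C0; lra.
Qed.

Variables (om omX : R -> R -> R).
Variables (c : R) (Cn : Zd d -> R) (b : R) (e : nat -> R -> R) (NR : nat -> R -> R -> bool).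
Hypotheses (c_gt0 : 0 < c) (Cn0 : forall n, 0 <= Cn n).
Hypothesis hmaj : forall K y, l2_ball s C0 y -> exists P F,
  majorants phi m s (level_coef c) om omX K (4 * C0) Cn y P F.
Hypotheses (b0 : 0 <= b) (hthr : thresholds (level_coef c) om omX b e NR).
Variable L : R.
Hypotheses (L0 : 0 < L) (bC : b * (4 * C0) <= 4^-1) (eC : e 0%N 0 * (4 * C0) <= 4^-1 * L).

Let lev0 i : 0 < level_coef c i.
Proof. by rewrite /level_coef divr_gt0 // exprn_gt0. Qed.

(** Cauchy-Schwarz in linearized form. With [h] the norm aimed at, the right side is affine in the
    sum of squares and can be absorbed. *)
Let young (F : seq (Zd d)) (x y : Zd d -> R) (q h : R) : 0 < q -> 0 < h ->
  \sum_(n <- F) y n ^+ 2 <= q ^+ 2 ->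
  \sum_(n <- F) x n * y n <= q * ((\sum_(n <- F) x n ^+ 2) / (2 * h) + h / 2).
Proof.
move=> q0 h0 hy.
apply: le_trans (_ : \sum_(n <- F) (q / (2 * h) * x n ^+ 2 + h / (2 * q) * y n ^+ 2) <= _).
  apply: ler_sum => n _.
  have -> : q / (2 * h) * x n ^+ 2 + h / (2 * q) * y n ^+ 2 =
      x n * y n + (q * x n - h * y n) ^+ 2 / (2 * h * q) by field; rewrite !gt_eqF.
  by rewrite lerDl divr_ge0 ?sqr_ge0 // !mulr_ge0 // ltW.
rewrite big_split /= -!mulr_sumr.
have hq : 0 <= h / (2 * q) by rewrite divr_ge0 ?mulr_ge0 // ltW.
have -> : q * ((\sum_(n <- F) x n ^+ 2) / (2 * h) + h / 2) =
    q / (2 * h) * \sum_(n <- F) x n ^+ 2 + h / (2 * q) * q ^+ 2 by field; rewrite !gt_eqF.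
by rewrite lerD2l ler_wpM2l.
Qed.

(** By [bC] and [eC], the boundary terms and the time integral contribute at most [4^-1 * W * g t1]
    each. As [g t1 = 2 * h], their sum [W * h] is [S / 2 + h ^ 2 / 2], and absorbing [S / 2] leaves
    [S <= h ^ 2] up to errors that vanish with [eta] and [2 ^- K]. *)
Lemma halving (G : R) : 0 < G ->
  (forall t, 0 <= t <= T -> l2_ball s (G * expR (L * t)) (fun n => cabs (u t n - u' t n))) ->
  forall t, 0 <= t <= T -> l2_ball s (G / 2 * expR (L * t)) (fun n => cabs (u t n - u' t n)).
Proof.
move=> G0 hG t1 ht1; have /andP[t10 t1T] := ht1.
pose g t := G * expR (L * t); have g0 t : 0 < g t by rewrite mulr_gt0 // expR_gt0.
pose v t n := u t n - u' t n.
set h := G / 2 * expR (L * t1).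
have h0 : 0 < h by rewrite mulr_gt0 ?expR_gt0 // divr_gt0.
have gh : g t1 = 2 * h by rewrite /h /g; field.
split=> [n||F uF]; [exact: cabs_ge0|exact: ltW|].
pose x n := bracketZ R n `^ s * cabs (v t1 n).
set S := \sum_(n <- F) _; rewrite -[_ ^+ 2]/(h ^+ 2).
have S0 : 0 <= S by apply: sumr_ge0 => n _; apply: sqr_ge0.
pose W := S / (2 * h) + h / 2.
have hW : W * h = S / 2 + h ^+ 2 / 2 by rewrite /W; field; rewrite gt_eqF.
have W0 : 0 <= W by rewrite addr_ge0 ?divr_ge0 ?mulr_ge0 // ltW.
(* Coefficients frozen at time [t1], whose pairing with [v t1] is [S]: the weighted norm is reached
   through one scalar function of time. *)
pose cf n : R[i] := (bracketZ R n `^ s ^+ 2)%:C * (v t1 n)^*.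
have cfE n : cabs (cf n) = bracketZ R n `^ s * x n.
  rewrite /cf cabsM cabs_real ger0_norm ?sqr_ge0 // [cabs _^*]cabsE.
  have -> : complex.Re (v t1 n)^* ^+ 2 + complex.Im (v t1 n)^* ^+ 2 =
      complex.Re (v t1 n) ^+ 2 + complex.Im (v t1 n) ^+ 2.
    by case: (v t1 n) => a a' /=; rewrite sqrrN.
  by rewrite -cabsE /x expr2 mulrA.
have cfv n : complex.Re (cf n * v t1 n) = x n ^+ 2.
  rewrite /cf -mulrA ReM_real /x exprMn; congr (_ * _).
  rewrite cabsE sqr_sqrtr ?addr_ge0 ?sqr_ge0 //; case: (v t1 n) => a a' /=; ring.
pose A1 := \sum_(n <- F) cabs (cf n) * Cn n.
pose A2 := \sum_(n <- F) cabs (cf n).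
have A10 : 0 <= A1 by apply: sumr_ge0 => n _; rewrite mulr_ge0 ?cabs_ge0.
have A20 : 0 <= A2 by apply: sumr_ge0 => n _; apply: cabs_ge0.
have T0 : 0 <= T by apply: le_trans t10 t1T.
pose gT := G * expR (L * T).
have gT0 : 0 < gT by rewrite mulr_gt0 // expR_gt0.
have key K eta : 0 < eta -> S <= h ^+ 2 + 2 * (T * (gT * (A1 / 2 ^+ K) + eta * A2)).
  move=> eta0.
  (* The majorants are chosen at each time separately, so they are not integrated in time: [halving]
     compares derivatives instead. *)
  have /choice[PF hPF] : forall t, exists PF : (nat -> nat -> R -> seq (Zd d) -> R) *
      (nat -> nat -> R -> seq (Zd d) -> R), 0 <= t <= T ->
      majorants phi m s (level_coef c) om omX K (4 * C0) Cn
        (diff_scale u u' r r' g t) PF.1 PF.2.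
    move=> t; have [ht|ht] := boolP (0 <= t <= T); last by exists (fun _ _ _ _ => 0, fun _ _ _ _ => 0).
    have [P [F' hPF]] := hmaj K (diff_scale_l2 (g0 t) (hG t ht)).
    by exists (P, F').
  have NF n := normal_form b0 lev0 hthr
    (diff_scale_ge0 u u' r r' g0) (fun t => ltW (g0 t)) (diff_prod_ccont uc u'c)
    (diff_prod0 uu'0) (diff_prod_cderiv ud u'd)
    (fun sg t _ => diff_prod_le u u' r r' g0 sg t)
    (diff_prod_expand T uB u'B fA f'A g0) hPF (leq0n K) [:: n] 0 eta0.
  have /choice[Bn hBn] : forall n, exists z : (R -> R[i]) * (R -> R[i]) * nat,
    [/\ ccont z.1.1, z.1.1 0 = 0, forall t, 0 < t < T -> cderiv z.1.1 t (z.1.2 t) &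
    forall l, (z.2 <= l)%N ->
      (forall t, 0 <= t <= T -> cabs (z.1.1 t) <= g t * (b * (PF t).1 l 0%N 0 [:: n])) /\
      (forall t, 0 < t < T -> cabs (f n t - f' n t - z.1.2 t) <=
        g t * (e 0%N 0 * (PF t).1 l 0%N 0 [:: n] +
               (4 ^+ K)^-1 * (PF t).2 l 0%N 0 [:: n]) + eta)].
    move=> n; have [Bn [dB [l0 [h1 h2 h3 h4]]]] := NF n.
    exists (Bn, dB, l0); split=> // l hl; have [h5 h6] := h4 l hl; split=> // t ht.
    have := h6 t ht; rewrite mulr0 expi0 mul1r expr0 div1r.
    by rewrite /diff_prod_deriv /= !lprod_nil !mulr1 !mulr0 !addr0.
  pose l := (\max_(n <- F) (Bn n).2)%N.
  pose P t n := (PF t).1 l 0%N 0 [:: n].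
  have hl n : n \in F -> ((Bn n).2 <= l)%N by move=> nF; apply: leq_bigmax_seq.
  have P2 t : 0 <= t <= T ->
      \sum_(n <- F) (bracketZ R n `^ s * P t n) ^+ 2 <= (4 * C0) ^+ 2.
    by move=> ht; have [_ _ hP] := maj_l2 (hPF t ht) l; apply: hP.
  have C40 : 0 < 4 * C0 by rewrite mulr_gt0.
  have sumP t : 0 <= t <= T -> \sum_(n <- F) cabs (cf n) * P t n <= 4 * C0 * W.
    move=> ht; have := young x C40 h0 (P2 t ht).
    by under eq_bigr => n _ do rewrite mulrCA mulrA -cfE.
  have e0 : 0 <= e 0%N 0.
    case: hthr => _ _ _ /(_ 0%N 0) + _.
    have : 0 < (level_coef c 0)^-1 by rewrite invr_gt0 lev0.
    lra.
  pose E := gT * (A1 / 2 ^+ K) + eta * A2.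
  have E0 : 0 <= E by rewrite addr_ge0 ?mulr_ge0 ?invr_ge0 ?exprn_ge0 // ltW.
  pose Hc t := \sum_(n <- F) cf n * (v t n - (Bn n).1.1 t).
  pose dHc t := \sum_(n <- F) cf n * (f n t - f' n t - (Bn n).1.2 t).
  (* An explicit primitive of the bound on the derivative. As [g' = L * g], the large factor [L]
     disappears on integration. *)
  pose Ph t := 4^-1 * W * g t + t * E.
  have dPh t : is_derive t 1 Ph (4^-1 * W * (L * g t) + E).
    have lin : is_derive t 1 (fun q => L * q) L.
      by have := is_derive_affine L 0 t; under eq_fun => q do rewrite addr0.
    have hex := @is_derive1_comp R _ _ t _ _ (is_derive_expR (L * t)) lin.
    have hg := is_derive_mul (is_derive_cst (4^-1 * W * G) t 1) hex.
    have hE := is_derive_mul (is_derive_id t (1 : R)) (is_derive_cst E t 1).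
    have := is_derive_add hg hE; rewrite mul0r add0r mulr0 addr0 mul1r.
    have -> : 4^-1 * W * G * (expR (L * t) * L) = 4^-1 * W * (L * g t) by rewrite /g; ring.
    congr is_derive; apply/funext => q; by rewrite /Ph /g mulrA.
  have dH t : 0 < t < t1 -> is_derive t 1 (fun q => complex.Re (Hc q) - Ph q)
      (complex.Re (dHc t) - (4^-1 * W * (L * g t) + E)).
    move=> /andP[ta tb]; have ht : 0 < t < T by rewrite ta (lt_le_trans tb).
    suff [dc _] : cderiv Hc t (dHc t) by exact: is_derive_sub dc (dPh t).
    apply: cderiv_sum => n; apply: cderivZ; apply: cderivB; last by case: (hBn n) => _ _ h1 _; apply: h1.
    exact: cderivB (ud n ht) (u'd n ht).
  have dH_le t : 0 < t < t1 -> complex.Re (dHc t) - (4^-1 * W * (L * g t) + E) <= 0.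
    move=> /andP[ta tb]; have ht : 0 < t < T by rewrite ta (lt_le_trans tb).
    have ht' : 0 <= t <= T by case/andP: ht => *; rewrite !ltW.
    rewrite subr_le0.
    apply: le_trans (_ : \sum_(n <- F) cabs (cf n) * (g t * (e 0%N 0 * P t n +
        Cn n / 2 ^+ K) + eta) <= _).
      rewrite /dHc Re_sum big_seq [leRHS]big_seq; apply: ler_sum => n nF.
      apply: le_trans (ler_norm _) _; apply: le_trans (cabs_Re _) _.
      rewrite cabsM ler_wpM2l ?cabs_ge0 //.
      have [_ _ _ /(_ _ (hl n nF))[_ /(_ t ht) hd]] := hBn n.
      apply: le_trans hd _; rewrite lerD2r ler_wpM2l ?(ltW (g0 t)) // lerD2l.
      rewrite ler_pdivrMl ?exprn_gt0 //; apply: le_trans (maj_point (hPF t ht') l n) _.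
      apply: ler_eq.
      have -> : 4 ^+ K = 2 ^+ K * 2 ^+ K :> R by rewrite -exprMn; congr (_ ^+ _); ring.
      by field; rewrite expf_neq0.
    have -> : \sum_(n <- F) cabs (cf n) * (g t * (e 0%N 0 * P t n + Cn n / 2 ^+ K) + eta) =
        g t * e 0%N 0 * (\sum_(n <- F) cabs (cf n) * P t n) + g t * (A1 / 2 ^+ K) + eta * A2.
      rewrite /A1 /A2 mulr_suml !mulr_sumr -!big_split; apply: eq_bigr => n _ /=; ring.
    have gtT : g t <= gT.
      by rewrite ler_wpM2l ?(ltW G0) // ler_expR ler_wpM2l ?(ltW L0) //; case/andP: ht'.
    have i1 : g t * (A1 / 2 ^+ K) <= gT * (A1 / 2 ^+ K).
      by rewrite ler_wpM2r // divr_ge0 // exprn_ge0.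
    have ge0 : 0 <= g t * e 0%N 0 by rewrite mulr_ge0 // ltW.
    have i2 := ler_wpM2l ge0 (sumP t ht').
    have i3 := ler_wpM2l (mulr_ge0 (ltW (g0 t)) W0) eC.
    rewrite /E; lra.
  have cH t : 0 <= t <= t1 -> {for t, continuous (fun q => complex.Re (Hc q) - Ph q)}.
    move=> _; apply: continuousB.
      suff [cR _] : ccont Hc by apply: cR.
      apply: ccont_sum => n; apply: ccontM; first exact: ccont_cst.
      by apply: ccontB; [exact: ccontB|case: (hBn n)].
    exact: is_derive_continuous (dPh t).
  have := derive_le0_le t10 dH dH_le cH.
  have -> : Hc 0 = 0.
    rewrite /Hc big1 // => n _; have [_ -> _ _] := hBn n.
    by rewrite /v uu'0 !subrr mulr0.
  have hB1 : \sum_(n <- F) cabs (cf n) * cabs ((Bn n).1.1 t1) <= 4^-1 * W * g t1.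
    apply: le_trans (_ : \sum_(n <- F) g t1 * b * (cabs (cf n) * P t1 n) <= _).
      rewrite big_seq [leRHS]big_seq; apply: ler_sum => n nF.
      have [_ _ _ /(_ _ (hl n nF))[/(_ t1 ht1) hb _]] := hBn n.
      apply: le_trans (ler_wpM2l (cabs_ge0 _) hb) _.
      by apply: ler_eq; rewrite /P; ring.
    rewrite -mulr_sumr.
    have gb0 : 0 <= g t1 * b by rewrite mulr_ge0 // ltW.
    have i2 := ler_wpM2l gb0 (sumP t1 ht1).
    have i3 := ler_wpM2l (mulr_ge0 (ltW (g0 t1)) W0) bC.
    lra.
  have -> : complex.Re (Hc t1) = S - \sum_(n <- F) complex.Re (cf n * (Bn n).1.1 t1).
    rewrite /Hc Re_sum -sumrB; apply: eq_bigr => n _.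
    by rewrite mulrBr ReD ReN cfv.
  have : \sum_(n <- F) complex.Re (cf n * (Bn n).1.1 t1) <=
      \sum_(n <- F) cabs (cf n) * cabs ((Bn n).1.1 t1).
    apply: ler_sum => n _; rewrite -cabsM; apply: le_trans (cabs_Re _); exact: ler_norm.
  have Ph0 : 0 <= Ph 0.
    by rewrite /Ph mul0r addr0 !mulr_ge0 ?invr_ge0 // ltW.
  have hP1 : Ph t1 <= 4^-1 * W * g t1 + T * E by rewrite lerD2l ler_wpM2r.
  move: hB1 hP1; rewrite gh -[complex.Re 0]/0.
  have -> : 4^-1 * W * (2 * h) = S / 4 + h ^+ 2 / 4 
    by transitivity (2^-1 * (W * h)); [field|rewrite hW; field].
  rewrite /E; lra.
have alg (a b1 a1 q z' a2 : R) : 2 * (a * (b1 * (a1 * q) + z' * a2)) =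
    2^-1 * (4 * (a * (b1 * a1)) * q) + 2^-1 * (z' * (4 * (a * a2) + 1)) - 2^-1 * z' by field.
have fin (a q z' y : R) : a <= y -> q = y -> 0 < z' ->
    2^-1 * a + 2^-1 * q - 2^-1 * z' <= y by lra.
apply/ler_addgt0Pr => z z0.
(* With this [eta] and the [K] below, each of the two error terms is at most [z / 2]. *)
pose eta := z / (4 * (T * A2) + 1).
have d0 : 0 < 4 * (T * A2) + 1 by rewrite ltr_wpDl // !mulr_ge0.
have eta0 : 0 < eta by rewrite divr_gt0.
pose y := 4 * (T * (gT * A1)) / z.
have y0 : 0 <= y by rewrite divr_ge0 ?(ltW z0) // !mulr_ge0 // ltW.
have hy := archi_boundP y0; set K := Num.bound y in hy.
have h2 := key K eta eta0; apply: le_trans h2 _; rewrite lerD2l.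
have h3 : y <= 2 ^+ K.
  by apply: le_trans (ltW hy) _; rewrite -natrX ler_nat ltnW // ltn_expl.
have K0 : 0 < 2 ^+ K :> R by rewrite exprn_gt0.
have h4 : 4 * (T * (gT * A1)) / 2 ^+ K <= z.
  by move: h3; rewrite /y ler_pdivrMr // ler_pdivrMr // (mulrC z).
have h5 : eta * (4 * (T * A2) + 1) = z by rewrite /eta divfK // gt_eqF.
rewrite alg; exact: fin h4 h5 eta0.
Qed.

End Halving.

(** * Reduction of (A) and (B) to majorants and thresholds *)

Section Conditions.
Variables (R : realType) (d p : nat) (s : R).
Variables (phi : Zd d -> tuples d p -> R) (m : Zd d -> tuples d p -> R[i]).
Variables (X : completeNormedModType R[i]) (ev : X -> (Zd d -> R[i])).
Hypotheses (hX : function_space ev) (hsolid : solid (embedded ev)).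

(** (A3) or (B3) read at one frequency through the point evaluations of X; this is the input for the
    uniform tails and the continuity of the right-hand side. *)
Lemma pointwise_bound C : 0 < C ->
  multilinear_bound (@decomp d p) (fun n k => cabs (m n k)) C (fun=> l2 d s) (embedded ev) ->
  forall n, exists c : R, 0 <= c /\ forall r y, l2_ball s r y ->
    forall t : seq (tuples d p), finite_decomp n t ->
    \sum_(k <- t) cabs (m n k) * lprod y (children k) <= c * r ^+ p.
Proof.
move=> C0 hb n; have [cn [cn0 hcn]] := X_ball_point hX hsolid.
exists (cn n * C); split; first by rewrite mulr_ge0 // ltW.
move=> r y yr t [ut tD].
have [h1 h2] := multi_op_l2X (fun n k => cabs_ge0 (m n k)) (ltW C0) hb yr.
by apply: le_trans (h2 n t ut tD) _; rewrite -mulrA; apply: hcn.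
Qed.

Lemma conditions_majorants :
  condition_A s phi m (embedded ev) \/ condition_B s phi m (embedded ev) ->
  exists om omX, has_majorants phi m s om omX /\
    forall c b : R, 0 < c -> c <= 1 -> 0 < b -> b <= 1 ->
      exists e NR, thresholds (level_coef c) om omX b e NR.
Proof.
case=> [[de [C [hde C0 A1 A2 A3]]]|[s1 [s2 [C [hs C0 [B1 B1'] [B2 B2'] B3]]]]].
  exists (fun _ f => 2^-1 * (1 + `|f|) `^ (- 2^-1)).
  exists (fun _ f => 2^-1 * (1 + `|f|) `^ (- (1 - de))).
  split; first exact: (majorants_A hX hsolid hde C0 A1 A2 A3).
  by move=> c b c0 c1 b0 b1; case/andP: hde => *; apply: thresholds_A.
have [q [th [q0 th0 th1 hm]]] := majorants_B hX hsolid hs C0 B1 B1' B2 B2' B3.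
pose om (al f : R) := q * (3 + `|al + f|) `^ (- th); exists om, om; split; first exact: hm.
by move=> c b c0 c1 b0 b1; apply: thresholds_B.
Qed.

End Conditions.

Lemma l2_ball_halved_eq0 (R : realType) (d : nat) (s r : R) (y : Zd d -> R) :
  (forall k, l2_ball s (r / 2 ^+ k) y) -> forall n, y n = 0.
Proof.
move=> hk n; have [y0 r0 _] := hk 0%N; rewrite divr1 in r0.
have b0 : 0 < bracketZ R n `^ s by rewrite powR_gt0 // bracketZ_gt0.
apply/eqP; rewrite eq_le y0 andbT leNgt; apply/negP => yn.
pose a := bracketZ R n `^ s * y n; have a0 : 0 < a by apply: mulr_gt0.
have hr : 0 <= r / a by rewrite divr_ge0 // ltW.
have h1 := archi_boundP hr; set K := Num.bound _ in h1.
have := l2_ball_point n (hk K); rewrite leNgt => /negP; apply.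
rewrite ltr_pdivrMr ?exprn_gt0 // -ltr_pdivrMl // mulrC; apply: lt_trans h1 _.
by rewrite -natrX ltr_nat ltn_expl.
Qed.

Theorem theorem1p1 (R : realType) (d p : nat) (s T : R)
    (hd : (1 <= d)%N) (hp : (2 <= p)%N) (hT : 0 < T)
    (phi : Zd d -> tuples d p -> R) (m : Zd d -> tuples d p -> R[i])
    (Rem : (R -> Zd d -> R[i]) -> (R -> Zd d -> R[i]))
    (hRem : admissible_remainder T s Rem)
    (X : completeNormedModType R[i]) (ev : X -> (Zd d -> R[i]))
    (hX : function_space ev) (hXsolid : solid (embedded ev))
    (hAB : condition_A s phi m (embedded ev) \/
           condition_B s phi m (embedded ev)) :
  forall w0 : Zd d -> R[i], l2 d s w0 ->
  forall w w' : R -> Zd d -> R[i],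
    solution T s phi m Rem w0 w -> solution T s phi m Rem w0 w' ->
    forall t : R, t \in `[0, T] -> w t = w' t.
Proof.
move=> w0 _ w w' sol sol'; have T0 := ltW hT.
have [om [omX [hmaj hthr]]] := conditions_majorants hX hXsolid hAB.
have hm : forall n, exists c : R, 0 <= c /\ forall r y, l2_ball s r y ->
    forall t : seq (tuples d p), finite_decomp n t ->
    \sum_(k <- t) cabs (m n k) * lprod y (children k) <= c * r ^+ p.
  by case: hAB => [[? [C [_ C0 _ _ A3]]]|[? [? [C [_ C0 _ _ B3]]]]];
    apply: (pointwise_bound hX hXsolid C0).
have [cw _ _ w_0] := sol; have [cw' _ _ w'_0] := sol'.
have [R1 _ _ _] := hRem; have cr := R1 _ cw; have cr' := R1 _ cw'.
have [_ _ _ _ Ele] := l2_ball_norm d s.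
have bounded (v : R -> Zd d -> R[i]) : CTl2 T s v -> exists B : R, 0 <= B /\
    forall t, l2_ball s B (fun n => cabs (v (clamp T t) n)).
  move=> cv; have [B [B0 hB]] := CTl2_bounded T0 cv; exists B; split=> // t.
  apply/l2_ballP => //; split; last exact/hB/clamp_itv.
  by have [] := cv _ (clamp_itv T0 t).
have [B1 [B10 h1]] := bounded _ cw; have [B2 [B20 h2]] := bounded _ cw'.
have [B3 [B30 h3]] := bounded _ cr; have [B4 [B40 h4]] := bounded _ cr'.
pose B := B1 + B2 + B3 + B4.
have uB t := Ele _ B _ (h1 t) ltac:(rewrite /B; lra).
have u'B t := Ele _ B _ (h2 t) ltac:(rewrite /B; lra).
have rB t := Ele _ B _ (h3 t) ltac:(rewrite /B; lra).
have r'B t := Ele _ B _ (h4 t) ltac:(rewrite /B; lra).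
have B0 : 0 <= B by rewrite /B; lra.
have [CR [CR0 hCR]] := remainder_lipschitz T0 hRem cw cw'.
have rr'B t q : l2_ball s q (fun n => cabs (w (clamp T t) n - w' (clamp T t) n)) ->
    l2_ball s (CR * q) (fun n => cabs (Rem w (clamp T t) n - Rem w' (clamp T t) n)).
  have ct := clamp_itv T0 t; have [a1 _] := cr _ ct; have [a2 _] := cr' _ ct.
  move=> hq; have [_ q0 _] := hq; apply: Ele (l2_ball_snorm (l2_sub a1 a2)) _.
  apply: le_trans (hCR _ ct) _; apply: ler_wpM2l => //.
  by apply: (proj2 ((l2_ballP s _ q0).2 _)).
pose C0 := 4 * B + 1 + CR + 1.
have C00 : 0 < C0 by rewrite /C0; lra.
have [c [Cn [c0 c1 Cn0 hK]]] := hmaj C0 C00.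
(* [b] depends on [C0] alone and precedes the thresholds, whose error at level 0 then fixes [L]. *)
pose b := (16 * C0 + 1)^-1.
have b0 : 0 < b by rewrite invr_gt0; lra.
have b1 : b <= 1 by rewrite invf_le1; lra.
have [e [NR thr]] := hthr c b c0 c1 b0 b1.
have e0 : 0 <= e 0%N 0.
  case: thr => _ _ _ /(_ 0%N 0) + _.
  have : 0 < (level_coef c 0)^-1 by rewrite invr_gt0 divr_gt0.
  lra.
pose L := 16 * (e 0%N 0 * C0) + 1.
have L0 : 0 < L by rewrite ltr_wpDl // !mulr_ge0 // ltW.
have bC : b * (4 * C0) <= 4^-1 by rewrite ler_pdivrMl; lra.
have eC : e 0%N 0 * (4 * C0) <= 4^-1 * L by rewrite /L; lra.
have c00 : clamp T 0 = 0 by rewrite clamp_id // lexx.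
have uu'0 : w (clamp T 0) = w' (clamp T 0) by rewrite c00 w_0 w'_0.
have half := halving uB u'B rB r'B CR0 rr'B (curve_ccont hT sol) (curve_ccont hT sol')
  (curve_cderiv hT hm sol cr) (curve_cderiv hT hm sol' cr') uu'0
  (field_approx hT hm sol) (field_approx hT hm sol') c0 Cn0 hK (ltW b0) thr L0 bC eC.
pose v t n := cabs (w (clamp T t) n - w' (clamp T t) n).
(* The iteration starts from boundedness alone: the difference has norm at most [2 * B], and adding
   1 keeps the constant positive. *)
have G0 : 0 < 2 * B + 1 by lra.
have iter k t : 0 <= t <= T -> l2_ball s ((2 * B + 1) / 2 ^+ k * expR (L * t)) (v t).
  elim: k t => [|k IH] t ht.
    have [_ _ ED _ _] := l2_ball_norm d s.
    apply: l2_ball_le (_ : l2_ball s _ (fun n => cabs (w (clamp T t) n) +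
        cabs (w' (clamp T t) n))) _; last by move=> n; rewrite cabs_ge0 cabsB.
    apply: Ele (ED _ _ _ _ (uB t) (u'B t)) _; rewrite divr1.
    have : 1 <= expR (L * t).
      by rewrite -expR0 ler_expR mulr_ge0 ?(ltW L0) //; case/andP: ht.
    by move=> h6; have := ler_wpM2l (ltW G0) h6; lra.
  rewrite exprSr invfM mulrA.
  by apply: half ht => //; rewrite divr_gt0 // exprn_gt0.
move=> t ht; apply/funext => n; apply/eqP; rewrite -subr_eq0; apply/eqP/cabs0_eq0.
have := @l2_ball_halved_eq0 R d s ((2 * B + 1) * expR (L * t)) (v t) _ n.
rewrite /v clamp_id //; apply=> k.
by have := iter k t ht; rewrite /v clamp_id // mulrAC.
Qed.
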